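(* Let $1\le p<\infty$, let $m:=[p]$ be the integer part of $p$, and let $n\in\mathbb{N}$ with $n>m$. Let $\mathbf{X}^{(m)}:[0,T]\to G^{(m)}(\mathbb{R}^d)$ be a càdlàg path with $\mathbf X^{(m)}_0=1$, of finite $p$-variation with respect to the Carnot--Caratheodory metric on $G^{(m)}(\mathbb{R}^d)$. Then there exists a càdlàg path $\mathbf{X}^{(n)}:[0,T]\to G^{(n)}(\mathbb{R}^d)\subset T^{(n)}(\mathbb{R}^d)$ extending $\mathbf{X}^{(m)}$ (i.e. whose projection to $T^{(m)}(\mathbb{R}^d)$ is $\mathbf{X}^{(m)}$), starting from $1$, of finite $p$-variation with respect to the Carnot--Caratheodory metric on $G^{(n)}(\mathbb{R}^d)$, and such that $$\log^{(n)}\Delta_t\mathbf{X}^{(n)}=\log^{(m)}\Delta_t\mathbf{X}^{(m)}\qquad\text{for all } t\in(0,T].$$ Moreover, $\mathbf{X}^{(n)}$ is the unique extension of $\mathbf{X}^{(m)}$ with these properties.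
   Context: $T^{(k)}(\mathbb{R}^d)=\bigoplus_{j=0}^k(\mathbb{R}^d)^{\otimes j}$ is the truncated tensor algebra with truncated tensor product $\otimes$; $\exp^{(k)}$ and $\log^{(k)}$ are the usual power series in it. $\mathfrak{g}^{(k)}\subset T^{(k)}(\mathbb{R}^d)$ is the free step-$k$ nilpotent Lie algebra generated by $\mathbb{R}^d$ (with bracket $[a,b]=a\otimes b-b\otimes a$), and $G^{(k)}=G^{(k)}(\mathbb{R}^d)=\exp^{(k)}(\mathfrak{g}^{(k)})$ is the free step-$k$ nilpotent Lie group. For $k\ge m$, $\mathfrak{g}^{(m)}$ is regarded as a linear subspace of $\mathfrak{g}^{(k)}$ in the obvious way (setting tensor components of levels $m+1,\dots,k$ to zero). The Carnot--Caratheodory (CC) norm $\|g\|_{CC}$ of $g\in G^{(k)}$ is the infimum of the lengths of finite-length curves $\gamma:[0,1]\to\mathbb{R}^d$ whose step-$k$ signature (sequence of iterated integrals up to level $k$) equals $g$; the CC metric is $d_{CC}(g,h)=\|g^{-1}\otimes h\|_{CC}$. A path $\mathbf X$ in $G^{(k)}$ has finite $p$-variation if $\sup_{\mathcal P}\sum_{[s,t]\in\mathcal P} d_{CC}(\mathbf X_s,\mathbf X_t)^p<\infty$, the supremum being over finite partitions of $[0,T]$. Jumps are $\Delta_t\mathbf{X}:=\mathbf{X}_{t-}^{-1}\otimes\mathbf{X}_t$, where $\mathbf X_{t-}=\lim_{s\uparrow t}\mathbf X_s$. *)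

(* Defs.v *)
From HB Require Import structures.
From mathcomp Require Import all_boot all_order all_algebra.
From mathcomp Require Import all_classical all_reals all_analysis.

Set Implicit Arguments.
Unset Strict Implicit.
Unset Printing Implicit Defensive.

Import Order.TTheory GRing.Theory Num.Theory.
Import numFieldNormedType.Exports.

Local Open Scope classical_set_scope.
Local Open Scope ring_scope.

(** * The truncated tensor algebra T^(k)(F^d)

    An element is given by its coordinates on the basis
    e_{i_1} (x) ... (x) e_{i_j}, j <= k, i.e. by a function on the words of
    length at most k over 'I_d.  The record keeps the concatenation product
    apart from the pointwise product that {ffun _ -> _} carries. *)

Record tensor (F : fieldType) (d k : nat) : Type :=
  Tensor { tensor_val : {ffun k.-bseq 'I_d -> F} }.

HB.instance Definition _ (F : fieldType) (d k : nat) :=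
  [isNew for @tensor_val F d k].
HB.instance Definition _ (F : fieldType) (d k : nat) :=
  [Choice of tensor F d k by <:].

(** [x s] is the coordinate of [x] on the word [s], zero above level k. *)
Definition tcoef (F : fieldType) (d k : nat) (x : tensor F d k)
    (s : seq 'I_d) : F :=
  if (size s <= k)%N then tensor_val x (insub_bseq k s) else 0.
Coercion tcoef : tensor >-> Funclass.

Definition mkt (F : fieldType) (d k : nat) (f : seq 'I_d -> F) : tensor F d k :=
  Tensor [ffun w : k.-bseq 'I_d => f w].

Section TensorAlgebra.
Variables (F : fieldType) (d k : nat).
Implicit Types (x y z : tensor F d k) (s : seq 'I_d) (a b : F).

Lemma mktE (f : seq 'I_d -> F) s :
  mkt k f s = if (size s <= k)%N then f s else 0.
Proof.
rewrite /tcoef /=; case: ifP => // hs.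
by rewrite ffunE /insub_bseq /insubd insubT.
Qed.

Lemma tcoef_gt x s : (k < size s)%N -> x s = 0.
Proof. by rewrite /tcoef ltnNge => /negbTE ->. Qed.

Lemma tensorP x y : (forall s, (size s <= k)%N -> x s = y s) -> x = y.
Proof.
case: x y => x [y] h; congr Tensor; apply/ffunP => w.
have := h w (size_bseq w); rewrite /tcoef size_bseq /=.
by rewrite /insub_bseq valKd.
Qed.

Definition tzero : tensor F d k := mkt k (fun=> 0).
Definition tadd x y : tensor F d k := mkt k (fun s => x s + y s).
Definition topp x : tensor F d k := mkt k (fun s => - x s).
Definition tscale a x : tensor F d k := mkt k (fun s => a * x s).
Definition tone : tensor F d k := mkt k (fun s => (s == [::])%:R).
Definition tmul x y : tensor F d k :=
  mkt k (fun s => \sum_(i < (size s).+1) x (take i s) * y (drop i s)).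

Fact taddA : associative tadd.
Proof. by move=> x y z; apply: tensorP => s hs; rewrite !mktE hs addrA. Qed.
Fact taddC : commutative tadd.
Proof. by move=> x y; apply: tensorP => s hs; rewrite !mktE hs addrC. Qed.
Fact tadd0 : left_id tzero tadd.
Proof. by move=> x; apply: tensorP => s hs; rewrite !mktE hs add0r. Qed.
Fact taddN : left_inverse tzero topp tadd.
Proof. by move=> x; apply: tensorP => s hs; rewrite !mktE hs addNr. Qed.

HB.instance Definition _ :=
  GRing.isZmodule.Build (tensor F d k) taddA taddC tadd0 taddN.

Lemma tcoef0 s : (0 : tensor F d k) s = 0.
Proof. by rewrite mktE; case: ifP. Qed.
Lemma tcoefD x y s : (x + y) s = x s + y s.
Proof. by rewrite mktE; case: leqP => // h; rewrite !tcoef_gt ?addr0. Qed.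
Lemma tcoefN x s : (- x) s = - x s.
Proof. by rewrite mktE; case: leqP => // h; rewrite !tcoef_gt ?oppr0. Qed.

Fact tscaleA a b x : tscale a (tscale b x) = tscale (a * b) x.
Proof. by apply: tensorP => s hs; rewrite !mktE hs mulrA. Qed.
Fact tscale1 : left_id 1 tscale.
Proof. by move=> x; apply: tensorP => s hs; rewrite !mktE hs mul1r. Qed.
Fact tscaleDr : right_distributive tscale +%R.
Proof.
by move=> a x y; apply: tensorP => s hs; rewrite !(mktE, tcoefD) hs mulrDr.
Qed.
Fact tscaleDl x : {morph tscale^~ x : a b / a + b}.
Proof.
by move=> a b; apply: tensorP => s hs; rewrite !(mktE, tcoefD) hs mulrDl.
Qed.

HB.instance Definition _ := GRing.Zmodule_isLmodule.Build F (tensor F d k)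
  tscaleA tscale1 tscaleDr tscaleDl.

Lemma tcoefZ a x s : (a *: x) s = a * x s.
Proof. by rewrite mktE; case: leqP => // h; rewrite !tcoef_gt ?mulr0. Qed.

Let leq_take (s : seq 'I_d) i : (size s <= k)%N -> (size (take i s) <= k)%N.
Proof. by move=> h; rewrite size_take_min (leq_trans _ h)// geq_minr. Qed.
Let leq_drop (s : seq 'I_d) i : (size s <= k)%N -> (size (drop i s) <= k)%N.
Proof. by move=> h; rewrite size_drop (leq_trans (leq_subr _ _)). Qed.

Fact tmulA : associative tmul.
Proof.
move=> x y z; apply: tensorP => s hs; rewrite !mktE hs; set n := size s.
pose G i j := x (take i s) * (y (take j (drop i s)) * z (drop (i + j) s)).
transitivity (\sum_(i < n.+1) \sum_(j < n.+1 | (j <= n - i)%N) G i j).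
  apply: eq_bigr => i _; rewrite mktE leq_drop// big_distrr/= size_drop.
  rewrite (big_ord_narrow_leq (leq_subr _ _)) /=.
  by apply: eq_bigr => j _; rewrite /G drop_drop addnC.
transitivity (\sum_(i < n.+1) \sum_(l < n.+1 | (i <= l)%N) G i (l - i)%N).
  apply: eq_bigr => i _.
  rewrite -(big_mkord (fun j => (j <= n - i)%N) (G i)).
  rewrite -(big_mkord (fun l => (i <= l)%N) (fun l => G i (l - i)%N)).
  have hi : (i <= n.+1)%N by apply: ltnW.
  rewrite [RHS](big_cat_nat (n := i))//= [X in X + _]big1_seq ?add0r; last first.
    move=> l; rewrite mem_index_iota => /andP[h] /andP[_ h'].
    by move: h; rewrite leqNgt h'.
  rewrite -{3}[val i]add0n big_addn.
  rewrite (@big_cat_nat _ _ _ (n.+1 - i)%N)/= ?leq_subr//.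
  rewrite [X in _ + X]big1_seq ?addr0; last first.
    move=> l; rewrite mem_index_iota => /andP[h] /andP[h' _].
    by have := leq_trans h' h; rewrite subSn -1?ltnS// ltnn.
  rewrite big_nat_cond [RHS]big_nat_cond; apply: congr_big => //.
    move=> l; rewrite leq_addl andbT leq0n/=.
    by rewrite subSn -1?ltnS// andbb.
  by move=> l _; rewrite addnK.
rewrite (exchange_big_dep predT)//=; apply: eq_bigr => l _.
rewrite mktE leq_take// big_distrl/= size_take_min.
have hl : (l <= n)%N by rewrite -ltnS.
rewrite (minn_idPl hl) (big_ord_narrow_leq hl)/=.
apply: eq_bigr => i _.
have hil : (i <= l)%N by rewrite -ltnS.
rewrite /G subnKC// mulrA take_takel//; congr (_ * _ * _).
by rewrite take_drop subnK.
Qed.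

Fact tmul1x : left_id tone tmul.
Proof.
move=> x; apply: tensorP => s hs; rewrite mktE hs big_ord_recl/= take0 drop0.
rewrite mktE/= mul1r big1 ?addr0// => i _; rewrite mktE leq_take//.
case: s hs i => [|c s] hs i; first by case: i.
by rewrite /= mul0r.
Qed.

Fact tmulx1 : right_id tone tmul.
Proof.
move=> x; apply: tensorP => s hs; rewrite mktE hs big_ord_recr/=.
rewrite take_size drop_size mktE/= mulr1 big1 ?add0r// => i _.
rewrite mktE leq_drop// -size_eq0 size_drop subn_eq0 leqNgt ltn_ord.
by rewrite mulr0.
Qed.

Fact tmulDl : left_distributive tmul +%R.
Proof.
move=> x y z; apply: tensorP => s hs; rewrite tcoefD !mktE hs -big_split/=.
by apply: eq_bigr => i _; rewrite tcoefD mulrDl.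
Qed.

Fact tmulDr : right_distributive tmul +%R.
Proof.
move=> x y z; apply: tensorP => s hs; rewrite tcoefD !mktE hs -big_split/=.
by apply: eq_bigr => i _; rewrite tcoefD mulrDr.
Qed.

Fact tone_neq0 : tone != 0.
Proof.
apply/eqP => /(congr1 (fun x : tensor F d k => x [::])).
by rewrite mktE tcoef0/= => /eqP; rewrite oner_eq0.
Qed.

HB.instance Definition _ := GRing.Zmodule_isNzRing.Build (tensor F d k)
  tmulA tmul1x tmulx1 tmulDl tmulDr tone_neq0.

Lemma tcoef1 s : (1 : tensor F d k) s = (s == [::])%:R.
Proof. by rewrite mktE; case: s => // c s; case: ifP. Qed.

Lemma tcoefM x y s : (size s <= k)%N ->
  (x * y) s = \sum_(i < (size s).+1) x (take i s) * y (drop i s).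
Proof. by move=> hs; rewrite mktE hs. Qed.

Lemma tcoefM0 x y : (x * y) [::] = x [::] * y [::].
Proof. by rewrite tcoefM// big_ord_recl big_ord0 addr0. Qed.

Fact tscaleAl a x y : a *: (x * y) = (a *: x) * y.
Proof.
apply: tensorP => s hs; rewrite tcoefZ !tcoefM// big_distrr/=.
by apply: eq_bigr => i _; rewrite tcoefZ mulrA.
Qed.

HB.instance Definition _ :=
  GRing.Lmodule_isLalgebra.Build F (tensor F d k) tscaleAl.

Fact tscaleAr a x y : a *: (x * y) = x * (a *: y).
Proof.
apply: tensorP => s hs; rewrite tcoefZ !tcoefM// big_distrr/=.
by apply: eq_bigr => i _; rewrite tcoefZ mulrCA.
Qed.

HB.instance Definition _ :=
  GRing.Lalgebra_isAlgebra.Build F (tensor F d k) tscaleAr.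

Lemma tcoefX_lt x s n : x [::] = 0 -> (size s < n)%N -> (x ^+ n) s = 0.
Proof.
move=> x0; elim: n s => // n IH s hs; have [hk|hk] := leqP (size s) k; last first.
  by rewrite tcoef_gt.
rewrite exprS tcoefM// big_ord_recl take0 x0 mul0r add0r big1// => i _.
rewrite IH ?mulr0// size_drop /= /bump leq0n add1n.
by case: (size s) hs i => [_ []//|l hl i]; rewrite subSS (leq_ltn_trans (leq_subr _ _)).
Qed.

Lemma texpr_gt x n : x [::] = 0 -> (k < n)%N -> x ^+ n = 0.
Proof.
move=> x0 hn; apply: tensorP => s hs.
by rewrite tcoef0 tcoefX_lt// (leq_ltn_trans hs).
Qed.

(** The invertible elements are those with nonzero scalar component; their
    inverse is given by the (terminating) geometric series. *)
Definition tunit : pred (tensor F d k) := fun x => x [::] != 0.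
Definition tgeom x : tensor F d k := \sum_(i < k.+1) (1 - x) ^+ i.
Definition tinv x : tensor F d k :=
  if tunit x then (x [::])^-1 *: tgeom ((x [::])^-1 *: x) else x.

Lemma tgeomP x : x [::] = 1 -> x * tgeom x = 1 /\ tgeom x * x = 1.
Proof.
move=> x1; have e : x * tgeom x = 1.
  have := subrX1 (1 - x) k.+1.
  rewrite texpr_gt ?tcoefD ?tcoefN ?tcoef1 ?x1 ?subrr//.
  by rewrite addrAC subrr !sub0r mulNr => /oppr_inj.
split=> //; rewrite -[RHS]e /tgeom; apply/esym.
apply: commr_sum => i _; apply: commrX; apply: commrB => //.
exact: commr1.
Qed.

Fact tmulVx : {in tunit, left_inverse 1 tinv *%R}.
Proof.
move=> x ux; have u0 : x [::] != 0 by [].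
rewrite /tinv [tunit x]u0 -scalerAl scalerAr.
by have [|_ ->] := @tgeomP ((x [::])^-1 *: x); rewrite ?tcoefZ ?mulVf.
Qed.

Fact tmulxV : {in tunit, right_inverse 1 tinv *%R}.
Proof.
move=> x ux; have u0 : x [::] != 0 by [].
rewrite /tinv [tunit x]u0 -scalerAr scalerAl.
by have [|-> _] := @tgeomP ((x [::])^-1 *: x); rewrite ?tcoefZ ?mulVf.
Qed.

Fact tunitP x y : y * x = 1 /\ x * y = 1 -> tunit x.
Proof.
move=> [/(congr1 (fun x : tensor F d k => x [::]))].
rewrite tcoefM0 tcoef1/= => h _; apply/eqP => x0.
by move: h; rewrite x0 mulr0 => /esym/eqP; rewrite oner_eq0.
Qed.

Fact tinv_out : {in [predC tunit], tinv =1 id}.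
Proof. by move=> x ux; rewrite /tinv ifN. Qed.

HB.instance Definition _ := GRing.NzRing_hasMulInverse.Build (tensor F d k)
  tmulVx tmulxV tunitP tinv_out.

End TensorAlgebra.

(** Used with [l <= k] this is the projection T^(k) -> T^(l); with [k <= l]
    it is the inclusion T^(k) -> T^(l) as a linear subspace, the levels
    k+1, ..., l being set to zero. *)
Definition tresize (F : fieldType) (d k l : nat) (x : tensor F d k) :
  tensor F d l := mkt l x.

Definition tvec (F : fieldType) (d k : nat) (v : 'rV[F]_d) : tensor F d k :=
  mkt k (fun s => if s is [:: i] then v 0 i else 0).

(** The power series are cut at degree k: they are meant for arguments [x] of
    [texp] with zero scalar component and [x] of [tlog] with scalar component
    one, for which the higher powers vanish (lemma [texpr_gt]). *)
Definition texp (F : fieldType) (d k : nat) (x : tensor F d k) : tensor F d k :=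
  \sum_(0 <= i < k.+1) (i`!%:R)^-1 *: x ^+ i.

Definition tlog (F : fieldType) (d k : nat) (x : tensor F d k) : tensor F d k :=
  \sum_(1 <= i < k.+1) ((-1) ^+ i.+1 / i%:R) *: (x - 1) ^+ i.

(** Lie subalgebra of T^(k)(F^d) generated by F^d. *)
Inductive free_lie (F : fieldType) (d k : nat) : set (tensor F d k) :=
| free_lie_vec (v : 'rV[F]_d) : free_lie (tvec k v)
| free_lie_lin (a : F) (x y : tensor F d k) :
    free_lie x -> free_lie y -> free_lie (a *: x + y)
| free_lie_bracket (x y : tensor F d k) :
    free_lie x -> free_lie y -> free_lie (x * y - y * x).

Definition free_group (F : fieldType) (d k : nat) : set (tensor F d k) :=
  @texp F d k @` @free_lie F d k.

(** * Signatures and the Carnot-Caratheodory metric *)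

Section Paths.
Variable R : realType.

(** [v] is the Riemann-Stieltjes integral of [f] against [g] over [a, b]: the
    limit of the tagged sums along the partitions
    a = t_0 < t_1 < ... < t_(size s) = b with t_(i+1) = s`_i, as the mesh
    tends to 0. *)
Definition is_RS_integral (f g : R -> R) (a b v : R) : Prop :=
  forall e : R, 0 < e -> exists2 delta : R, 0 < delta &
    forall (s : seq R) (c : nat -> R), itv_partition a b s ->
      (forall i, (i < size s)%N ->
        nth b s i - nth b (a :: s) i < delta /\
        nth b (a :: s) i <= c i <= nth b s i) ->
      `| \sum_(0 <= i < size s) f (c i) * (g (nth b s i) - g (nth b (a :: s) i))
         - v | < e.

Definition RS_integral (f g : R -> R) (a b : R) : R :=
  xget 0 [set v | is_RS_integral f g a b v].

(** The word is read from its last letter: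
    [iter_int gamma [:: i_j; ...; i_1] t] is the integral of
    dgamma^{i_1}_{t_1} ... dgamma^{i_j}_{t_j} over 0 < t_1 < ... < t_j < t. *)
Fixpoint iter_int (d : nat) (gamma : R -> 'rV[R]_d) (u : seq 'I_d) (t : R) : R :=
  if u is i :: u' then
    RS_integral (iter_int gamma u') (fun s => gamma s 0 i) 0 t
  else 1.

Definition signature (d k : nat) (gamma : R -> 'rV[R]_d) : tensor R d k :=
  mkt k (fun s => iter_int gamma (rev s) 1).

(** Supremum over the partitions of [a, b] of the sum of [D s t] over the
    intervals [s, t] of the partition. *)
Definition partition_sup (D : R -> R -> \bar R) (a b : R) : \bar R :=
  ereal_sup [set (\sum_(0 <= i < size s) D (nth b (a :: s) i) (nth b s i))%E
            | s in itv_partition a b].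

(** The library norm on 'rV[R]_d is the sup norm. *)
Definition euclid_norm (d : nat) (v : 'rV[R]_d) : R :=
  Num.sqrt (\sum_(i < d) v 0 i ^+ 2).

Definition curve_length (d : nat) (gamma : R -> 'rV[R]_d) : \bar R :=
  partition_sup (fun s t => (euclid_norm (gamma t - gamma s))%:E) 0 1.

(** The value is +oo when [g] is not the signature of any such curve. *)
Definition CC_norm (d k : nat) (g : tensor R d k) : \bar R :=
  ereal_inf [set curve_length gamma | gamma in
    [set gamma : R -> 'rV[R]_d |
      [/\ {within `[0, 1], continuous gamma},
          (curve_length gamma < +oo)%E
        & signature k gamma = g]]].

Definition CC_dist (d k : nat) (g h : tensor R d k) : \bar R :=
  CC_norm (g^-1 * h).

(** * Cadlag paths; a path on [0, T] is a function on R whose values outside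
    [0, T] are irrelevant.  Limits in T^(k)(R^d) are taken coordinatewise. *)

Definition finite_pvar (d k : nat) (p T : R) (X : R -> tensor R d k) : Prop :=
  (partition_sup (fun s t => CC_dist (X s) (X t) `^ p) 0 T < +oo)%E.

Definition cadlag_in (d k : nat) (E : set (tensor R d k)) (T : R)
    (X : R -> tensor R d k) : Prop :=
  [/\ forall t, 0 <= t <= T -> E (X t),
      forall t, 0 <= t < T -> forall w : seq 'I_d,
        X s w @[s --> t^'+] --> X t w
    & forall t, 0 < t <= T -> exists2 l, E l &
        forall w : seq 'I_d, X s w @[s --> t^'-] --> l w].

Definition left_limit (d k : nat) (X : R -> tensor R d k) (t : R) :
  tensor R d k := mkt k (fun w => lim (X s w @[s --> t^'-])).

Definition jump (d k : nat) (X : R -> tensor R d k) (t : R) : tensor R d k :=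
  (left_limit X t)^-1 * X t.

End Paths.

(* Main.v *)
(** Extension by one level, from m to m + 1 > p.  Let Z_st in G^(m+1) have the
    same logarithm as the increment X_st; then Z_su Z_ut and Z_st differ only at
    level m + 1, by an amount which is small with respect to the p-variation of
    X to a power greater than 1.  Sewing turns the defect
    Z_0s Z_st - Z_0t, a Lie element of pure level m + 1, into the increments of
    a path H up to an error that is of higher order, and that tends to 0 on
    intervals shrinking to a jump of X.  The extension is Z_0t + H_t: its
    increments are Z_st up to that error, hence its jumps have the logarithms
    of those of X.  Two extensions differ by a continuous path of finite
    q-variation with q < 1, which is constant.

    The comparison of the Carnot-Caratheodory norm with the coordinates goes
    level by level: the lowest level of log g is, by Dynkin's formula, a
    combination of brackets of generators, and these are reached up to higher
    levels by group commutators of segments. *)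

(* The control [a] of the p-variation jumps with the path, so the usual sewing error, a power of
   [a t - a s], does not tend to 0 on intervals shrinking to a jump and would allow a spurious jump
   at level m + 1. What saves the argument is that the defect of Z vanishes as soon as one of the
   factors X_su, X_ut is 1: it is bounded by the smaller of the two increments times a power of the
   whole one. When [s, t] shrinks to a jump at one of its ends, the smaller increment tends to 0,
   because the monotone function [a] has one-sided limits. All corrections live in the top level,
   where multiplication by a group element is trivial; the problem there is linear and is sewn one
   scalar coordinate at a time. Coordinates sewn separately need not form a Lie element, so Dynkin's
   formula serves a second time: the scalar paths become coefficients of brackets. Since p < m + 1
   gives p < n + 1 for all n >= m, the same step applies at each level. *)
Require Import Defs.
From HB Require Import structures.
From mathcomp Require Import all_boot all_order all_algebra.
From mathcomp Require Import all_classical all_reals all_analysis.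
From mathcomp Require Import ring lra.

Set Implicit Arguments.
Unset Strict Implicit.
Unset Printing Implicit Defensive.

Import Order.TTheory GRing.Theory Num.Theory.
Import numFieldNormedType.Exports.

Local Open Scope classical_set_scope.
Local Open Scope ring_scope.

(** * Exponential and logarithm in the truncated tensor algebra *)

Section Evaluation.
Variables (F : fieldType) (d k : nat).
Implicit Types (x y : tensor F d k) (p q : {poly F}).

(** Evaluation cut at degree k. It sees only the coefficients up to k ([eq_teval]), and for zero
    scalar component it is also the ring morphism [horner_alg]; identities between power series thus
    reduce to identities between coefficients. *)
Definition teval x p : tensor F d k := \sum_(i < k.+1) p`_i *: x ^+ i.

Lemma teval_horner x p : x [::] = 0 -> teval x p = horner_alg x p.
Proof.
move=> x0; rewrite /horner_alg /horner_morph horner_coef size_map_poly.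
have [h|h] := leqP (size p) k.+1.
  rewrite /teval (big_ord_widen _ (fun i => p`_i *: x ^+ i) (leqnn k.+1)).
  rewrite (big_ord_widen _ (fun i => (map_poly (in_alg (tensor F d k)) p)`_i * x ^+ i) h).
  rewrite [LHS]big_mkcond [RHS]big_mkcond/=; apply: eq_bigr => i _.
  rewrite ltn_ord coef_map/= mulr_algl.
  by case: ltnP => // hi; rewrite nth_default// scale0r.
rewrite /teval (big_ord_widen _ (fun i => p`_i *: x ^+ i) (ltnW h)).
rewrite big_mkcond/=; apply: eq_bigr => i _.
rewrite coef_map/= mulr_algl; case: ltnP => // hi.
by rewrite texpr_gt// scaler0.
Qed.

Lemma eq_teval x p q : (forall i, (i <= k)%N -> p`_i = q`_i) ->
  teval x p = teval x q.
Proof. by move=> h; apply: eq_bigr => i _; rewrite h// -ltnS. Qed.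

Lemma tevalM x p q : x [::] = 0 -> teval x (p * q) = teval x p * teval x q.
Proof. by move=> x0; rewrite !teval_horner// rmorphM. Qed.

Lemma teval_coef0 x p : x [::] = 0 -> teval x p [::] = p`_0.
Proof.
move=> x0; rewrite /teval big_ord_recl expr0 tcoefD tcoefZ tcoef1 mulr1.
rewrite (big_morph (fun x : tensor F d k => x [::]) (fun x y => tcoefD x y [::])
  (tcoef0 _ _ _)) big1 ?addr0// => i _.
by rewrite tcoefZ tcoefX_lt// mulr0.
Qed.

Lemma horner_algE x p : horner_alg x p = \sum_(i < size p) p`_i *: x ^+ i.
Proof.
rewrite /horner_alg /horner_morph horner_coef size_map_poly.
by apply: eq_bigr => i _; rewrite coef_map/= mulr_algl.
Qed.

Lemma teval_comp x p q : x [::] = 0 -> p`_0 = 0 ->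
  teval (teval x p) q = teval x (q \Po p).
Proof.
move=> x0 p0; rewrite teval_horner ?teval_coef0// !teval_horner//.
rewrite horner_algE comp_polyE linear_sum/=.
by apply: eq_bigr => i _; rewrite linearZ/= rmorphXn/= mulr_algl.
Qed.
End Evaluation.

Section ExpLog.
Variables (F : numFieldType) (d k : nat).
Implicit Types (x y g : tensor F d k).

Definition exp_poly : {poly F} := \poly_(i < k.+1) (i`!%:R)^-1.
Definition log_poly : {poly F} :=
  \poly_(i < k.+1) (if i == 0%N then 0 else (-1) ^+ i.+1 / i%:R).

Lemma texpE x : texp x = teval x exp_poly.
Proof.
rewrite /texp big_mkord; apply: eq_bigr => i _.
by rewrite coef_poly ltn_ord.
Qed.

Lemma tlogE g : tlog g = teval (g - 1) log_poly.
Proof.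
rewrite /tlog /teval big_ord_recl coef_poly/= scale0r add0r big_add1 big_mkord.
apply: eq_bigr => i _.
by rewrite coef_poly /bump leq0n add1n ltnS ltn_ord.
Qed.

Lemma exp_poly0 : exp_poly`_0 = 1.
Proof. by rewrite coef_poly/= fact0 invr1. Qed.

Lemma log_poly0 : log_poly`_0 = 0.
Proof. by rewrite coef_poly. Qed.

Lemma deriv_exp_poly : exp_poly^`() = exp_poly - (k`!%:R)^-1 *: 'X^k.
Proof.
apply/polyP => i; rewrite coef_deriv coefB coefZ coefXn !coef_poly !ltnS.
have [->|ne] := eqVneq i k; first by rewrite ltnn leqnn mulr1 subrr mul0rn.
rewrite mulr0 subr0 ltn_neqAle ne/=; case: leqP => hi; last by rewrite mul0rn.
rewrite -[LHS]mulr_natr factS natrM invfM mulrAC mulVf ?mul1r ?pnatr_eq0//.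
Qed.

Lemma deriv_log_poly : (1 + 'X) * log_poly^`() = 1 - (- 'X) ^+ k :> {poly F}.
Proof.
have -> : log_poly^`() = \sum_(i < k) (- 'X) ^+ i.
  transitivity (\poly_(i < k) ((-1) ^+ i : F)); last first.
    rewrite poly_def; apply: eq_bigr => i _.
    by rewrite [RHS]exprNn -mul_polyC rmorphXn rmorphN1.
  apply/polyP => i; rewrite coef_deriv !coef_poly ltnS; case: ltnP => hi.
    rewrite /= -[LHS]mulr_natr -mulrA mulVf ?mulr1 ?pnatr_eq0//.
    by rewrite 2!exprS mulN1r mulN1r opprK.
  by rewrite mul0rn.
have /(congr1 -%R) := subrX1 (- 'X : {poly F}) k.
by rewrite opprB => ->; rewrite -mulNr opprB opprK.
Qed.

Lemma dvdXn_coef n (p : {poly F}) :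
  reflect (forall i, (i < n)%N -> p`_i = 0) ('X^n %| p).
Proof.
apply: (iffP idP) => [/dvdpP[q ->] i hi|h]; first by rewrite coefMXn hi.
apply/dvdpP; exists (drop_poly n p); rewrite -{1}(poly_take_drop n p).
rewrite (_ : take_poly n p = 0) ?add0r//; apply/polyP => i.
by rewrite coef_take_poly coef0; case: ifP => // /h.
Qed.

Lemma dvdX_exp (p : {poly F}) n : p`_0 = 0 -> 'X^n %| p ^+ n.
Proof.
move=> p0; apply: dvdp_exp2r; rewrite -['X]expr1; apply/dvdXn_coef.
by case.
Qed.

(** Modulo X^k the derivative of the composite is 1: with u = exp - 1, (1 + u) log'(u) is 1 and exp'
    is exp, and the factor exp = 1 + u, coprime to X^k, cancels. In characteristic 0 the derivative
    and the constant term determine the coefficients. *)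
Lemma log_exp_poly i : (i <= k)%N -> (log_poly \Po (exp_poly - 1))`_i = 'X`_i.
Proof.
set u := exp_poly - 1; set P := _ \Po u.
have u0 : u`_0 = 0 by rewrite coefB exp_poly0 coefC eqxx subrr.
have P0 : P`_0 = 0.
  by rewrite -horner_coef0 horner_comp horner_coef0 u0 horner_coef0 log_poly0.
have h : 'X^k %| P^`() - 1.
  have cE : coprimep 'X^k exp_poly.
    apply: coprimep_expl.
    by rewrite coprimep_sym coprimepX /root horner_coef0 exp_poly0 oner_eq0.
  rewrite -(Gauss_dvdpr _ cE).
  have e : (1 + u) * (log_poly^`() \Po u) = 1 - (- u) ^+ k.
    have := congr1 (comp_poly u) deriv_log_poly.
    by rewrite comp_polyM !comp_polyD comp_polyC comp_polyX rmorphN rmorphXn rmorphN/= comp_polyX.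
  have Eu : exp_poly = 1 + u by rewrite /u addrC subrK.
  have -> : exp_poly * (P^`() - 1) =
      - ((k`!%:R)^-1%:P * 'X^k) - (- u) ^+ k * exp_poly^`().
    rewrite mulrBr mulr1 /P deriv_comp [u^`()]derivB derivC subr0 {1}Eu mulrA e.
    rewrite mulrBl mul1r addrAC; congr (_ - _).
    by rewrite deriv_exp_poly addrAC subrr sub0r mul_polyC.
  rewrite dvdp_sub// ?dvdpNr; first by rewrite dvdp_mull.
  by rewrite dvdp_mulr// dvdX_exp// coefN u0 oppr0.
case: i => [|i] hi; first by rewrite P0 coefX.
have /dvdXn_coef/(_ i hi) := h.
rewrite coefB coef_deriv coefC => /eqP; rewrite subr_eq0 => /eqP e.
rewrite coefX eqSS; apply: (@mulfI _ i.+1%:R); first by rewrite pnatr_eq0.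
rewrite mulr_natl e; case: eqP => [->|]; by rewrite ?mulr1 ?mulr0.
Qed.

(** The difference T of the two sides satisfies (1 + X) T' = T modulo X^k and T(0) = 0; read on
    coefficients, this recursion forces T to vanish up to degree k. *)
Lemma exp_log_poly i : (i <= k)%N -> (exp_poly \Po log_poly)`_i = (1 + 'X)`_i.
Proof.
set Q := _ \Po _; pose T := Q - (1 + 'X).
suff h j : (j <= k)%N -> T`_j = 0.
  by move=> /h; rewrite coefB => /eqP; rewrite subr_eq0 => /eqP.
have h : 'X^k %| (1 + 'X) * T^`() - T.
  have -> : (1 + 'X) * T^`() - T =
     - ('X^k \Po log_poly) * ((k`!%:R)^-1)%:P * (1 - (- 'X) ^+ k) - Q * (- 'X) ^+ k.
    rewrite /T derivB deriv_comp deriv_exp_poly derivD derivX derivC add0r.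
    rewrite mulrBr mulrCA deriv_log_poly comp_polyB comp_polyZ -/Q -mul_polyC.
    by ring.
  rewrite dvdp_sub//.
    by rewrite mulNr mulNr dvdpNr -mulrA dvdp_mulr// comp_Xn_poly dvdX_exp ?log_poly0.
  by rewrite dvdp_mull// dvdX_exp// coefN coefX oppr0.
elim: j => [_|j IH hj].
  rewrite coefB coefD coefC coefX eqxx addr0.
  by rewrite -horner_coef0 horner_comp horner_coef0 log_poly0 horner_coef0 exp_poly0 subrr.
have /dvdXn_coef/(_ j hj) := h.
rewrite coefB IH ?(ltnW hj)// subr0 mulrDl mul1r coefD coef_deriv coefXM coef_deriv.
case: j IH hj => [|j] IH hj /=; rewrite ?IH ?(ltnW hj)// ?mul0rn addr0 => /eqP.
  by rewrite mulr1n => /eqP.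
by rewrite mulrn_eq0/= => /eqP.
Qed.

Lemma tlogK g : g [::] = 1 -> texp (tlog g) = g.
Proof.
move=> g1; have g0 : (g - 1) [::] = 0 by rewrite tcoefD tcoefN tcoef1 g1 subrr.
rewrite texpE tlogE teval_comp ?log_poly0// (@eq_teval _ _ _ _ _ (1 + 'X))//; last first.
  exact: exp_log_poly.
by rewrite teval_horner// rmorphD/= rmorph1 horner_algX addrC subrK.
Qed.

Lemma tlog0 g : g [::] = 1 -> tlog g [::] = 0.
Proof.
by move=> g1; rewrite tlogE teval_coef0 ?log_poly0// tcoefD tcoefN tcoef1 g1 subrr.
Qed.

Lemma texp0 x : x [::] = 0 -> texp x [::] = 1.
Proof. by move=> x0; rewrite texpE teval_coef0 ?exp_poly0. Qed.

Lemma texpK x : x [::] = 0 -> tlog (texp x) = x.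
Proof.
move=> x0; have e : texp x - 1 = teval x (exp_poly - 1).
  by rewrite texpE !teval_horner// rmorphB rmorph1.
rewrite tlogE e teval_comp// ?coefB ?exp_poly0 ?coefC ?subrr//.
rewrite (@eq_teval _ _ _ _ _ 'X); last exact: log_exp_poly.
by rewrite teval_horner// horner_algX.
Qed.

(** Both factors are polynomials in the same x, so the binomial formula on coefficients suffices. *)
Lemma texpDZ a b x : x [::] = 0 ->
  texp ((a + b) *: x) = texp (a *: x) * texp (b *: x).
Proof.
move=> x0; pose E c := \poly_(i < k.+1) (c ^+ i * exp_poly`_i).
have tE c : texp (c *: x) = teval x (E c).
  rewrite texpE; apply: eq_bigr => i _.
  by rewrite exprZn scalerA mulrC [in RHS]coef_poly ltn_ord.
rewrite !tE -tevalM//; apply: eq_teval => n hn.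
rewrite coefM coef_poly ltnS hn [a + b]addrC exprDn big_distrl/=; apply: eq_bigr => i _.
have hi : (i <= n)%N by rewrite -ltnS.
rewrite !coef_poly !ltnS hn (leq_trans hi hn) (leq_trans (leq_subr _ _) hn).
have h := bin_fact hi.
have -> : (n`!%:R : F) = 'C(n, i)%:R * (i`!%:R * (n - i)`!%:R) by rewrite -h !natrM.
have nz (m : nat) : (m`!%:R : F) != 0 by rewrite pnatr_eq0 -lt0n fact_gt0.
have nC : ('C(n, i)%:R : F) != 0 by rewrite pnatr_eq0 -lt0n bin_gt0.
rewrite -[X in X / _]mulr_natr; field.
by rewrite !nz nC.
Qed.

Lemma texp_0 : texp (0 : tensor F d k) = 1.
Proof.
rewrite texpE /teval big_ord_recl exp_poly0 scale1r big1 ?addr0// => i _.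
by rewrite exprS mul0r scaler0.
Qed.

Lemma texpN x : x [::] = 0 -> texp (- x) * texp x = 1.
Proof.
by move=> x0; have := texpDZ (-1) 1 x0; rewrite addNr scale0r scaleN1r scale1r texp_0.
Qed.
End ExpLog.

(** * Gradation and the free Lie algebra *)

Lemma sum_triangle (V : zmodType) k (f : nat -> nat -> V) :
  \sum_(n < k) \sum_(i < n.+1) f (n - i)%N i =
  \sum_(i < k) \sum_(j < k - i) f j i.
Proof.
elim: k => [|k IH]; first by rewrite !big_ord0.
rewrite big_ord_recr/= IH [RHS]big_ord_recr/= subSnn big_ord1.
rewrite big_ord_recr/= subnn addrA; congr (_ + _).
rewrite -big_split/=; apply: eq_bigr => i _.
by rewrite subSn ?big_ord_recr// ltnW.
Qed.

Section Gradation.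
Variables (F : fieldType) (d k : nat).
Implicit Types (x y z : tensor F d k) (s : seq 'I_d).

Lemma tcoef_sum I (r : seq I) (P : pred I) (f : I -> tensor F d k) s :
  (\sum_(i <- r | P i) f i) s = \sum_(i <- r | P i) f i s.
Proof.
apply: (big_morph (fun x : tensor F d k => tcoef x s)) => [x y|].
  exact: tcoefD.
exact: tcoef0.
Qed.

Lemma tcoefB x y s : (x - y) s = x s - y s.
Proof. by rewrite tcoefD tcoefN. Qed.

(** The filtration by lowest level. It is multiplicative ([vanishM]) and reaches 0 above level k
    ([vanish_gt]), so it plays the role of error terms of order j. *)
Definition vanish (j : nat) x := forall s, (size s < j)%N -> x s = 0.

Lemma vanishW i j x : (i <= j)%N -> vanish j x -> vanish i x.
Proof. by move=> ij h s hs; apply: h; apply: leq_trans hs ij. Qed.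

Lemma vanish0 j : vanish j 0.
Proof. by move=> s _; rewrite tcoef0. Qed.

Lemma vanishD j x y : vanish j x -> vanish j y -> vanish j (x + y).
Proof. by move=> hx hy s hs; rewrite tcoefD hx// hy// addr0. Qed.

Lemma vanishN j x : vanish j x -> vanish j (- x).
Proof. by move=> hx s hs; rewrite tcoefN hx// oppr0. Qed.

Lemma vanishB j x y : vanish j x -> vanish j y -> vanish j (x - y).
Proof. by move=> hx hy; apply/vanishD => //; apply: vanishN. Qed.

Lemma vanishZ j a x : vanish j x -> vanish j (a *: x).
Proof. by move=> hx s hs; rewrite tcoefZ hx// mulr0. Qed.

Lemma vanish_sum j I (r : seq I) (P : pred I) (f : I -> tensor F d k) :
  (forall i, P i -> vanish j (f i)) -> vanish j (\sum_(i <- r | P i) f i).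
Proof.
by move=> h; apply: big_ind => //; [exact: vanish0|exact: vanishD].
Qed.

Lemma vanishM i j x y : vanish i x -> vanish j y -> vanish (i + j) (x * y).
Proof.
move=> hx hy s hs; have [hk|hk] := leqP (size s) k; last by rewrite tcoef_gt.
rewrite tcoefM// big1// => l _; have [li|li] := ltnP l i.
  by rewrite hx ?mul0r// size_take_min gtn_min li.
rewrite hy ?mulr0// size_drop ltn_subLR.
  by rewrite (leq_trans hs)// leq_add2r.
by rewrite -ltnS.
Qed.

Lemma vanishMl j x y : vanish j y -> vanish j (x * y).
Proof. by move=> hy; apply: (@vanishM 0%N). Qed.

Lemma vanishMr j x y : vanish j x -> vanish j (x * y).
Proof. by move=> hx; rewrite -[j]addn0; apply: vanishM. Qed.

Lemma vanishX n x : vanish 1 x -> vanish n (x ^+ n).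
Proof. by move=> x1 s hs; rewrite tcoefX_lt ?x1. Qed.

Lemma vanish1P x : vanish 1 x <-> x [::] = 0.
Proof. by split=> [->//|x0 [|a s]]. Qed.

Lemma vanish_gt j x : (k < j)%N -> vanish j x -> x = 0.
Proof.
move=> kj h; apply: tensorP => s hs; rewrite tcoef0 h//.
exact: leq_ltn_trans hs kj.
Qed.

Definition tlevel (j : nat) x : tensor F d k :=
  mkt k (fun s => if size s == j then x s else 0).

Lemma tlevelE j x s : tlevel j x s = if size s == j then x s else 0.
Proof. by rewrite mktE; case: leqP => // h; rewrite tcoef_gt ?if_same. Qed.

Lemma tlevelD j x y : tlevel j (x + y) = tlevel j x + tlevel j y.
Proof.
by apply: tensorP => s _; rewrite tcoefD !tlevelE tcoefD; case: eqP; rewrite ?addr0.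
Qed.

Lemma tlevelZ j a x : tlevel j (a *: x) = a *: tlevel j x.
Proof.
by apply: tensorP => s _; rewrite tcoefZ !tlevelE tcoefZ; case: eqP; rewrite ?mulr0.
Qed.

Lemma tlevelN j x : tlevel j (- x) = - tlevel j x.
Proof. by rewrite -scaleN1r tlevelZ scaleN1r. Qed.

Lemma tlevel_vanish i j x : vanish j x -> (i < j)%N -> tlevel i x = 0.
Proof.
move=> h ij; apply: tensorP => s _; rewrite tlevelE tcoef0.
by case: eqP => // e; rewrite h// e.
Qed.

Lemma sum_tlevel x : x = \sum_(j < k.+1) tlevel j x.
Proof.
apply: tensorP => s hs; rewrite tcoef_sum.
rewrite (bigD1 (Ordinal (hs : size s < k.+1)%N))//= tlevelE eqxx big1 ?addr0//.
by move=> i; rewrite -val_eqE/= tlevelE eq_sym => /negbTE ->.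
Qed.

Lemma tlevelM j x y :
  tlevel j (x * y) = \sum_(i < j.+1) tlevel i x * tlevel (j - i)%N y.
Proof.
apply: tensorP => s hs; rewrite tlevelE tcoef_sum.
case: eqP => [e|ne]; last first.
  rewrite big1// => i _; rewrite tcoefM// big1// => l _; rewrite !tlevelE.
  rewrite size_takel -1?ltnS// size_drop; case: eqP => [li|]; last by rewrite mul0r.
  case: eqP => [e|]; last by rewrite mulr0.
  by case: ne; rewrite -(subnK (_ : l <= size s)%N) -1?ltnS// e li subnK -1?ltnS.
case: _ / e; rewrite tcoefM//; apply: eq_bigr => i _.
rewrite tcoefM// (bigD1 i)//= !tlevelE size_takel -1?ltnS//.
rewrite size_drop !eqxx big1 ?addr0// => l ne; rewrite !tlevelE.
rewrite size_takel -1?ltnS//; move: ne; rewrite -val_eqE/= => /negbTE ->.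
by rewrite mul0r.
Qed.

Definition tbr x y : tensor F d k := x * y - y * x.

Lemma vanish_br i j x y : vanish i x -> vanish j y -> vanish (i + j) (tbr x y).
Proof. by move=> hx hy; apply: vanishB; last rewrite addnC; apply: vanishM. Qed.

Lemma tlevel_br j x y :
  tlevel j (tbr x y) = \sum_(i < j.+1) tbr (tlevel i x) (tlevel (j - i)%N y).
Proof.
rewrite tlevelD tlevelN !tlevelM sumrB; congr (_ - _).
rewrite (reindex_inj rev_ord_inj)/=; apply: eq_bigr => i _.
by rewrite subSS subKn// -ltnS.
Qed.

Local Notation lie := (@free_lie F d k).

Lemma lie0 : lie 0.
Proof.
have := free_lie_lin (-1) (free_lie_vec k (0 : 'rV[F]_d)) (free_lie_vec k 0).
by rewrite scaleN1r addNr.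
Qed.

Lemma lieZ a x : lie x -> lie (a *: x).
Proof. by move=> hx; rewrite -[_ *: _]addr0; apply: free_lie_lin => //; exact: lie0. Qed.

Lemma lieD x y : lie x -> lie y -> lie (x + y).
Proof. by move=> hx hy; rewrite -[x]scale1r; apply: free_lie_lin. Qed.

Lemma lieN x : lie x -> lie (- x).
Proof. by move=> hx; rewrite -scaleN1r; apply: lieZ. Qed.

Lemma lieB x y : lie x -> lie y -> lie (x - y).
Proof. by move=> hx hy; apply: lieD => //; apply: lieN. Qed.

Lemma lie_sum I (r : seq I) (P : pred I) (f : I -> tensor F d k) :
  (forall i, P i -> lie (f i)) -> lie (\sum_(i <- r | P i) f i).
Proof. by move=> h; apply: big_ind => //; [exact: lie0|exact: lieD]. Qed.

Lemma lie_vanish x : lie x -> vanish 1 x.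
Proof.
move=> h; elim: h => {x} [v|a x y _ hx _ hy|x y _ hx _ hy].
- by case=> // _; rewrite mktE.
- by apply: vanishD => //; apply: vanishZ.
- by apply: (@vanishW _ (1 + 1)) => //; apply: vanish_br.
Qed.

Lemma lie_tlevel j x : lie x -> lie (tlevel j x).
Proof.
move=> h; elim: h j => {x} [v|a x y _ hx _ hy|x y _ hx _ hy] j.
- have [->|ne] := eqVneq j 1%N.
    rewrite (_ : tlevel _ _ = tvec k v); first exact: free_lie_vec.
    apply: tensorP => s hs; rewrite tlevelE mktE hs.
    by case: s {hs} => [|i [|? ?]].
  rewrite (_ : tlevel _ _ = 0); first exact: lie0.
  apply: tensorP => s hs; rewrite tlevelE mktE hs tcoef0.
  by case: s {hs} => [|i [|? ?]]; case: eqP => // e; rewrite -e in ne.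
- by rewrite tlevelD tlevelZ; apply: free_lie_lin.
- by rewrite tlevel_br; apply: lie_sum => i _; apply: free_lie_bracket.
Qed.

(** The generator of the dilations, which multiply level j by the j-th power of the ratio; hence a
    derivation ([eulerM]). *)
Definition euler x : tensor F d k := mkt k (fun s => (size s)%:R * x s).

Lemma eulerE x s : euler x s = (size s)%:R * x s.
Proof. by rewrite mktE; case: leqP => // h; rewrite tcoef_gt ?mulr0. Qed.

Lemma eulerD x y : euler (x + y) = euler x + euler y.
Proof. by apply: tensorP => s _; rewrite tcoefD !eulerE tcoefD mulrDr. Qed.

Lemma eulerZ a x : euler (a *: x) = a *: euler x.
Proof. by apply: tensorP => s _; rewrite tcoefZ !eulerE tcoefZ mulrCA. Qed.

Lemma eulerB x y : euler (x - y) = euler x - euler y.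
Proof. by rewrite eulerD -scaleN1r eulerZ scaleN1r. Qed.

Lemma euler_sum I (r : seq I) (P : pred I) (f : I -> tensor F d k) :
  euler (\sum_(i <- r | P i) f i) = \sum_(i <- r | P i) euler (f i).
Proof.
apply: (big_morph _ eulerD).
by apply: tensorP => s _; rewrite eulerE tcoef0 mulr0.
Qed.

Lemma eulerM x y : euler (x * y) = euler x * y + x * euler y.
Proof.
apply: tensorP => s hs; rewrite tcoefD eulerE !tcoefM// big_distrr/= -big_split/=.
apply: eq_bigr => i _; rewrite !eulerE size_takel -1?ltnS// size_drop.
rewrite mulrCA [x _ * (_ * _)]mulrCA -mulrA -mulrDl -mulrCA -natrD subnKC -1?ltnS//.
Qed.

Lemma euler1 : euler 1 = 0.
Proof.
by apply: tensorP => s _; rewrite eulerE tcoef1 tcoef0; case: s => [|? ?]; rewrite ?mul0r ?mulr0.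
Qed.

Lemma tlevel_euler j x : tlevel j (euler x) = j%:R *: tlevel j x.
Proof.
apply: tensorP => s _; rewrite tcoefZ !tlevelE eulerE.
by case: eqP => [->//|]; rewrite mulr0.
Qed.

Lemma euler_vanish j x : vanish j x -> vanish j (euler x).
Proof. by move=> h s hs; rewrite eulerE h// mulr0. Qed.

Lemma euler_vanish1 x : vanish 1 (euler x).
Proof. by move=> [|//] _; rewrite eulerE mul0r. Qed.

Lemma lie_euler x : lie x -> lie (euler x).
Proof.
move=> hx; rewrite [euler x]sum_tlevel; apply: lie_sum => i _.
by rewrite tlevel_euler; apply/lieZ/lie_tlevel.
Qed.

End Gradation.

(** * The Baker-Campbell-Hausdorff theorem *)

Section BCH.
Variables (F : numFieldType) (d k : nat).
Implicit Types (x y g h : tensor F d k).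
Local Notation lie := (@free_lie F d k).
Local Notation G := (@free_group F d k).

(** This is (- ad x)^i applied to y; the sign is the one that appears when y moves from the left of
    x to its right. *)
Definition adj_seq x y i : tensor F d k := (-1) ^+ i *: iter i (tbr x) y.

Lemma adj_seqS x y i : adj_seq x y i * x = x * adj_seq x y i + adj_seq x y i.+1.
Proof.
rewrite /adj_seq/= exprS mulN1r /tbr scaleNr -scalerN opprB -scalerAl -scalerAr.
by rewrite -scalerDr addrC subrK.
Qed.

(** Right multiplication by x is the sum of left multiplication by x and of - ad x, which commute:
    this is the binomial formula for that sum. *)
Lemma adj_seqX x y n : y * x ^+ n =
  \sum_(i < n.+1) (x ^+ (n - i) * adj_seq x y i) *+ 'C(n, i).
Proof.
elim: n => [|n IH].
  by rewrite big_ord1 expr0 mulr1 mul1r /adj_seq/= expr0 scale1r.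
rewrite exprSr mulrA IH big_distrl/=.
under eq_bigr => i _.
  rewrite mulrnAl -mulrA adj_seqS mulrDr mulrA -exprSr mulrnDl -subSn -1?ltnS//; over.
rewrite big_split/= [X in X + _](_ : _ = \sum_(i < n.+2)
    (x ^+ (n.+1 - i) * adj_seq x y i) *+ 'C(n, i)); last first.
  by rewrite [RHS]big_ord_recr/= bin_small// mulr0n addr0.
rewrite big_ord_recl [RHS]big_ord_recl !bin0 -addrA; congr (_ + _).
rewrite -big_split/=; apply: eq_bigr => i _.
by rewrite /bump leq0n add1n subSS binS mulrnDr.
Qed.

Lemma eulerX x n : euler (x ^+ n) =
  \sum_(i < n) (x ^+ (n.-1 - i) * adj_seq x (euler x) i) *+ 'C(n, i.+1).
Proof.
elim: n => [|n IH]; first by rewrite big_ord0 expr0 euler1.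
rewrite exprS eulerM IH adj_seqX/= big_distrr/=.
rewrite [X in _ + X](_ : _ = \sum_(i < n.+1)
    (x ^+ (n - i) * adj_seq x (euler x) i) *+ 'C(n, i.+1)); last first.
  rewrite [RHS]big_ord_recr/= bin_small// mulr0n addr0; apply: eq_bigr => i _.
  case: n i {IH} => [[]//|n] i.
  by rewrite mulrnAr mulrA -exprS -subSn// -ltnS.
rewrite -big_split/=; apply: eq_bigr => i _.
by rewrite binS addnC mulrnDr.
Qed.

Lemma vanish_adj_seq j x y i : vanish 1 x -> vanish j y ->
  vanish (i + j) (adj_seq x y i).
Proof.
move=> x1 yj; apply: vanishZ; elim: i => [|i IH]//=.
by rewrite -add1n -addnA; apply: vanish_br.
Qed.

Lemma vanish_adj_seq0 x y i : vanish 1 x -> vanish i (adj_seq x y i).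
Proof. by move=> x1; rewrite -[i in vanish i]addn0; apply: vanish_adj_seq. Qed.

Lemma lie_adj_seq x y i : lie x -> lie y -> lie (adj_seq x y i).
Proof.
by move=> hx hy; apply: lieZ; elim: i => //= i IH; apply: free_lie_bracket.
Qed.

(** A Cauchy product: the pairs of degrees outside the triangle contribute only above level k. *)
Lemma texp_triangle x (c : nat -> tensor F d k) : vanish 1 x ->
  (forall i, vanish i (c i)) ->
  texp x * (\sum_(i < k.+1) c i) =
  \sum_(n < k.+1) \sum_(i < n.+1) ((n - i)`!%:R)^-1 *: (x ^+ (n - i) * c i).
Proof.
move=> x1 hc.
rewrite (sum_triangle k.+1 (fun j i => (j`!%:R)^-1 *: (x ^+ j * c i))).
rewrite big_distrr/=; apply: eq_bigr => i _.
rewrite /texp big_mkord big_distrl/=.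
rewrite (big_ord_widen _ (fun j => (j`!%:R)^-1 *: (x ^+ j * c i)) (leq_subr i k.+1)).
rewrite [RHS]big_mkcond/=; apply: eq_bigr => j _; rewrite -scalerAl.
case: ltnP => // hj; rewrite [x ^+ _ * _](@vanish_gt _ _ _ (j + i)) ?scaler0//.
  by rewrite addnC -leq_subLR.
by apply: vanishM => //; apply: vanishX.
Qed.

(** Hadamard's formula exp(- x) y exp(x) = exp(- ad x) y, written without the inverse. *)
Lemma conj_texp x y : vanish 1 x ->
  y * texp x = texp x * \sum_(i < k.+1) (i`!%:R)^-1 *: adj_seq x y i.
Proof.
move=> x1; rewrite (texp_triangle (c := fun i => (i`!%:R)^-1 *: adj_seq x y i))//; last first.
  by move=> i; apply/vanishZ/vanish_adj_seq0.
rewrite /texp big_mkord big_distrr/=; apply: eq_bigr => n _.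
rewrite -scalerAr adj_seqX scaler_sumr; apply: eq_bigr => i _.
rewrite -[X in _ = _ *: X]scalerAr [RHS]scalerA -[X in _ *: X = _]scaler_nat [LHS]scalerA;
  congr (_ *: _).
have hi : (i <= n)%N by rewrite -ltnS.
rewrite -(bin_fact hi) !natrM.
have nz (m : nat) : (m`!%:R : F) != 0 by rewrite pnatr_eq0 -lt0n fact_gt0.
have nC : ('C(n, i)%:R : F) != 0 by rewrite pnatr_eq0 -lt0n bin_gt0.
by field; rewrite !nz nC.
Qed.

(** The series (1 - exp(- ad x)) / ad x applied to [euler x]. It is the logarithmic derivative g^-1
    [euler g] of g = exp x. *)
Definition texp_deriv x : tensor F d k :=
  \sum_(i < k.+1) (i.+1`!%:R)^-1 *: adj_seq x (euler x) i.

Lemma euler_texp x : vanish 1 x -> euler (texp x) = texp x * texp_deriv x.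
Proof.
move=> x1; rewrite /texp_deriv.
rewrite (texp_triangle (c := fun i => (i.+1`!%:R)^-1 *: adj_seq x (euler x) i))//; last first.
  by move=> i; apply/vanishZ/vanish_adj_seq0.
rewrite /texp big_mkord euler_sum big_ord_recl/= expr0 eulerZ euler1 scaler0 add0r.
rewrite [RHS]big_ord_recr/= [X in _ + X]big1 ?addr0; last first.
  move=> i _; rewrite [_ * _](@vanish_gt _ _ _ k.+1) ?scaler0//.
  have hi : (i <= k)%N by rewrite -ltnS.
  apply: (@vanishW _ _ _ _ ((k - i) + i.+1)); first by rewrite addnS subnK.
  apply: vanishM; first exact: vanishX.
  by apply: vanishZ; rewrite -addn1; apply: vanish_adj_seq => //; exact: euler_vanish1.
apply: eq_bigr => n _; rewrite /bump leq0n add1n eulerZ eulerX scaler_sumr.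
apply: eq_bigr => i _.
rewrite -[X in _ = _ *: X]scalerAr [RHS]scalerA -[X in _ *: X = _]scaler_nat [LHS]scalerA;
  congr (_ *: _).
have hi : (i.+1 <= n.+1)%N := ltn_ord i.
rewrite -(bin_fact hi) subSS (natrM _ _ (_ * _)%N) (natrM _ i.+1`!).
have nz (m : nat) : (m`!%:R : F) != 0 by rewrite pnatr_eq0 -lt0n fact_gt0.
have nC : ('C(n.+1, i.+1)%:R : F) != 0 by rewrite pnatr_eq0 -lt0n bin_gt0.
by field; rewrite !nz nC.
Qed.

Lemma unit_texp x : vanish 1 x -> texp x \is a GRing.unit.
Proof. by move=> /vanish1P x0; rewrite unfold_in/= /tunit texp0// oner_neq0. Qed.

Lemma lie_texp_deriv x : lie x -> lie (texp_deriv x).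
Proof.
by move=> hx; apply: lie_sum => i _; apply/lieZ/lie_adj_seq => //; exact: lie_euler.
Qed.

Lemma vanish_tbr_sub j x y x' y' : vanish 1 x -> vanish 1 y' ->
  vanish j (x - x') -> vanish j (y - y') -> vanish j.+1 (tbr x y - tbr x' y').
Proof.
move=> x1 y1 hx hy.
have -> : tbr x y - tbr x' y' = tbr x (y - y') + tbr (x - x') y'.
  apply: tensorP => s _; rewrite /tbr !(mulrBl, mulrBr) !(tcoefD, tcoefN).
  by ring.
apply: vanishD; first by rewrite -add1n; apply: vanish_br.
by rewrite -addn1; apply: vanish_br.
Qed.

(** At level j + 1 the series is j + 1 times the component of x, plus iterated brackets of lower
    components. Subtracting the series of the truncation x', Lie by induction, isolates that
    component. *)
Lemma lie_of_texp_deriv x : vanish 1 x -> lie (texp_deriv x) -> lie x.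
Proof.
move=> x1 hD; rewrite [x]sum_tlevel; apply: lie_sum => -[j /= hj] _.
move: hj => _; elim/ltn_ind: j => j IH.
case: j IH => [|j] IH; first by rewrite (tlevel_vanish x1)//; exact: lie0.
pose x' := \sum_(i < j.+1) tlevel i x.
have hx' : lie x' by apply: lie_sum => i _; apply: IH.
have hv : vanish j.+1 (x - x').
  move=> s hs; rewrite tcoefB tcoef_sum (bigD1 (Ordinal hs))//= tlevelE eqxx.
  rewrite big1 ?addr0 ?subrr// => i.
  by rewrite -val_eqE/= tlevelE eq_sym => /negbTE ->.
have x'1 := lie_vanish hx'.
(* Each bracket gains a level, so in the difference only the term i = 0 of the series reaches level
   j + 1. *)
have hv2 i : vanish j.+2 (adj_seq x (euler x) i.+1 - adj_seq x' (euler x') i.+1).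
  rewrite /adj_seq -scalerBr; apply: vanishZ; elim: i => [|i IHi] /=.
    apply: vanish_tbr_sub => //; first exact: euler_vanish1.
    by rewrite -eulerB; apply: euler_vanish.
  apply: vanish_tbr_sub => //; last exact: vanishW IHi.
  apply: (@vanishW _ _ _ _ (1 + 1)) => //; apply: (@vanish_br _ _ _ 1 1) => //.
  elim: i {IHi} => [|i IHi] /=; first exact: euler_vanish1.
  by apply: (@vanishW _ _ _ _ (1 + 1)) => //; exact: vanish_br.
have e : tlevel j.+1 (texp_deriv x - texp_deriv x') = j.+1%:R *: tlevel j.+1 x.
  rewrite /texp_deriv -sumrB big_ord_recl/= tlevelD [X in _ + X](_ : _ = 0) ?addr0; last first.
    apply: (@tlevel_vanish _ _ _ _ j.+2) => //; apply: vanish_sum => i _.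
    by rewrite -scalerBr; apply: vanishZ; exact: hv2.
  rewrite /adj_seq/= expr0 !scale1r invr1 !scale1r -eulerB tlevel_euler.
  rewrite tlevelD tlevelN [tlevel _ x'](_ : _ = 0) ?subr0//.
  apply: tensorP => s _; rewrite tlevelE tcoef_sum tcoef0.
  case: eqP => // es; rewrite big1// => i _; rewrite tlevelE es.
  by rewrite gtn_eqF// ltn_ord.
have nz : (j.+1%:R : F) != 0 by rewrite pnatr_eq0.
rewrite -[tlevel _ _]scale1r -(mulVf nz) -scalerA -e.
by apply/lieZ/lie_tlevel/lieB => //; exact: lie_texp_deriv.
Qed.

(** Membership becomes linear in the logarithmic derivative of [g]
    along the dilations, which is additive on products up to conjugation. *)
Lemma free_groupP g :
  G g <-> g [::] = 1 /\ lie (g^-1 * euler g).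
Proof.
split=> [[x hx <-]|[g1 hg]].
  have x1 := lie_vanish hx; split; first by apply: texp0; apply/vanish1P.
  by rewrite euler_texp// mulKr ?unit_texp//; exact: lie_texp_deriv.
exists (tlog g); last exact: tlogK.
have l1 : vanish 1 (tlog g) by apply/vanish1P; exact: tlog0.
apply: lie_of_texp_deriv => //.
by move: hg; rewrite -{1 2}[g]tlogK// euler_texp// mulKr// unit_texp.
Qed.

Lemma free_group0 g : G g -> g [::] = 1.
Proof. by move=> /free_groupP[]. Qed.

Lemma free_group_unit g : G g -> g \is a GRing.unit.
Proof. by move=> [x hx <-]; apply: unit_texp; exact: lie_vanish. Qed.

Lemma lie_tlog g : G g -> lie (tlog g).
Proof.
by move=> [x hx <-]; rewrite texpK//; apply/vanish1P; exact: lie_vanish.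
Qed.

Lemma free_group1 : G 1.
Proof. by exists 0; [exact: lie0|exact: texp_0]. Qed.

Lemma free_groupM g h : G g -> G h -> G (g * h).
Proof.
move=> Gg Gh; have ug := free_group_unit Gg; have uh := free_group_unit Gh.
have [g1 hg] := (free_groupP g).1 Gg; have [h1 hh] := (free_groupP h).1 Gh.
apply/free_groupP; split; first by rewrite tcoefM0 g1 h1 mulr1.
rewrite eulerM invrM// mulrDr; apply: lieD; last first.
  by rewrite -mulrA mulKr.
(* Conjugation by exp x is exp(- ad x), a combination of iterated brackets with x. *)
case: Gh uh => x hx <- uh; rewrite mulrA -(mulrA _ g^-1).
rewrite -mulrA conj_texp ?mulKr//; last exact: lie_vanish.
by apply: lie_sum => i _; apply/lieZ/lie_adj_seq.
Qed.

Lemma free_groupV g : G g -> G g^-1.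
Proof.
move=> [x hx <-]; have /vanish1P x0 := lie_vanish hx.
exists (- x); first exact: lieN.
apply: (mulIr (unit_texp (lie_vanish hx))).
by rewrite texpN// mulVr// unit_texp//; exact: lie_vanish.
Qed.

End BCH.

(** * The Dynkin operator *)

Section Dynkin.
Variables (F : numFieldType) (d k : nat).
Implicit Types (x y g h : tensor F d k) (w s : seq 'I_d).
Local Notation lie := (@free_lie F d k).
Local Notation G := (@free_group F d k).

Definition tgen (i : 'I_d) : tensor F d k := tvec k (delta_mx 0 i).

Lemma tgenE i s : tgen i s = ((s == [:: i]) && (1 <= k)%N)%:R.
Proof.
rewrite mktE; case: s => [|l [|l' s]]; rewrite ?if_same//.
  by rewrite mxE/= eqseq_cons andbT; case: ltnP; rewrite ?andbT ?andbF.
by rewrite eqseq_cons andbF.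
Qed.

Lemma tvec_sum (v : 'rV[F]_d) : tvec k v = \sum_i v 0 i *: tgen i.
Proof.
apply: tensorP => s hs; rewrite tcoef_sum mktE hs.
under eq_bigr do rewrite tcoefZ tgenE.
case: s hs => [|l [|? ?]] hs; [rewrite big1//| |rewrite big1//]; last first.
- by move=> i _; rewrite eqseq_cons andbF mulr0.
- rewrite (bigD1 l)//= eqxx hs mulr1 big1 ?addr0// => i /negbTE ne.
  by rewrite eqseq_cons eq_sym ne mulr0.
- by move=> i _; rewrite /= mulr0.
Qed.

Fixpoint wbr w : tensor F d k :=
  if w is i :: w' then (if w' is [::] then tgen i else tbr (tgen i) (wbr w'))
  else 0.

Definition homog (j : nat) x := forall s, size s != j -> x s = 0.

Lemma homogM i j x y : homog i x -> homog j y -> homog (i + j) (x * y).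
Proof.
move=> hx hy s ne; have [hk|hk] := leqP (size s) k; last by rewrite tcoef_gt.
rewrite tcoefM// big1// => l _; have [e|/eqP ne'] := eqVneq (val l) i; last first.
  by rewrite hx ?mul0r// size_takel -1?ltnS//; apply/eqP.
rewrite hy ?mulr0// size_drop; apply: contra ne => /eqP <-.
by rewrite -e eq_sym; apply/eqP/subnKC; rewrite -ltnS; exact: ltn_ord.
Qed.

Lemma homog_br i j x y : homog i x -> homog j y -> homog (i + j) (tbr x y).
Proof.
move=> hx hy s ne; rewrite tcoefB (homogM hx hy)// (homogM hy hx) ?subr0//.
by rewrite addnC.
Qed.

Lemma homog_tgen i : homog 1 (tgen i).
Proof.
move=> s ne; rewrite tgenE; case: eqP => // e; by rewrite e in ne.
Qed.

Lemma homog_wbr w : homog (size w) (wbr w).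
Proof.
elim: w => [|i [|l w] IH] /=; first by move=> s _; rewrite tcoef0.
- exact: homog_tgen.
- by rewrite -add1n; apply: homog_br => //; exact: homog_tgen.
Qed.

Lemma homog_vanish j x : homog j x -> vanish j x.
Proof. by move=> h s hs; rewrite h// ltn_eqF. Qed.

Lemma lie_tgen i : lie (tgen i).
Proof. exact: free_lie_vec. Qed.

Lemma lie_wbr w : lie (wbr w).
Proof.
elim: w => [|i [|l w] IH] /=; first exact: lie0.
- exact: lie_tgen.
- by apply: free_lie_bracket => //; exact: lie_tgen.
Qed.

Definition dynkin_level j x : tensor F d k :=
  \sum_(w : j.-tuple 'I_d) x w *: wbr w.
Definition dynkin x : tensor F d k := \sum_(j < k.+1) dynkin_level j x.

Lemma tlevel_dynkin j x : (j <= k)%N -> tlevel j (dynkin x) = dynkin_level j x.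
Proof.
move=> hj; have H i : homog i (dynkin_level i x).
  move=> s ne; rewrite tcoef_sum big1// => w _.
  by rewrite tcoefZ homog_wbr ?mulr0// size_tuple.
apply: tensorP => s hs; rewrite tlevelE tcoef_sum; case: eqP => [e|/eqP ne].
  rewrite (bigD1 (Ordinal (hj : j < k.+1)%N))//= big1 ?addr0// => i.
  by rewrite -val_eqE/= => ne; rewrite H// e eq_sym.
by rewrite H.
Qed.

Lemma dynkin_linear a x y : dynkin (a *: x + y) = a *: dynkin x + dynkin y.
Proof.
rewrite /dynkin scaler_sumr -big_split/=; apply: eq_bigr => j _.
rewrite /dynkin_level scaler_sumr -big_split/=; apply: eq_bigr => w _.
by rewrite tcoefD tcoefZ scalerDl scalerA.
Qed.

Lemma dynkinD x y : dynkin (x + y) = dynkin x + dynkin y.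
Proof. by rewrite -[X in X + y]scale1r dynkin_linear scale1r. Qed.

Lemma dynkinB x y : dynkin (x - y) = dynkin x - dynkin y.
Proof. by rewrite addrC -scaleN1r dynkin_linear scaleN1r addrC. Qed.

Lemma dynkinZ a x : dynkin (a *: x) = a *: dynkin x.
Proof.
have d0 : dynkin 0 = 0 by rewrite -[X in dynkin X](subrr 0) dynkinB subrr.
by rewrite -[_ *: x]addr0 dynkin_linear d0 addr0.
Qed.

Lemma sum_tupleS (V : zmodType) j (f : seq 'I_d -> V) :
  \sum_(w : j.+1.-tuple 'I_d) f w = \sum_i \sum_(w : j.-tuple 'I_d) f (i :: w).
Proof.
rewrite pair_big/=.
rewrite (reindex (fun p : 'I_d * j.-tuple 'I_d => [tuple of p.1 :: p.2]))/=; last first.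
  exists (fun w : j.+1.-tuple 'I_d => (thead w, [tuple of behead w])).
    by move=> [i w] _ /=; congr pair; apply: val_inj.
  by move=> w _; rewrite /= -tuple_eta.
by [].
Qed.

Lemma dynkin_level0 x : dynkin_level 0 x = 0.
Proof. by rewrite /dynkin_level big1// => w _; rewrite tuple0 scaler0. Qed.

Lemma tgenM i x l w : (size w < k)%N -> (tgen i * x) (l :: w) = (l == i)%:R * x w.
Proof.
move=> hw; have k0 : (0 < k)%N by apply: leq_ltn_trans hw.
rewrite tcoefM//= 2!big_ord_recl/= tgenE mul0r add0r.
rewrite tgenE take0 drop0 k0 andbT eqseq_cons andbT big1 ?addr0// => m _.
by rewrite tgenE/=; case: w hw m => [|a w] hw m /=; [case: m|rewrite eqseq_cons andbF mul0r].
Qed.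

Lemma tbr_sumr I (r : seq I) (P : pred I) (f : I -> tensor F d k) x :
  tbr x (\sum_(i <- r | P i) f i) = \sum_(i <- r | P i) tbr x (f i).
Proof. by rewrite /tbr big_distrr big_distrl/= sumrB. Qed.

Lemma tbrZr a x y : tbr x (a *: y) = a *: tbr x y.
Proof. by rewrite /tbr -scalerAl -scalerAr scalerBr. Qed.

Lemma tbr_linearl a x y z : tbr (a *: x + y) z = a *: tbr x z + tbr y z.
Proof.
rewrite /tbr mulrDl mulrDr -scalerAl -scalerAr scalerBr.
by apply: tensorP => s _; rewrite !(tcoefD, tcoefN); ring.
Qed.

Lemma dynkin_tgenM i y : vanish 1 y ->
  dynkin (tgen i * y) = tbr (tgen i) (dynkin y).
Proof.
move=> /vanish1P y0; rewrite /dynkin tbr_sumr [LHS]big_ord_recl [RHS]big_ord_recr/=.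
rewrite dynkin_level0 add0r [X in _ + X](_ : _ = 0) ?addr0; last first.
  apply: (@vanish_gt _ _ _ k.+1) => //; rewrite -add1n; apply: vanish_br.
    exact/homog_vanish/homog_tgen.
  apply: vanish_sum => w _; apply: vanishZ.
  by have := homog_vanish (@homog_wbr w); rewrite size_tuple.
apply: eq_bigr => j _; rewrite /dynkin_level /bump leq0n add1n.
rewrite (sum_tupleS _ (fun w => (tgen i * y) w *: wbr w)) (bigD1 i)//= [X in _ + X]big1 ?addr0.
  rewrite tbr_sumr; apply: eq_bigr => -[w hw] _ /=.
  rewrite tgenM ?(eqP hw)// eqxx mul1r tbrZr.
  by case: w hw => [|? ?] hw //=; rewrite y0 !scale0r.
move=> l ne; rewrite big1// => w _.
by rewrite tgenM ?size_tuple// (negbTE ne) mul0r scale0r.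
Qed.

(** The x that satisfy this for all y contain the generators and are stable under brackets by the
    Jacobi identity. The scalar part of y has to vanish because [wbr [::]] is 0. *)
Lemma dynkinM x y : lie x -> vanish 1 y -> dynkin (x * y) = tbr x (dynkin y).
Proof.
move=> h; elim: h y => {x} [v|a x z _ hx _ hz|x z lx hx lz hz] y y1.
- rewrite tvec_sum; apply: (big_ind (fun u => dynkin (u * y) = tbr u (dynkin y))).
  - by rewrite mul0r /tbr mul0r mulr0 subrr -[X in dynkin X](subrr 0) dynkinB subrr.
  - by move=> u u' e e'; rewrite mulrDl dynkinD e e' -[in RHS](scale1r u) tbr_linearl scale1r.
  - by move=> i _; rewrite -scalerAl dynkinZ dynkin_tgenM// /tbr -scalerAl -scalerAr scalerBr.
- by rewrite mulrDl -scalerAl dynkin_linear hx// hz// tbr_linearl.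
- rewrite mulrBl -!mulrA dynkinB hx ?hz ?hz ?hx//; try exact: vanishMl.
  apply: tensorP => s _; rewrite /tbr !(mulrBl, mulrBr) !mulrA !(tcoefD, tcoefN).
  by ring.
Qed.

Lemma dynkin_tvec v : dynkin (tvec k v) = euler (tvec k v).
Proof.
have t1 : dynkin_level 1 (tvec k v) = tvec k v.
  rewrite /dynkin_level (sum_tupleS _ (fun w => tvec k v w *: wbr w)) [RHS]tvec_sum.
  apply: eq_bigr => i _; rewrite (big_pred1 [tuple])/=; last first.
    by move=> w; rewrite /= tuple0.
  rewrite mktE/=; case: ltnP => // k0.
  by rewrite (@vanish_gt _ _ _ 1 (tgen i)) ?scaler0//; apply/homog_vanish/homog_tgen.
have t0 j : j != 1%N -> dynkin_level j (tvec k v) = 0.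
  move=> ne; apply: big1 => w _; rewrite mktE.
  case: w => -[|a [|b w]] /= /eqP e; rewrite ?if_same ?scale0r//.
  by rewrite -e in ne.
rewrite /dynkin; have [k0|k0] := posnP k.
  apply: etrans (esym _); last first.
    apply: (@vanish_gt _ _ _ 1); rewrite ?k0//; exact: euler_vanish1.
  by apply: big1 => -[[|j] hj] _ /=; rewrite t0//; move: hj; rewrite k0.
rewrite (bigD1 (Ordinal (k0 : 1 < k.+1)%N))//= t1 big1 ?addr0; last first.
  by move=> j; rewrite -val_eqE/= => /t0.
apply: tensorP => s hs; rewrite eulerE mktE hs.
by case: s {hs} => [|a [|? ?]]; rewrite ?mulr0 ?mul1r.
Qed.

(** The theorem of Dynkin, Specht and Wever: by [dynkinM] the operator acts on Lie brackets as a
    derivation, as [euler] does, and both agree on generators. *)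
Lemma lie_dynkin x : lie x -> dynkin x = euler x.
Proof.
move=> h; elim: h => {x} [v|a x z _ hx _ hz|x z lx hx lz hz].
- exact: dynkin_tvec.
- by rewrite dynkin_linear hx hz eulerD eulerZ.
- rewrite dynkinB (dynkinM lx (lie_vanish lz)) (dynkinM lz (lie_vanish lx)).
  rewrite eulerB !eulerM hx hz /tbr.
  by apply: tensorP => s _; rewrite !(tcoefD, tcoefN); ring.
Qed.

Lemma lie_tlevel_dynkin j x : (j <= k)%N -> lie x ->
  j%:R *: tlevel j x = dynkin_level j x.
Proof. by move=> hj lx; rewrite -tlevel_euler -lie_dynkin// tlevel_dynkin. Qed.

End Dynkin.

(** * Lowest level of exponential and logarithm; products with elements of the top level *)

Section Top.
Variables (F : numFieldType) (d k : nat).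
Implicit Types (x y g h r : tensor F d k) (s : seq 'I_d).

Lemma texp_vanish j x : (0 < j)%N -> vanish j x -> vanish j.+1 (texp x - 1 - x).
Proof.
move=> j0 hx; have [k0|k0] := posnP k.
  rewrite (@vanish_gt _ _ _ 1 x) ?k0// ?texp_0 ?subrr ?subr0; first exact: vanish0.
  exact: vanishW hx.
rewrite /texp big_ltn// big_ltn ?ltnS// expr0 expr1 fact0 (_ : 1`! = 1%N)// invr1 !scale1r.
rewrite [1 + _]addrC addrK [x + _]addrC addrK big_nat_cond.
apply: vanish_sum => -[|[|i]]// _; apply: vanishZ.
rewrite exprS exprS mulrA; apply: vanishMr.
apply: (@vanishW _ _ _ _ (j + j)); first by rewrite -addn1 leq_add2l.
exact: vanishM.
Qed.

Lemma tlog_vanish j g : vanish j (g - 1) -> vanish j (tlog g).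
Proof.
move=> hg; rewrite /tlog big_add1/=; apply: vanish_sum => i _; apply: vanishZ.
by rewrite exprS; apply: vanishMr.
Qed.

Lemma tlevel_tlog j g : (0 < j)%N -> g [::] = 1 -> vanish j (g - 1) ->
  tlevel j (tlog g) = tlevel j g.
Proof.
move=> j0 g1 hg; have := texp_vanish j0 (tlog_vanish hg); rewrite tlogK// => h.
apply/eqP; rewrite -subr_eq0 -tlevelN -tlevelD -opprB tlevelN oppr_eq0.
rewrite (_ : g - tlog g = (g - 1 - tlog g) + 1); last by rewrite addrAC subrK.
rewrite tlevelD (tlevel_vanish h)// add0r; apply/eqP/tensorP => s _.
by rewrite tlevelE tcoef0 tcoef1; case: s => [|? ?]; case: eqP => // e; rewrite -e in j0.
Qed.

(** The linearity on which the extension step rests: x minus its scalar part pushes r above level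
    k. *)
Lemma mulx_top x r : vanish k r -> x * r = x [::] *: r.
Proof.
move=> hr; apply/eqP; rewrite -subr_eq0; apply/eqP.
rewrite -[in X in _ - X](mul1r r) scalerAl -mulrBl.
apply: (@vanish_gt _ _ _ (1 + k)) => //; apply: vanishM => //.
by apply/vanish1P; rewrite tcoefB tcoefZ tcoef1 mulr1 subrr.
Qed.

Lemma mul_topx x r : vanish k r -> r * x = x [::] *: r.
Proof.
move=> hr; apply/eqP; rewrite -subr_eq0; apply/eqP.
rewrite -[in X in _ - X](mulr1 r) scalerAr -mulrBr.
apply: (@vanish_gt _ _ _ (k + 1)); first by rewrite addn1.
apply: vanishM => //.
by apply/vanish1P; rewrite tcoefB tcoefZ tcoef1 mulr1 subrr.
Qed.

Lemma texp_top r : (0 < k)%N -> vanish k r -> texp r = 1 + r.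
Proof.
move=> k0 hr; apply/eqP; rewrite -subr_eq0 opprD addrA; apply/eqP.
by apply: (@vanish_gt _ _ _ k.+1) => //; apply: texp_vanish.
Qed.

End Top.

(** * Change of the truncation level *)

Section Resize.
Variables (F : numFieldType) (d : nat).

Lemma tresizeE k l (x : tensor F d k) s :
  tresize l x s = if (size s <= l)%N then x s else 0.
Proof. exact: mktE. Qed.

Lemma tresize_tresize k l m (x : tensor F d k) : (m <= l)%N ->
  tresize m (tresize l x) = tresize m x.
Proof.
move=> ml; apply: tensorP => s hs; rewrite !tresizeE hs.
by rewrite (leq_trans hs ml).
Qed.

Lemma tresize_id k (x : tensor F d k) : tresize k x = x.
Proof. by apply: tensorP => s hs; rewrite tresizeE hs. Qed.

Lemma tresize_up k l (x : tensor F d k) : (k <= l)%N -> tresize k (tresize l x) = x.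
Proof. by move=> kl; rewrite tresize_tresize// tresize_id. Qed.

Lemma tresize_up_up k l m (x : tensor F d k) : (k <= l)%N ->
  tresize m (tresize l x) = tresize m x.
Proof.
move=> kl; apply: tensorP => s hs; rewrite !tresizeE hs.
by case: leqP => // h; rewrite tcoef_gt// (leq_ltn_trans kl).
Qed.

Lemma tresizeD k l (x y : tensor F d k) :
  tresize l (x + y) = tresize l x + tresize l y.
Proof. by apply: tensorP => s hs; rewrite tcoefD !tresizeE hs tcoefD. Qed.

Lemma tresizeZ k l a (x : tensor F d k) : tresize l (a *: x) = a *: tresize l x.
Proof. by apply: tensorP => s hs; rewrite tcoefZ !tresizeE hs tcoefZ. Qed.

Lemma tresizeB k l (x y : tensor F d k) :
  tresize l (x - y) = tresize l x - tresize l y.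
Proof. by rewrite tresizeD -scaleN1r tresizeZ scaleN1r. Qed.

Lemma tresize1 k l : tresize l (1 : tensor F d k) = 1.
Proof. by apply: tensorP => s hs; rewrite tresizeE hs !tcoef1. Qed.

Lemma tresize_nil k l (x : tensor F d k) : tresize l x [::] = x [::].
Proof. by rewrite tresizeE. Qed.

Lemma tresize_sum k l I (r : seq I) (P : pred I) (f : I -> tensor F d k) :
  tresize l (\sum_(i <- r | P i) f i) = \sum_(i <- r | P i) tresize l (f i).
Proof.
apply: (big_morph _ (@tresizeD k l)); apply: tensorP => s hs.
by rewrite tresizeE tcoef0 if_same tcoef0.
Qed.

Variables (k l : nat).
Hypothesis lk : (l <= k)%N.
Implicit Types x y : tensor F d k.

Lemma tresizeM x y : tresize l (x * y) = tresize l x * tresize l y.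
Proof.
apply: tensorP => s hs; rewrite tresizeE hs !tcoefM ?(leq_trans hs)//.
apply: eq_bigr => i _; rewrite !tresizeE size_drop size_take_min.
by rewrite (leq_trans (geq_minr _ _) hs) (leq_trans (leq_subr _ _) hs).
Qed.

Lemma tresizeX x n : tresize l (x ^+ n) = tresize l x ^+ n.
Proof. by elim: n => [|n IH]; rewrite ?expr0 ?tresize1// !exprS tresizeM IH. Qed.

Lemma tresize_teval x p : x [::] = 0 -> tresize l (teval x p) = teval (tresize l x) p.
Proof.
move=> x0; rewrite !teval_horner ?tresize_nil// !horner_algE tresize_sum.
by apply: eq_bigr => i _; rewrite tresizeZ tresizeX.
Qed.

Lemma tresize_texp x : x [::] = 0 -> tresize l (texp x) = texp (tresize l x).
Proof.
move=> x0; rewrite !texpE tresize_teval//; apply: eq_teval => i hi.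
by rewrite !coef_poly !ltnS hi (leq_trans hi lk).
Qed.

Lemma tresize_tlog x : x [::] = 1 -> tresize l (tlog x) = tlog (tresize l x).
Proof.
move=> x1; rewrite !tlogE tresize_teval ?tcoefB ?x1 ?tcoef1 ?subrr//.
rewrite tresizeB tresize1; apply: eq_teval => i hi.
by rewrite !coef_poly !ltnS hi (leq_trans hi lk).
Qed.

Lemma tresizeV x : x [::] = 1 -> tresize l x^-1 = (tresize l x)^-1.
Proof.
move=> x1; have ux : x \is a GRing.unit by rewrite unfold_in/= /tunit x1 oner_neq0.
have ux' : tresize l x \is a GRing.unit by rewrite unfold_in/= /tunit tresize_nil x1 oner_neq0.
by apply: (mulrI ux'); rewrite -tresizeM !mulrV// tresize1.
Qed.

Lemma tresize_tvec (v : 'rV[F]_d) : tresize l (tvec k v) = tvec l v.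
Proof. by apply: tensorP => s hs; rewrite tresizeE !mktE hs (leq_trans hs). Qed.

Lemma tresize_lie x : free_lie x -> free_lie (tresize l x).
Proof.
move=> h; elim: h => {x} [v|a x y _ hx _ hy|x y _ hx _ hy].
- by rewrite tresize_tvec; exact: free_lie_vec.
- by rewrite tresizeD tresizeZ; exact: free_lie_lin.
- by rewrite tresizeB !tresizeM; exact: free_lie_bracket.
Qed.

Lemma tresize_free_group x : free_group x -> free_group (tresize l x).
Proof.
move=> [y hy <-]; exists (tresize l y); first exact: tresize_lie.
by rewrite tresize_texp//; apply/vanish1P; exact: lie_vanish.
Qed.

Lemma lie_lift (z : tensor F d l) : free_lie z ->
  exists2 x : tensor F d k, free_lie x & tresize l x = z.
Proof.
move=> h; elim: h => {z} [v|a x y _ [x' lx <-] _ [y' ly <-]|x y _ [x' lx <-] _ [y' ly <-]].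
- by exists (tvec k v); [exact: free_lie_vec|exact: tresize_tvec].
- by exists (a *: x' + y'); [exact: free_lie_lin|rewrite tresizeD tresizeZ].
- exists (x' * y' - y' * x'); first exact: free_lie_bracket.
  by rewrite tresizeB !tresizeM.
Qed.

(** The inclusion is not multiplicative, so brackets cannot be carried through it. Instead z is
    lifted to a Lie element of T^(k), whose levels above l are then cut off by [lie_tlevel]. *)
Lemma lie_include (z : tensor F d l) : free_lie z -> free_lie (tresize k z).
Proof.
move=> /lie_lift[x lx <-].
have -> : tresize k (tresize l x) = \sum_(j < l.+1) tlevel j x.
  apply: tensorP => s hs; rewrite !tresizeE hs tcoef_sum; case: ltnP => h.
    by rewrite big1// => i _; rewrite tlevelE gtn_eqF// (leq_ltn_trans _ h)// -ltnS.
  rewrite (bigD1 (Ordinal (h : size s < l.+1)%N))//= tlevelE eqxx big1 ?addr0// => i.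
  by rewrite -val_eqE/= tlevelE eq_sym => /negbTE ->.
by apply: lie_sum => j _; exact: lie_tlevel.
Qed.

End Resize.

(** * Families of tensors depending on a parameter *)

Lemma tinvE (F : fieldType) d k (x : tensor F d k) : x [::] = 1 ->
  x^-1 = teval (x - 1) (\poly_(i < k.+1) (-1) ^+ i).
Proof.
move=> x1; rewrite /GRing.inv/= /tinv /tunit x1 oner_neq0 invr1 !scale1r.
rewrite /tgeom /teval; apply: eq_bigr => i _; rewrite coef_poly ltn_ord.
rewrite -[1 - x]opprB -scaleN1r; elim: (val i) => [|n IH].
  by rewrite !expr0 scale1r.
by rewrite !exprS IH -scalerAl -scalerAr !scalerA.
Qed.

Lemma unit_tcoef1 (F : fieldType) d k (x : tensor F d k) : x [::] = 1 ->
  x \is a GRing.unit.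
Proof. by move=> x1; rewrite unfold_in/= /tunit x1 oner_neq0. Qed.

Lemma tinv_nil (F : fieldType) d k (x : tensor F d k) : x [::] = 1 ->
  x^-1 [::] = 1.
Proof.
move=> x1; have := mulrV (unit_tcoef1 x1).
move=> /(congr1 (fun y : tensor F d k => y [::])).
by rewrite tcoefM0 x1 mul1r tcoef1.
Qed.

(** * Properties of families that are stable under polynomial operations *)

Section PolyClosed.
Variables (F : fieldType) (d k : nat) (I : Type).
Variable P : (I -> tensor F d k) -> Prop.
Hypothesis P1 : P (fun=> 1).
Hypothesis PL : forall a f g, P f -> P g -> P (fun i => a *: f i + g i).
Hypothesis PM : forall f g, P f -> P g -> P (fun i => f i * g i).

Let P0 : P (fun=> 0).
Proof.
rewrite (_ : (fun=> 0) = fun i => (-1) *: (fun=> 1 : tensor F d k) i + (fun=> 1) i).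
  exact: PL.
by apply/funext => i; rewrite scaleN1r addNr.
Qed.

Let PB1 f : P f -> P (fun i => f i - 1).
Proof.
move=> Pf; rewrite (_ : (fun i => f i - 1) = fun i => (-1) *: (fun=> 1 : tensor F d k) i + f i).
  exact: PL.
by apply/funext => i; rewrite scaleN1r addrC.
Qed.

(** Boundedness, closeness and convergence are all instances of P, so that each passes to inverse,
    exponential and logarithm by the same induction. *)
Lemma closed_teval f p : P f -> P (fun i => teval (f i) p).
Proof.
move=> Pf; rewrite /teval; elim: (k.+1) => [|n IH].
  by under [X in P X]funext do rewrite big_ord0.
under [X in P X]funext do rewrite big_ord_recr/= addrC.
apply: PL => //; elim: n {IH} => [|n IH]; first by under [X in P X]funext do rewrite expr0.
by under [X in P X]funext do rewrite exprS; apply: PM.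
Qed.

Lemma closed_inv (f : I -> tensor F d k) : (forall i, f i [::] = 1) -> P f -> P (fun i => (f i)^-1).
Proof.
move=> f1 Pf; under [X in P X]funext => i do rewrite tinvE//.
exact/closed_teval/PB1.
Qed.
End PolyClosed.

Section PolyClosedNum.
Variables (F : numFieldType) (d k : nat) (I : Type).
Variable P : (I -> tensor F d k) -> Prop.
Hypothesis P1 : P (fun=> 1).
Hypothesis PL : forall a f g, P f -> P g -> P (fun i => a *: f i + g i).
Hypothesis PM : forall f g, P f -> P g -> P (fun i => f i * g i).

Lemma closed_texp f : P f -> P (fun i => texp (f i)).
Proof.
by move=> Pf; under [X in P X]funext do rewrite texpE; apply: closed_teval.
Qed.

Lemma closed_tlog f : P f -> P (fun i => tlog (f i)).
Proof.
move=> Pf; under [X in P X]funext do rewrite tlogE; apply: closed_teval => //.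
rewrite (_ : (fun i => f i - 1) = fun i => (-1) *: (fun=> 1 : tensor F d k) i + f i).
  exact: PL.
by apply/funext => i; rewrite scaleN1r addrC.
Qed.
End PolyClosedNum.

(* Locked, lest conversion unfold products of tensors. *)
Fact tlift_key : unit. Proof. exact: tt. Qed.
Definition tlift (F : fieldType) d k l (x : tensor F d k) : tensor F d l :=
  locked_with tlift_key (texp (tresize l (tlog x))).
Lemma tliftE (F : fieldType) d k l (x : tensor F d k) :
  tlift l x = texp (tresize l (tlog x)).
Proof. by rewrite /tlift locked_withE. Qed.

(** * Lifting to a higher level with the same logarithm *)

Section Lift.
Variables (F : numFieldType) (d k l : nat).
Hypothesis kl : (k <= l)%N.
Implicit Types x : tensor F d k.

Let tlog_lift0 x : x [::] = 1 -> tresize l (tlog x) [::] = 0.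
Proof. by move=> x1; rewrite tresize_nil tlog0. Qed.

Lemma tlift_nil x : x [::] = 1 -> tlift l x [::] = 1.
Proof. by move=> x1; rewrite tliftE texp0 ?tlog_lift0. Qed.

Lemma tlog_tlift x : x [::] = 1 -> tlog (tlift l x) = tresize l (tlog x).
Proof. by move=> x1; rewrite tliftE texpK ?tlog_lift0. Qed.

Lemma tresize_tlift x : x [::] = 1 -> tresize k (tlift l x) = x.
Proof. by move=> x1; rewrite tliftE tresize_texp ?tlog_lift0// tresize_up// tlogK. Qed.

Lemma tlift1 : tlift l (1 : tensor F d k) = 1.
Proof.
rewrite tliftE -texp_0 texpK ?tcoef0// (_ : tresize l _ = 0) ?texp_0//.
by apply: tensorP => s hs; rewrite tresizeE tcoef0 if_same tcoef0.
Qed.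

Lemma free_group_tlift x : free_group x -> free_group (tlift l x).
Proof. by rewrite tliftE => /lie_tlog h; exists (tresize l (tlog x)) => //; apply: lie_include. Qed.
End Lift.

(** * Homogeneous bounds, uniform over a family *)

Section Domination.
Variables (R : realType) (d : nat) (I : Type) (D : I -> Prop).
Implicit Types (e l : I -> R).

(** Level j is measured against [l i ^+ j], the scaling of the Carnot-Caratheodory norm; [e] records
    an additional smallness common to all levels. The point is that C does not depend on i. *)
Definition dom k e l (f : I -> tensor R d k) := exists2 C, 0 <= C &
  forall i, D i -> forall s, (size s <= k)%N -> `|f i s| <= C * e i * l i ^+ size s.

Variable l : I -> R.
Hypothesis l0 : forall i, D i -> 0 <= l i.

Section Fixed.
Variable k : nat.
Implicit Types f g : I -> tensor R d k.

Lemma dom_lin a e f g : (forall i, D i -> 0 <= e i) ->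
  dom e l f -> dom e l g -> dom e l (fun i => a *: f i + g i).
Proof.
move=> e0 [C C0 hf] [C' C'0 hg]; exists (`|a| * C + C').
  by rewrite addr_ge0 ?mulr_ge0.
move=> i Di s hs; rewrite tcoefD tcoefZ (le_trans (ler_normD _ _))// !mulrDl.
rewrite lerD ?hg// normrM -!mulrA ler_wpM2l// mulrA hf//.
Qed.

Lemma domM e e' f g : (forall i, D i -> 0 <= e i) -> (forall i, D i -> 0 <= e' i) ->
  dom e l f -> dom e' l g -> dom (fun i => e i * e' i) l (fun i => f i * g i).
Proof.
move=> e0 e'0 [C C0 hf] [C' C'0 hg]; exists (k.+1%:R * (C * C')).
  by rewrite !mulr_ge0.
move=> i Di s hs; rewrite tcoefM// (le_trans (ler_norm_sum _ _ _))//.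
have h (j : 'I_(size s).+1) : `|f i (take j s) * g i (drop j s)| <=
    C * C' * (e i * e' i) * l i ^+ size s.
  have hj : (j <= size s)%N by rewrite -ltnS.
  rewrite normrM.
  have -> : C * C' * (e i * e' i) * l i ^+ size s =
      (C * e i * l i ^+ size (take j s)) * (C' * e' i * l i ^+ size (drop j s)).
    rewrite -{1}(subnKC hj) exprD size_takel// size_drop; ring.
  apply: ler_pM => //; [apply: hf => //|apply: hg => //].
    by rewrite size_takel// (leq_trans hj).
  by rewrite size_drop (leq_trans (leq_subr _ _)).
rewrite (le_trans (ler_sum _ (fun j _ => h j)))//.
rewrite sumr_const card_ord -[X in X <= _]mulr_natl -!mulrA ler_wpM2r ?ler_nat//.
by rewrite !mulr_ge0 ?exprn_ge0 ?l0 ?e0 ?e'0.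
Qed.

Lemma dom_le e e' f : (exists2 c, 0 <= c & forall i, D i -> e i <= c * e' i) ->
  dom e l f -> dom e' l f.
Proof.
move=> [c c0 h] [C C0 hf]; exists (C * c); first by rewrite mulr_ge0.
move=> i Di s hs; rewrite (le_trans (hf _ Di _ hs))//.
by rewrite ler_wpM2r ?exprn_ge0 ?l0// -mulrA ler_wpM2l// h.
Qed.

Definition bdd f := dom (fun=> 1) l f.

Lemma bdd_lin a f g : bdd f -> bdd g -> bdd (fun i => a *: f i + g i).
Proof. by apply: dom_lin => i _. Qed.

Lemma bddM f g : bdd f -> bdd g -> bdd (fun i => f i * g i).
Proof.
move=> hf hg; apply: dom_le (domM _ _ hf hg) => //.
by exists 1 => // i _; rewrite mulr1.
Qed.

Lemma bdd1 : bdd (fun=> 1).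
Proof.
exists 1 => // i Di s hs; rewrite tcoef1 !mul1r.
by case: s hs => [|a s] hs; rewrite ?normr1 ?expr0// normr0 exprn_ge0 ?l0.
Qed.

Variable e : I -> R.
Hypothesis e0 : forall i, D i -> 0 <= e i.

(** Boundedness of both families is part of closeness, since only then is closeness stable under
    products. *)
Definition near_bdd f g := [/\ bdd f, bdd g & dom e l (fun i => f i - g i)].

Lemma near_bdd_refl f : bdd f -> near_bdd f f.
Proof.
move=> h; split=> //; exists 0 => // i Di s hs.
by rewrite subrr tcoef0 normr0 !mul0r.
Qed.

Lemma near_bdd_lin a f g f' g' : near_bdd f f' -> near_bdd g g' ->
  near_bdd (fun i => a *: f i + g i) (fun i => a *: f' i + g' i).
Proof.
move=> [bf bf' df] [bg bg' dg]; split; [exact: bdd_lin|exact: bdd_lin|].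
rewrite (_ : (fun i => _) = fun i => a *: (f i - f' i) + (g i - g' i)).
  exact: dom_lin.
by apply/funext => i; rewrite scalerBr opprD addrACA.
Qed.

Lemma near_bddM f g f' g' : near_bdd f f' -> near_bdd g g' ->
  near_bdd (fun i => f i * g i) (fun i => f' i * g' i).
Proof.
move=> [bf bf' df] [bg bg' dg]; split; [exact: bddM|exact: bddM|].
rewrite (_ : (fun i => _) = fun i => 1 *: (f i * (g i - g' i)) + (f i - f' i) * g' i); last first.
  by apply/funext => i; rewrite scale1r mulrBr mulrBl addrA subrK.
apply: dom_lin => //; apply: dom_le.
- by exists 1 => // i; rewrite mul1r -[leRHS]mul1r => _; apply: lexx.
- by apply: (domM (e := fun=> 1)).
- by exists 1 => // i; rewrite mul1r -[leRHS]mulr1 => _; apply: lexx.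
- by apply: (domM (e' := fun=> 1)).
Qed.

End Fixed.

Lemma bdd_tresize k k' (f : I -> tensor R d k) :
  bdd f -> bdd (fun i => tresize k' (f i)).
Proof.
move=> [C C0 h]; exists C => // i Di s hs; rewrite tresizeE hs.
have [hk|hk] := leqP (size s) k; first exact: h.
by rewrite tcoef_gt// normr0 mulr1 mulr_ge0// exprn_ge0 ?l0.
Qed.

Section Lifting.
Variable k : nat.
Implicit Types f g : I -> tensor R d k.

Lemma bdd_inv f : (forall i, f i [::] = 1) -> bdd f -> bdd (fun i => (f i)^-1).
Proof.
move=> f1 bf; apply: (closed_inv (P := @bdd k)) => //;
 [exact: bdd1|by move=> *; apply: bdd_lin|by move=> *; apply: bddM].
Qed.

Lemma bdd_tlog f : bdd f -> bdd (fun i => tlog (f i)).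
Proof.
move=> bf; apply: (closed_tlog (P := @bdd k)) => //;
 [exact: bdd1|by move=> *; apply: bdd_lin|by move=> *; apply: bddM].
Qed.

Lemma bdd_texp f : bdd f -> bdd (fun i => texp (f i)).
Proof.
move=> bf; apply: (closed_texp (P := @bdd k)) => //;
 [exact: bdd1|by move=> *; apply: bdd_lin|by move=> *; apply: bddM].
Qed.

Variable e : I -> R.
Hypothesis e0 : forall i, D i -> 0 <= e i.

(** A pair of families is encoded as one family over [bool * I], to make closeness a property to
    which the closure lemmas apply. *)
Let P (h : bool * I -> tensor R d k) :=
  near_bdd e (fun i => h (true, i)) (fun i => h (false, i)).

Lemma near_bdd_texp f g : near_bdd e f g ->
  near_bdd e (fun i => texp (f i)) (fun i => texp (g i)).
Proof.
move=> h; pose u (bi : bool * I) := if bi.1 then f bi.2 else g bi.2.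
apply: (@closed_texp _ _ _ _ P _ _ _ u) => //.
- exact/near_bdd_refl/bdd1.
- by move=> *; apply: near_bdd_lin.
- by move=> *; apply: near_bddM.
Qed.

Lemma near_bdd_tlog f g : near_bdd e f g ->
  near_bdd e (fun i => tlog (f i)) (fun i => tlog (g i)).
Proof.
move=> h; pose u (bi : bool * I) := if bi.1 then f bi.2 else g bi.2.
apply: (@closed_tlog _ _ _ _ P _ _ _ u) => //.
- exact/near_bdd_refl/bdd1.
- by move=> *; apply: near_bdd_lin.
- by move=> *; apply: near_bddM.
Qed.
End Lifting.

Lemma near_bdd_tresize e k k' (f g : I -> tensor R d k) : (forall i, D i -> 0 <= e i) ->
  near_bdd e f g -> near_bdd e (fun i => tresize k' (f i)) (fun i => tresize k' (g i)).
Proof.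
move=> e0 [bf bg [C C0 h]]; split; [exact: bdd_tresize|exact: bdd_tresize|].
exists C => // i Di s hs; rewrite -tresizeB tresizeE hs.
have [hk|hk] := leqP (size s) k; first exact: h.
by rewrite tcoef_gt// normr0 !mulr_ge0 ?exprn_ge0 ?l0 ?e0.
Qed.

Lemma bdd_tlift k k' (f : I -> tensor R d k) :
  bdd f -> bdd (fun i => tlift k' (f i)).
Proof.
move=> h; rewrite (_ : (fun i => _) = fun i => texp (tresize k' (tlog (f i)))).
  exact/bdd_texp/bdd_tresize/bdd_tlog.
by apply/funext => i; rewrite tliftE.
Qed.

Lemma near_bdd_eq e k (f g f' g' : I -> tensor R d k) : f =1 f' -> g =1 g' ->
  near_bdd e f g -> near_bdd e f' g'.
Proof. by move=> /funext -> /funext ->. Qed.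

Lemma near_bdd_tlift e k k' (f g : I -> tensor R d k) : (forall i, D i -> 0 <= e i) ->
  near_bdd e f g -> near_bdd e (fun i => tlift k' (f i)) (fun i => tlift k' (g i)).
Proof.
move=> e0 h; apply: near_bdd_eq; last first.
- exact/(near_bdd_texp e0)/(near_bdd_tresize k' e0)/(near_bdd_tlog e0 h).
- by move=> i; rewrite tliftE.
- by move=> i; rewrite tliftE.
Qed.

Lemma near_bdd_trans k e (f g h : I -> tensor R d k) : (forall i, D i -> 0 <= e i) ->
  near_bdd e f h -> near_bdd e g h -> near_bdd e f g.
Proof.
move=> e0 [bf bh dfh] [bg _ dgh]; split=> //.
have [C C0 hC] := dom_lin (-1) e0 dgh dfh; exists C => // i hi s hs.
have -> : f i - g i = -1 *: (g i - h i) + (f i - h i); last exact: hC.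
by rewrite scaleN1r opprB [RHS]addrC addrA subrK.
Qed.

(** Both sides become [tlift k' (g i)] when f is replaced by 1, and each of them moves by at most
    the order of e in doing so. *)
Lemma near_bdd_tliftMl e k k' (f g : I -> tensor R d k) : (forall i, D i -> 0 <= e i) ->
  near_bdd e f (fun=> 1) -> bdd g ->
  near_bdd e (fun i => tlift k' (f i * g i)) (fun i => tlift k' (f i) * tlift k' (g i)).
Proof.
move=> e0 nf bg; have rg := near_bdd_refl e bg.
have h1 := near_bdd_tlift k' e0 (near_bddM e0 nf rg).
have h2 := near_bddM e0 (near_bdd_tlift k' e0 nf) (near_bdd_tlift k' e0 rg).
apply: near_bdd_trans e0 h1 (near_bdd_eq _ _ h2) => // i.
by rewrite tlift1 !mul1r.
Qed.

Lemma near_bdd_tliftMr e k k' (f g : I -> tensor R d k) : (forall i, D i -> 0 <= e i) ->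
  bdd f -> near_bdd e g (fun=> 1) ->
  near_bdd e (fun i => tlift k' (f i * g i)) (fun i => tlift k' (f i) * tlift k' (g i)).
Proof.
move=> e0 bf ng; have rf := near_bdd_refl e bf.
have h1 := near_bdd_tlift k' e0 (near_bddM e0 rf ng).
have h2 := near_bddM e0 (near_bdd_tlift k' e0 rf) (near_bdd_tlift k' e0 ng).
apply: near_bdd_trans e0 h1 (near_bdd_eq _ _ h2) => // i.
by rewrite tlift1 !mulr1.
Qed.

End Domination.

(** * Coordinatewise convergence of tensors *)

Section Convergence.
Variables (R : realType) (d : nat) (I : Type) (F : set_system I).
Context {FF : Filter F}.

Definition tcvg k (f : I -> tensor R d k) (x : tensor R d k) :=
  forall s : seq 'I_d, f i s @[i --> F] --> x s.

Section Fixed.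
Variable k : nat.
Implicit Types (f g : I -> tensor R d k) (x y : tensor R d k).

Lemma tcvg_cst x : tcvg (fun=> x) x.
Proof. by move=> s; exact: cvg_cst. Qed.

Lemma tcvg_lin a f g x y : tcvg f x -> tcvg g y ->
  tcvg (fun i => a *: f i + g i) (a *: x + y).
Proof.
move=> hf hg s; under eq_fun do rewrite tcoefD tcoefZ.
rewrite tcoefD tcoefZ; apply: cvgD => //; apply: cvgM => //; exact: cvg_cst.
Qed.

Let cvg_sumr J (r : seq J) (u : J -> I -> R) (a : J -> R) :
  (forall j, u j i @[i --> F] --> a j) ->
  (\sum_(j <- r) u j i) @[i --> F] --> \sum_(j <- r) a j.
Proof.
move=> h; elim: r => [|j r IH].
  by rewrite big_nil; under eq_cvg do rewrite big_nil; exact: cvg_cst.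
rewrite big_cons; under eq_cvg do rewrite big_cons.
exact: cvgD.
Qed.

Lemma tcvgM f g x y : tcvg f x -> tcvg g y -> tcvg (fun i => f i * g i) (x * y).
Proof.
move=> hf hg s; have [hs|hs] := leqP (size s) k; last first.
  by under eq_fun do rewrite tcoef_gt//; rewrite tcoef_gt//; exact: cvg_cst.
under eq_fun do rewrite tcoefM//.
rewrite [(x * y) s]tcoefM//; apply: cvg_sumr => i; exact: cvgM.
Qed.

(** The limit is stored at the index [None], which turns convergence into a property of a single
    family. *)
Let P (h : option I -> tensor R d k) := tcvg (fun i => h (Some i)) (h None).

Let tcvg_inv_total f x : (forall i, f i [::] = 1) -> x [::] = 1 ->
  tcvg f x -> tcvg (fun i => (f i)^-1) x^-1.
Proof.
move=> f1 x1 h; pose u (oi : option I) := if oi is Some i then f i else x.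
apply: (@closed_inv _ _ _ _ P _ _ _ u) => //.
- exact: tcvg_cst.
- by move=> *; apply: tcvg_lin.
- by move=> *; apply: tcvgM.
- by case.
Qed.

Lemma near_tcvg f g x : (\near F, f F = g F) -> tcvg f x -> tcvg g x.
Proof.
move=> fg h s; apply: cvg_trans (h s); apply: near_eq_cvg.
by apply: filterS fg => i ->.
Qed.

Lemma tcvg_inv f x : (\near F, f F [::] = 1) -> x [::] = 1 ->
  tcvg f x -> tcvg (fun i => (f i)^-1) x^-1.
Proof.
(* The scalar component is 1 only eventually, whereas [closed_inv] wants it everywhere. *)
move=> f1 x1 h; pose f' i := if f i [::] == 1 then f i else 1.
have e : \near F, f' F = f F by apply: filterS f1 => i fi; rewrite /f' fi eqxx.
apply: (@near_tcvg (fun i => (f' i)^-1)); first by apply: filterS e => i ->.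
apply: tcvg_inv_total => //.
  by move=> i; rewrite /f'; case: eqP => // _; rewrite tcoef1.
by apply: near_tcvg h; apply: filterS e => i ->.
Qed.

Lemma tcvg_texp f x : tcvg f x -> tcvg (fun i => texp (f i)) (texp x).
Proof.
move=> h; pose u (oi : option I) := if oi is Some i then f i else x.
apply: (@closed_texp _ _ _ _ P _ _ _ u) => //.
- exact: tcvg_cst.
- by move=> *; apply: tcvg_lin.
- by move=> *; apply: tcvgM.
Qed.

Lemma tcvg_tlog f x : tcvg f x -> tcvg (fun i => tlog (f i)) (tlog x).
Proof.
move=> h; pose u (oi : option I) := if oi is Some i then f i else x.
apply: (@closed_tlog _ _ _ _ P _ _ _ u) => //.
- exact: tcvg_cst.
- by move=> *; apply: tcvg_lin.
- by move=> *; apply: tcvgM.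
Qed.
End Fixed.

Lemma tcvg_tresize k k' (f : I -> tensor R d k) x :
  tcvg f x -> tcvg (fun i => tresize k' (f i)) (tresize k' x).
Proof.
move=> h s; under eq_fun do rewrite tresizeE; rewrite tresizeE.
by case: ifP => _; [exact: h|exact: cvg_cst].
Qed.

Lemma tcvg_tlift k k' (f : I -> tensor R d k) x :
  tcvg f x -> tcvg (fun i => tlift k' (f i)) (tlift k' x).
Proof.
move=> h; rewrite tliftE (_ : (fun i => _) = fun i => texp (tresize k' (tlog (f i)))).
  exact/tcvg_texp/tcvg_tresize/tcvg_tlog.
by apply/funext => i; rewrite tliftE.
Qed.
End Convergence.

(** * Partitions and Riemann-Stieltjes sums *)

(** Recursive form of the indexed sums over a partition, suited to induction and to
    concatenation. *)
Fixpoint psum (T : Type) (V : nmodType) (f : T -> T -> V) (a : T) (s : seq T) : V :=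
  if s is c :: s' then f a c + psum f c s' else 0.

Lemma psumE (T : Type) (V : nmodType) (f : T -> T -> V) a b (s : seq T) :
  \sum_(0 <= i < size s) f (nth b (a :: s) i) (nth b s i) = psum f a s.
Proof.
elim: s a => [|c s IH] a /=; first by rewrite big_nil.
by rewrite big_nat_recl//= IH.
Qed.

Lemma psum_cat (T : Type) (V : nmodType) (f : T -> T -> V) a (s t : seq T) :
  psum f a (s ++ t) = psum f a s + psum f (last a s) t.
Proof. by elim: s a => [|c s IH] a /=; rewrite ?add0r// IH addrA. Qed.

Lemma psum_tele (V : zmodType) (T : Type) (f : T -> V) a (s : seq T) :
  psum (fun u v => f v - f u) a s = f (last a s) - f a.
Proof.
elim: s a => [|c s IH] a /=; first by rewrite subrr.
by rewrite IH addrC addrA subrK.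
Qed.

Section Partition.
Variable R : realType.
Implicit Types (a b t e M V : R) (s : seq R) (f g : R -> R).

Lemma itv_partition_rcons a b c s : itv_partition a b s -> b < c ->
  itv_partition a c (rcons s c).
Proof.
move=> [ps /eqP ls] bc; split; last by rewrite last_rcons.
by rewrite rcons_path ps ls.
Qed.

Lemma itv_partition_head a b c s : itv_partition a b (c :: s) ->
  [/\ a < c, c <= b & itv_partition c b s].
Proof.
move=> h; have hs := itv_partition_cons h; split=> //; last exact: itv_partition_le hs.
by case: h => /= /andP[].
Qed.

Lemma partition_sum_mem (F : R -> R -> \bar R) a b s : itv_partition a b s ->
  (psum F a s <= partition_sup F a b)%E.
Proof. by move=> hs; apply: ereal_sup_ubound; exists s => //; rewrite psumE. Qed.

Lemma partition_sup_le (F : R -> R -> \bar R) (h : R -> R) a b :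
  (forall u v, a <= u -> u < v -> v <= b -> (F u v <= (h v - h u)%:E)%E) ->
  (partition_sup F a b <= (h b - h a)%:E)%E.
Proof.
move=> H; apply: ub_ereal_sup => _ [s hs <-]; rewrite psumE.
elim: s a hs H => [|c s IH] a hs H.
  by rewrite (itv_partition_nil hs) /= subrr.
have [ac cb hs'] := itv_partition_head hs.
rewrite /= (_ : h b - h a = (h c - h a) + (h b - h c)); last by ring.
rewrite EFinD leeD// ?H//; apply: IH => // u v cu; apply: H.
exact: le_trans (ltW ac) cu.
Qed.

Lemma fine_partition a b e : a <= b -> 0 < e -> exists2 s, itv_partition a b s &
  forall i, (i < size s)%N -> nth b s i - nth b (a :: s) i < e.
Proof.
(* Steps of length e / 2, because the mesh has to be strictly less than e. *)
move=> ab e0; have [n] : exists n, b - a <= n%:R * (e / 2).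
  exists (Num.bound ((b - a) / (e / 2))).
  rewrite -ler_pdivrMr ?divr_gt0//; apply/ltW/archi_boundP.
  by rewrite divr_ge0 ?subr_ge0// ltW// divr_gt0.
elim: n a ab => [|n IH] a ab hn.
  exists [::]; last by [].
  split=> //=; rewrite eq_le ab/=; move: hn; rewrite mul0r; lra.
have [h|h] := leP (b - a) (e / 2).
  have [->|ne] := eqVneq a b; first by exists [::]; [split=> /=|].
  exists [:: b]; first by apply: itv_partition1; rewrite lt_neqAle ne.
  by case=> [|//] _ /=; lra.
have [||s hs sl] := IH (a + e / 2); first by lra.
  by move: hn; rewrite -natr1 mulrDl mul1r; lra.
exists (a + e / 2 :: s).
  case: hs => ps ls; split=> //=; rewrite ps andbT; lra.
case=> [|i] hi /=; first by lra.
exact: sl.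
Qed.

(** No existence of the integral is needed: the junk value 0 obeys the bound. *)
Lemma RS_integral_bound f g a b M V : a <= b ->
  (forall c, a <= c <= b -> `|f c| <= M) ->
  (forall s, itv_partition a b s -> psum (fun u v => `|g v - g u|) a s <= V) ->
  `|RS_integral f g a b| <= M * V.
Proof.
move=> ab hM hV; have M0 : 0 <= M by apply: le_trans (hM a _); rewrite ?lexx.
rewrite /RS_integral; case: xgetP => [v _ hv|_]; last first.
  have [s hs _] := fine_partition ab ltr01.
  rewrite normr0 mulr_ge0// (le_trans _ (hV s hs))//.
  by elim: s (a) {hs} => //= c s IH u; rewrite addr_ge0.
apply/ler_addgt0Pr => e e0; have [dl dl0 H] := hv e e0.
have [s hs sl] := fine_partition ab dl0.
pose c i := nth b (a :: s) i.
have {H} := H s c hs.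
have hc i : (i < size s)%N -> nth b s i - nth b (a :: s) i < dl /\
    nth b (a :: s) i <= c i <= nth b s i.
  move=> hi; split; first exact: sl.
  rewrite lexx/=; apply: ltW; case: hs => /(pathP b) ps _.
  exact: ps.
move=> /(_ hc); set S := \sum_(0 <= i < size s) _ => HS.
have hS : `|S| <= M * V.
  rewrite (le_trans (ler_norm_sum _ _ _))//.
  apply: (@le_trans _ _ (M * psum (fun u v => `|g v - g u|) a s)); last first.
    by rewrite ler_wpM2l// hV.
  rewrite -(psumE _ _ b) big_distrr/= big_seq [leRHS]big_seq.
  apply: ler_sum => i; rewrite mem_index_iota => /andP[_ hi].
  rewrite normrM ler_wpM2r// hM// /c.
  rewrite (itv_partition_nth_ge _ hs) ?(itv_partition_nth_le _ hs)//.
    by rewrite ltnW.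
  by rewrite ltnW.
rewrite -[v](subKr S) (le_trans (ler_normB _ _))//.
by rewrite lerD// ltW.
Qed.

Lemma is_RS_integral_unique f g a b (v v' : R) : a <= b ->
  is_RS_integral f g a b v -> is_RS_integral f g a b v' -> v = v'.
Proof.
move=> ab h h'; apply/eqP; rewrite -subr_eq0 -normr_le0.
apply/ler_addgt0Pr => e e0; rewrite add0r.
have e2 : 0 < e / 2 by rewrite divr_gt0.
have [dl dl0 H] := h _ e2; have [dl' dl'0 H'] := h' _ e2.
have m0 : 0 < Num.min dl dl' by rewrite lt_min dl0.
have [s hs sl] := fine_partition ab m0.
pose c i := nth b (a :: s) i.
have hc i : (i < size s)%N -> nth b s i - nth b (a :: s) i < Num.min dl dl' /\
    nth b (a :: s) i <= c i <= nth b s i.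
  move=> hi; split; first exact: sl.
  rewrite lexx/=; apply: ltW; case: hs => /(pathP b) ps _.
  exact: ps.
have hc1 i : (i < size s)%N -> nth b s i - nth b (a :: s) i < dl /\
    nth b (a :: s) i <= c i <= nth b s i.
  by move=> /hc[]; rewrite lt_min => /andP[].
have hc2 i : (i < size s)%N -> nth b s i - nth b (a :: s) i < dl' /\
    nth b (a :: s) i <= c i <= nth b s i.
  by move=> /hc[]; rewrite lt_min => /andP[].
have := H s c hs hc1; have := H' s c hs hc2.
set S := \sum_(0 <= i < size s) _ => h1 h2.
rewrite (_ : v - v' = (S - v') - (S - v)); last by ring.
rewrite (le_trans (ler_normB _ _))// (splitr e); apply/ltW/ltrD => //.
Qed.

Lemma RS_integralP f g a b (v : R) : a <= b -> is_RS_integral f g a b v ->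
  RS_integral f g a b = v.
Proof.
move=> ab hv; rewrite /RS_integral; case: xgetP => [w _ hw|]; last by move=> /(_ v).
exact: is_RS_integral_unique hw hv.
Qed.

End Partition.

(** * Curves and their signatures *)

Section Signature.
Variables (R : realType) (d : nat).
Implicit Types (gamma : R -> 'rV[R]_d) (L t : R).

Lemma norm_le_euclid (v : 'rV[R]_d) i : `|v 0 i| <= euclid_norm v.
Proof.
rewrite /euclid_norm -sqrtr_sqr ler_wsqrtr// (bigD1 i)//= lerDl.
by apply: sumr_ge0 => j _; rewrite sqr_ge0.
Qed.

Lemma euclid_norm_le (v : 'rV[R]_d) (e : R) : 0 <= e -> (forall i, `|v 0 i| <= e) ->
  euclid_norm v <= d%:R * e.
Proof.
move=> e0 h; have de : 0 <= d%:R * e by rewrite mulr_ge0.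
rewrite /euclid_norm -[leRHS](ger0_norm de) -sqrtr_sqr ler_wsqrtr//.
apply: (@le_trans _ _ (\sum_(i < d) e ^+ 2)).
  by apply: ler_sum => i _; rewrite -real_normK ?num_real// ler_sqr ?nnegrE// h.
rewrite sumr_const card_ord -[leLHS]mulr_natl exprMn ler_wpM2r ?sqr_ge0//.
by rewrite -natrX ler_nat; case: (d) => // n; rewrite expnS leq_pmulr// expn1.
Qed.

Lemma psum_curve_length gamma L t s i : (curve_length gamma <= L%:E)%E ->
  0 <= t <= 1 -> itv_partition 0 t s ->
  psum (fun u v => `|gamma v 0 i - gamma u 0 i|) 0 s <= L.
Proof.
move=> hL /andP[t0 t1] hs.
have key s' : itv_partition 0 1 s' ->
    psum (fun u v => `|gamma v 0 i - gamma u 0 i|) 0 s' <= L.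
  move=> hs'; rewrite -lee_fin (le_trans _ hL)//.
  rewrite (le_trans _ (partition_sum_mem _ hs'))//.
  elim: s' (0 : R) {hs'} => [|c s' IH] u //=.
  rewrite EFinD; apply: leeD; last exact: IH.
  rewrite lee_fin; have := norm_le_euclid (gamma c - gamma u) i.
  by rewrite !mxE.
have [e|ne] := eqVneq t 1; first by apply: key; rewrite -e.
have t1' : t < 1 by rewrite lt_neqAle ne.
apply: le_trans (key _ (itv_partition_rcons hs t1')).
by rewrite -cats1 psum_cat lerDl /= addr0.
Qed.

Lemma iter_int_bound gamma L u t : (curve_length gamma <= L%:E)%E ->
  0 <= t <= 1 -> `|iter_int gamma u t| <= L ^+ size u.
Proof.
move=> hL; elim: u t => [|i u IH] t ht /=; first by rewrite normr1.
have /andP[t0 t1] := ht.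
rewrite exprSr; apply: RS_integral_bound => //.
  by move=> c /andP[c0 ct]; apply: IH; rewrite c0 (le_trans ct).
by move=> s hs; apply: psum_curve_length hs.
Qed.

Lemma CC_norm_bound k (g : tensor R d k) L s : 0 <= L -> (CC_norm g < L%:E)%E ->
  `|g s| <= L ^+ size s.
Proof.
move=> L0 /ereal_inf_lt[_ [gamma [_ _ <-] <-]] /ltW hL.
rewrite mktE; case: ifP => hs.
  by rewrite -(size_rev s); apply: iter_int_bound => //; rewrite ler01 lexx.
by rewrite normr0 exprn_ge0.
Qed.

End Signature.

Lemma tvec_size (F : fieldType) d k (v : 'rV[F]_d) (s : seq 'I_d) :
  size s != 1%N -> tvec k v s = 0.
Proof. by rewrite mktE; case: s => [|a [|b s]]//=; rewrite if_same. Qed.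

Lemma tcoefM_tvec (F : fieldType) d k (x : tensor F d k) v (w : seq 'I_d) i :
  (size w < k)%N -> (x * tvec k v) (rcons w i) = x w * v 0 i.
Proof.
move=> hw; rewrite tcoefM size_rcons// 2!big_ord_recr/=.
rewrite big1 ?add0r => [|j _]; last first.
  rewrite tvec_size ?mulr0// size_drop size_rcons subSn ?eqSS ?subn_eq0 -?ltnNge//.
  by rewrite ltnW.
rewrite [drop _.+1 _]drop_oversize ?size_rcons// [tvec k v [::]]tvec_size// mulr0 addr0.
rewrite -cats1 take_size_cat// drop_size_cat// mktE/=.
by rewrite (leq_ltn_trans _ hw).
Qed.

(** Factoring out [x ^+ 2] exhibits the remainder as quadratic in x, as the local expansion of a
    segment's signature requires. *)
Lemma texp_quad (F : numFieldType) d k (x : tensor F d k) : x [::] = 0 ->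
  texp x - 1 - x = teval x (drop_poly 2 (exp_poly F k)) * x ^+ 2.
Proof.
move=> x0; rewrite texpE -{1}(poly_take_drop 2 (exp_poly F k)) teval_horner//.
rewrite rmorphD/= -!teval_horner// tevalM// [teval x 'X^2]teval_horner//.
rewrite rmorphXn/= horner_algX (@eq_teval _ _ _ _ _ (1 + 'X)).
  rewrite [teval x (1 + 'X)]teval_horner// rmorphD/= rmorph1 horner_algX.
  by apply: tensorP => s _; rewrite !(tcoefD, tcoefN); ring.
move=> i hi; rewrite coef_take_poly coefD coefC coefX coef_poly (ltnS i k) hi.
by case: i hi => [|[|i]] hi /=; rewrite ?fact0 ?invr1 ?addr0 ?add0r.
Qed.

(** * Elements reached by Lipschitz curves *)

Section Reach.
Variables (R : realType) (d : nat).
Implicit Types (gamma : R -> 'rV[R]_d) (L t u v : R).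

Definition ordered01 (uv : R * R) := 0 <= uv.1 /\ uv.1 <= uv.2 <= 1.

Definition gap (uv : R * R) : R := uv.2 - uv.1.

(** The constant length scale: along one fixed curve, [dom] only has to count powers of the time
    gap. *)
Definition one_gap (uv : R * R) : R := 1.

Lemma gap_ge0 uv : ordered01 uv -> 0 <= gap uv.
Proof. by move=> [_ /andP[h _]]; rewrite subr_ge0. Qed.

Definition flow_err k gamma (S : R -> tensor R d k) (uv : R * R) :=
  S uv.2 - S uv.1 - S uv.1 * tvec k (gamma uv.2 - gamma uv.1).

(** [S] is the signature of [gamma] up to the current time, characterized by
    the local expansion dS = S (x) dgamma. *)
Record flow k L (g : tensor R d k) gamma (S : R -> tensor R d k) : Prop := Flow {
  flow_lip : forall i u v, ordered01 (u, v) ->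
    `|gamma v 0 i - gamma u 0 i| <= L * (v - u);
  flow_start : S 0 = 1;
  flow_end : S 1 = g;
  flow_nil : forall t, S t [::] = 1;
  flow_bdd1 : dom ordered01 one_gap one_gap (fun uv => S uv.1);
  flow_step : dom ordered01 (fun uv => gap uv ^+ 2) one_gap (flow_err gamma S) }.

Definition reach k L (g : tensor R d k) :=
  free_group g /\ exists gamma S, flow L g gamma S.

Section Flow.
Variables (k : nat) (L : R) (g : tensor R d k) (gamma : R -> 'rV[R]_d).
Variable S : R -> tensor R d k.
Hypothesis fS : flow L g gamma S.

Let one_gap_ge0 uv : ordered01 uv -> 0 <= one_gap uv. Proof. by []. Qed.

Lemma flow_bdd2 : dom ordered01 one_gap one_gap (fun uv => S uv.2).
Proof.
have [C C0 h] := flow_bdd1 fS; exists C => // -[u v] [u0 /andP[uv v1]] s hs.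
apply: (h (v, v)) => //; split=> /=; first exact: le_trans uv.
by rewrite lexx.
Qed.

Lemma flow_dtvec : dom ordered01 gap one_gap
  (fun uv => tvec k (gamma uv.2 - gamma uv.1)).
Proof.
exists `|L| => // -[u v] huv s hs; rewrite expr1n mulr1 /gap/=.
rewrite mktE hs; case: s hs => [|i [|j s]] hs; rewrite ?normr0 ?mulr_ge0 ?(gap_ge0 huv)//.
rewrite !mxE; apply: le_trans (flow_lip fS i huv) _.
by rewrite ler_wpM2r ?ler_norm// (gap_ge0 huv).
Qed.

Lemma flow_diff : dom ordered01 gap one_gap (fun uv => S uv.2 - S uv.1).
Proof.
rewrite (_ : (fun uv => _) = fun uv : R * R =>
    1 *: (S uv.1 * tvec k (gamma uv.2 - gamma uv.1)) + flow_err gamma S uv); last first.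
  by apply/funext => uv; rewrite /flow_err scale1r [RHS]addrC subrK.
apply: dom_lin => //; first exact: gap_ge0.
  apply: (@dom_le _ _ _ _ _ _ _ (fun uv => 1 * gap uv)) => //.
    by exists 1 => // uv _; rewrite !mul1r.
  by apply: domM => //; [exact: gap_ge0|exact: flow_bdd1 fS|exact: flow_dtvec].
apply: (@dom_le _ _ _ _ _ _ _ (fun uv => gap uv ^+ 2)) => //; last exact: flow_step fS.
exists 1 => // -[u v] huv; rewrite mul1r expr2 ler_piMr ?gap_ge0//.
by case: huv => /= u0 /andP[uv v1]; rewrite /gap/=; lra.
Qed.

(** By the local expansion of S, the tagged sums telescope to the coordinate of S, with two errors
    per step: the flow error, and the variation of S between the left end and the tag. Both are of
    second order in the mesh, which also proves that the integral exists. *)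
Lemma flow_iter_int (u : seq 'I_d) t : (size u <= k)%N -> 0 <= t <= 1 ->
  iter_int gamma u t = S t (rev u).
Proof.
elim: u t => [|i u IH] t hu ht /=; first by rewrite (flow_nil fS).
have /andP[t0 t1] := ht.
apply: RS_integralP => // e e0.
have [C C0 hE] := flow_step fS; have [C' C'0 hD] := flow_diff.
have hru : (size (rev u) < k)%N by rewrite size_rev.
have hru' : (size (rcons (rev u) i) <= k)%N by rewrite size_rcons.
have F0 : S 0 (rcons (rev u) i) = 0.
  by rewrite (flow_start fS) tcoef1; case: (rev u).
(* C accounts for the flow error and C' |L| for the position of the tags; K + 1 below excludes a
   division by 0. *)
pose K := C + C' * `|L|.
have K0 : 0 <= K by rewrite addr_ge0 ?mulr_ge0.
have K1 : 0 < K + 1 by lra.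
exists (e / (K + 1)); first by rewrite divr_gt0.
move=> s c hs hc; rewrite rev_cons.
have -> : S t (rcons (rev u) i) =
    \sum_(0 <= j < size s) (S (nth t s j) (rcons (rev u) i) -
                            S (nth t (0 :: s) j) (rcons (rev u) i)).
  rewrite (psumE (fun a b => S b (rcons (rev u) i) - S a (rcons (rev u) i))).
  by rewrite psum_tele F0 subr0; case: hs => _ /eqP ->.
rewrite -sumrB (le_lt_trans (ler_norm_sum _ _ _))//.
apply: (@le_lt_trans _ _ (\sum_(0 <= j < size s) K * (e / (K + 1)) *
    (nth t s j - nth t (0 :: s) j))); last first.
  rewrite -big_distrr/= (psumE (fun a b => b - a)) (psum_tele id).
  have -> : last 0 s = t by case: hs => _ /eqP.
  rewrite subr0 (le_lt_trans (_ : _ <= K * (e / (K + 1)))).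
  - by [].
  - by rewrite ler_piMr// mulr_ge0// ltW// divr_gt0.
  - by rewrite mulrA ltr_pdivrMr// mulrC; nra.
rewrite big_seq [leRHS]big_seq; apply: ler_sum => j.
rewrite mem_index_iota => /andP[_ hj].
have [hlt /andP[c1 c2]] := hc j hj.
have a0 : 0 <= nth t (0 :: s) j by rewrite (itv_partition_nth_ge _ hs)// ltnW.
have b1 : nth t s j <= 1.
  by rewrite (le_trans _ t1)// (itv_partition_nth_le _ hs (m := j.+1)).
move: (nth t (0 :: s) j) (nth t s j) (c j) hlt c1 c2 a0 b1 => a b c' hlt ac cb a0 b1.
have ab := le_trans ac cb.
have oab : ordered01 (a, b) by split=> //=; rewrite ab b1.
have oac : ordered01 (a, c') by split=> //=; rewrite ac (le_trans cb).
rewrite IH ?(ltnW hu)//; last by rewrite (le_trans a0 ac) (le_trans cb b1).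
have /(_ (a, b) oab _ hru') := hE.
rewrite expr1n mulr1 !tcoefB tcoefM_tvec// !mxE /gap/= => h1.
have /(_ (a, c') oac _ (ltnW hru)) := hD.
rewrite expr1n mulr1 tcoefB /gap/= => h2.
have h3 := flow_lip fS i oab.
set x := S c' _ in h2 *; set y := S a (rev u) in h1 h2 *.
set z := S b _ in h1 *; set w := S a _ in h1 *.
set dg := gamma b 0 i - gamma a 0 i in h1 h3 *.
have -> : x * dg - (z - w) = (x - y) * dg - (z - w - y * dg) by ring.
rewrite (le_trans (ler_normB _ _))//.
have h4 : `|(x - y) * dg| <= C' * (c' - a) * (`|L| * (b - a)).
  rewrite normrM ler_pM//; apply: le_trans h3 _.
  by rewrite ler_wpM2r ?ler_norm// subr_ge0.
apply: le_trans (lerD h4 h1) _.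
have h5 : c' - a <= e / (K + 1) by rewrite (le_trans _ (ltW hlt))// lerD2r.
have h6 : b - a <= e / (K + 1) by exact: ltW.
have h7 : 0 <= b - a by rewrite subr_ge0.
rewrite /K mulrDl [leRHS]mulrDl [leRHS]addrC lerD//.
  rewrite mulrA ler_wpM2r// -!mulrA ler_wpM2l// [_ * `|L|]mulrC ler_wpM2l//.
by rewrite expr2 mulrA ler_wpM2r// ler_wpM2l.
Qed.

Lemma flow_continuous : {within `[0, 1], continuous gamma}.
Proof.
apply/subspace_continuousP => x; rewrite /= in_itv/= => hx.
apply/cvg_ballP => e e0; rewrite near_withinE.
have L1 : 0 < `|L| + 1 by rewrite ltr_wpDl.
near=> y; rewrite /= in_itv/= => hy; split=> // i j.
rewrite !ord1 /ball/=.
have : `|x - y| < e / (`|L| + 1).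
  by near: y; apply: nbhsx_ballx; exact: divr_gt0.
rewrite ltr_pdivlMr// => h; apply: le_lt_trans h.
have [/andP[x0 x1] /andP[y0 y1]] := (hx, hy).
have [xy|/ltW yx] := leP x y.
  have o : ordered01 (x, y) by split=> //=; rewrite xy.
  rewrite distrC (le_trans (flow_lip fS j o))// mulrC distrC ger0_norm ?subr_ge0//.
  by rewrite ler_wpM2l ?subr_ge0// (le_trans (ler_norm _))// lerDl.
have o : ordered01 (y, x) by split=> //=; rewrite yx.
rewrite (le_trans (flow_lip fS j o))// mulrC ger0_norm ?subr_ge0//.
by rewrite ler_wpM2l ?subr_ge0// (le_trans (ler_norm _))// lerDl.
Unshelve. all: by end_near. Qed.

Lemma flow_length : (curve_length gamma <= (d%:R * `|L|)%:E)%E.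
Proof.
rewrite (_ : d%:R * `|L| = d%:R * `|L| * 1 - d%:R * `|L| * 0); last by ring.
apply: (partition_sup_le (h := fun t => d%:R * `|L| * t)) => u v u0 uv v1.
have o : ordered01 (u, v) by split=> //=; rewrite ltW.
rewrite lee_fin -mulrBr -mulrA; apply: euclid_norm_le.
  by rewrite mulr_ge0// subr_ge0 ltW.
move=> i; rewrite !mxE (le_trans (flow_lip fS i o))//.
by rewrite ler_wpM2r ?ler_norm// subr_ge0 ltW.
Qed.

Lemma flow_signature : signature k gamma = g.
Proof.
apply: tensorP => s hs; rewrite mktE hs flow_iter_int ?size_rev//.
  by rewrite revK (flow_end fS).
by rewrite ler01 lexx.
Qed.

Lemma flow_bound s : `|g s| <= (d%:R * `|L|) ^+ size s.
Proof.
rewrite -flow_signature mktE; case: ifP => hs; last by rewrite normr0 exprn_ge0.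
rewrite -(size_rev s); apply: iter_int_bound; first exact: flow_length.
by rewrite ler01 lexx.
Qed.

End Flow.

Lemma reach_CC k L (g : tensor R d k) : reach L g ->
  (CC_norm g <= (d%:R * `|L|)%:E)%E.
Proof.
move=> [_ [gamma [S fS]]]; apply: (@le_trans _ _ (curve_length gamma)).
  apply: ereal_inf_lbound; exists gamma => //; split.
  - exact: flow_continuous fS.
  - by rewrite (le_lt_trans (flow_length fS))// ltry.
  - exact: flow_signature fS.
exact: flow_length fS.
Qed.

End Reach.

Arguments ordered01 {R}.
Arguments gap {R}.
Arguments one_gap {R}.

(** * Segments and concatenation *)

Section ReachGroup.
Variables (R : realType) (d k : nat).
Implicit Types (L a t u v : R) (g h : tensor R d k) (w s : seq 'I_d).
Local Notation G := (@free_group R d k).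

Let one_gap_ge0 (uv : R * R) : ordered01 uv -> 0 <= one_gap uv. Proof. by []. Qed.

Lemma reach_le L L' g : L <= L' -> reach L g -> reach L' g.
Proof.
move=> LL' [Gg [gamma [S [lip S0 S1 Sn Sb Ss]]]]; split=> //; exists gamma, S.
split=> // i u v huv; apply: le_trans (lip i u v huv) _.
by rewrite ler_wpM2r//; exact: (gap_ge0 huv).
Qed.

Lemma tvecZ (a : R) (v : 'rV[R]_d) : tvec k (a *: v) = a *: tvec k v.
Proof.
apply: tensorP => s hs; rewrite tcoefZ !mktE hs.
by case: s {hs} => [|i [|? ?]]; rewrite ?mulr0// mxE.
Qed.

Lemma tvecD (u v : 'rV[R]_d) : tvec k (u + v) = tvec k u + tvec k v.
Proof.
apply: tensorP => s hs; rewrite tcoefD !mktE hs.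
by case: s {hs} => [|i [|? ?]]; rewrite ?addr0// mxE.
Qed.

Lemma dom_seg a (i : 'I_d) (c : R * R -> R) (e : R * R -> R) :
  (forall uv, ordered01 uv -> `|c uv| <= e uv) ->
  dom ordered01 e one_gap (fun uv => (c uv * a) *: tgen R k i).
Proof.
move=> hc; exists `|a| => // uv huv s hs; rewrite expr1n mulr1 tcoefZ normrM.
rewrite normrM [`|a| * _]mulrC -[leRHS]mulr1 ler_pM ?mulr_ge0// ?ler_wpM2r ?hc//.
by rewrite tgenE; case: (_ && _); rewrite ?normr1 ?normr0.
Qed.

(** The curve is a segment, whose signature is the exponential of its displacement. The flow error
    is S_u (exp y - 1 - y), with y the displacement over the gap, hence quadratic by [texp_quad]. *)
Lemma reach_tgen a (i : 'I_d) : reach `|a| (texp (a *: tgen R k i)).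
Proof.
have l0 := lie_tgen R k i; split; first by exists (a *: tgen R k i) => //; exact: lieZ.
have t0 c : (c *: tgen R k i) [::] = 0 by rewrite tcoefZ tgenE mulr0.
exists (fun t => (t * a) *: delta_mx 0 i), (fun t => texp ((t * a) *: tgen R k i)).
split.
- move=> j u v huv; have vu0 : 0 <= v - u := gap_ge0 huv.
  rewrite !mxE eqxx/= -mulrBl -mulrBl.
  rewrite !normrM [`|_| * `|a|]mulrC -mulrA ler_wpM2l// (ger0_norm vu0).
  by rewrite ler_piMr//; case: (_ == _); rewrite ?normr1 ?normr0.
- by rewrite mul0r scale0r texp_0.
- by rewrite mul1r.
- by move=> t; rewrite texp0.
- apply: bdd_texp => //; apply: dom_seg => -[u v] [/= u0 /andP[uv v1]].
  by rewrite ger0_norm// (le_trans uv).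
- have -> : flow_err (fun t => (t * a) *: delta_mx 0 i)
      (fun t => texp ((t * a) *: tgen R k i)) =
    fun uv => texp ((uv.1 * a) *: tgen R k i) *
      (teval ((gap uv * a) *: tgen R k i) (drop_poly 2 (exp_poly R k)) *
       (((gap uv * a) *: tgen R k i) * ((gap uv * a) *: tgen R k i))).
    apply/funext => uv; rewrite -expr2 -texp_quad// /flow_err -scalerBl tvecZ -mulrBl.
    have -> : uv.2 * a = uv.1 * a + gap uv * a by rewrite /gap; ring.
    by rewrite texpDZ ?tgenE// !mulrBr mulr1.
  have hy : dom ordered01 gap one_gap (fun uv => (gap uv * a) *: tgen R k i).
    by apply: dom_seg => uv huv; rewrite ger0_norm ?gap_ge0.
  have by' : bdd ordered01 one_gap (fun uv => (gap uv * a) *: tgen R k i).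
    apply: dom_seg => -[u v] [/= u0 /andP[uv v1]].
    by rewrite ger0_norm /gap/= ?subr_ge0//; lra.
  apply: (@dom_le _ _ _ _ _ _ _ (fun uv => 1 * (1 * (gap uv * gap uv)))) => //.
    by exists 1 => // uv _; rewrite !mul1r.
  have g0 (uv : R * R) : ordered01 uv -> 0 <= gap uv * gap uv.
    by move=> huv; rewrite mulr_ge0 ?gap_ge0.
  apply: domM => //; first by move=> uv /g0; rewrite mul1r.
    apply: bdd_texp => //; apply: dom_seg => -[u v] [/= u0 /andP[uv v1]].
    by rewrite ger0_norm// (le_trans uv).
  apply: domM => //; last by apply: domM => //; exact: gap_ge0.
  apply: (closed_teval (P := @bdd R d (R * R)%type ordered01 one_gap k)) => //.
  + exact: bdd1.
  + by move=> *; apply: bdd_lin.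
  + by move=> *; apply: bddM.
Qed.

Lemma reach1 : reach 0 (1 : tensor R d k).
Proof.
split; first exact: free_group1.
exists (fun=> 0), (fun=> 1); split=> //.
- by move=> i u v _; rewrite subrr normr0 mul0r.
- by move=> t; rewrite tcoef1.
- exact: bdd1.
- exists 0 => // uv _ s _; rewrite !mul0r normr_le0 /flow_err subrr mul1r.
  rewrite subrr sub0r tcoefN mktE; case: ifP; rewrite ?oppr0//.
  by case: s => [|i [|? ?]]; rewrite ?oppr0 ?mxE ?oppr0.
Qed.

(** Clocks for a concatenation: the first runs during [0, 1/2] and then stays at 1, the second waits
    at 0 until 1/2. *)
Definition first_half t : R := Num.min 1 (2 * t).
Definition second_half t : R := Num.max 0 (2 * t - 1).

Lemma halves u v : ordered01 (u, v) ->
  [/\ ordered01 (first_half u, first_half v),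
      ordered01 (second_half u, second_half v),
      gap (first_half u, first_half v) <= 2 * gap (u, v),
      gap (second_half u, second_half v) <= 2 * gap (u, v) &
      gap (first_half u, first_half v) + gap (second_half u, second_half v)
        = 2 * gap (u, v)].
Proof.
move=> [/= u0 /andP[uv v1]]; rewrite /first_half /second_half /gap /ordered01/=.
rewrite !minEle !maxEle; case: ifP => h1; case: ifP => h2; case: ifP => h3; case: ifP => h4;
 move: h1 h2 h3 h4; rewrite ?leNgt => h1 h2 h3 h4; split; try (split; [lra|apply/andP; split]); lra.
Qed.

Lemma dom_time (phi : R -> R) n (f : R * R -> tensor R d k) :
  (forall u v, ordered01 (u, v) -> ordered01 (phi u, phi v) /\
     gap (phi u, phi v) <= 2 * gap (u, v)) ->
  dom ordered01 (fun uv => gap uv ^+ n) one_gap f ->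
  dom ordered01 (fun uv => gap uv ^+ n) one_gap (fun uv => f (phi uv.1, phi uv.2)).
Proof.
move=> hphi [C C0 h]; exists (C * 2 ^+ n); first by rewrite mulr_ge0 ?exprn_ge0.
move=> -[u v] huv s hs; have [h1 h2] := hphi u v huv.
apply: le_trans (h _ h1 _ hs) _; rewrite !expr1n !mulr1 -mulrA ler_wpM2l//= -exprMn.
by rewrite lerXn2r// nnegrE ?mulr_ge0//; exact: gap_ge0.
Qed.

(** The concatenated curve is the sum of the two curves, each read on its own clock. At each time at
    most one clock runs, at double speed, whence the factor 2. *)
Lemma reachM L g h : reach L g -> reach L h -> reach (2 * L) (g * h).
Proof.
move=> [Gg [al [A fA]]] [Gh [be [B fB]]]; split; first exact: free_groupM.
have h0 : first_half 0 = 0 /\ second_half 0 = 0.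
  rewrite /first_half /second_half mulr0 sub0r; split; first by rewrite minEle ler10.
  by rewrite maxEle; case: ifP => //; lra.
have h1 : first_half 1 = 1 /\ second_half 1 = 1.
  rewrite /first_half /second_half minEle maxEle; split; case: ifP => //; lra.
have H1 u v : ordered01 (u, v) -> ordered01 (first_half u, first_half v) /\
    gap (first_half u, first_half v) <= 2 * gap (u, v) by move=> /halves[].
have H2 u v : ordered01 (u, v) -> ordered01 (second_half u, second_half v) /\
    gap (second_half u, second_half v) <= 2 * gap (u, v) by move=> /halves[].
exists (fun t => al (first_half t) + be (second_half t)),
  (fun t => A (first_half t) * B (second_half t)); split.
- move=> i u v huv; have [hu1 hu2 _ _ e] := halves huv.
  rewrite !mxE opprD addrACA (le_trans (ler_normD _ _))//.
  have l1 := flow_lip fA i hu1; have l2 := flow_lip fB i hu2.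
  rewrite (le_trans (lerD l1 l2))// -mulrDr.
  by move: e; rewrite /gap/= => ->; rewrite mulrCA mulrA.
- by rewrite h0.1 h0.2 (flow_start fA) (flow_start fB) mulr1.
- by rewrite h1.1 h1.2 (flow_end fA) (flow_end fB).
- by move=> t; rewrite tcoefM0 (flow_nil fA) (flow_nil fB) mulr1.
- apply: bddM => //.
    exact: (@dom_time _ 0 (fun uv => A uv.1) H1 (flow_bdd1 fA)).
  exact: (@dom_time _ 0 (fun uv => B uv.1) H2 (flow_bdd1 fB)).
- pose a uv := tvec k (al (first_half uv.2) - al (first_half uv.1)).
  pose b uv := tvec k (be (second_half uv.2) - be (second_half uv.1)).
  have key (uv : R * R) : ordered01 uv ->
      flow_err (fun t => al (first_half t) + be (second_half t))
        (fun t => A (first_half t) * B (second_half t)) uv =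
      A (first_half uv.2) * flow_err be B (second_half uv.1, second_half uv.2) +
      (flow_err al A (first_half uv.1, first_half uv.2) *
        (B (second_half uv.1) + B (second_half uv.1) * b uv) +
       A (first_half uv.1) * (a uv * (B (second_half uv.1) * b uv))).
    case: uv => u v huv.
    (* At time u either the second curve has not started, so that its signature is 1, or the first
       one has stopped, so that its increment is 0. *)
    have comm : a (u, v) * B (second_half u) = B (second_half u) * a (u, v).
      have [hu|hu] := leP u (1/2).
        have -> : second_half u = 0.
          by rewrite /second_half maxEle; case: ifP => //; lra.
        by rewrite (flow_start fB) mulr1 mul1r.
      have -> : a (u, v) = 0; last by rewrite mul0r mulr0.
      rewrite /a/=; have [e1 e2] : first_half v = 1 /\ first_half u = 1.
        case: huv => /= u0 /andP[uv v1].
        rewrite /first_half !minEle; split; case: ifP => //; lra.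
      rewrite e1 e2 subrr; apply: tensorP => s hs; rewrite mktE hs tcoef0.
      by case: s {hs} => [|? [|? ?]]; rewrite ?mxE.
    rewrite {1}/flow_err/= [tvec k (_ + _ - _)](_ : _ = a (u, v) + b (u, v)); last first.
      by rewrite /a /b/= -tvecD opprD addrACA.
    move: comm; rewrite /flow_err/= -/(a (u, v)) -/(b (u, v)).
    move: (a _) (b _) (A _) (A _) (B _) (B _) => a' b' A2 A1 B2 B1 comm.
    have e : A2 * B1 * (a' + b') = A2 * (a' * B1) + A2 * B1 * b' by rewrite comm mulrDr !mulrA.
    rewrite e; apply: tensorP => s _.
    by rewrite !(mulrDl, mulrDr, mulNr, mulrN, mulrA) !(tcoefD, tcoefN); ring.
  have bB1 : bdd ordered01 one_gap (fun uv => B (second_half uv.1)).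
    exact: (@dom_time _ 0 (fun uv => B uv.1) H2 (flow_bdd1 fB)).
  have bA1 : bdd ordered01 one_gap (fun uv => A (first_half uv.1)).
    exact: (@dom_time _ 0 (fun uv => A uv.1) H1 (flow_bdd1 fA)).
  have bA2 : bdd ordered01 one_gap (fun uv => A (first_half uv.2)).
    exact: (@dom_time _ 0 (fun uv => A uv.2) H1 (flow_bdd2 fA)).
  have da : dom ordered01 gap one_gap a.
    exact: (@dom_time _ 1 (fun uv => tvec k (al uv.2 - al uv.1)) H1 (flow_dtvec fA)).
  have db : dom ordered01 gap one_gap b.
    exact: (@dom_time _ 1 (fun uv => tvec k (be uv.2 - be uv.1)) H2 (flow_dtvec fB)).
  have gap1 (uv : R * R) : ordered01 uv -> gap uv <= 1.
    by move=> [/= u0 /andP[]]; rewrite /gap; lra.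
  have bb : bdd ordered01 one_gap b.
    apply: dom_le db => //; exists 1 => // uv huv; rewrite mulr1; exact: gap1.
  have EA := dom_time H1 (flow_step fA); have EB := dom_time H2 (flow_step fB).
  have g2 (uv : R * R) : ordered01 uv -> 0 <= gap uv ^+ 2 by move=> _; apply: sqr_ge0.
  have D1 : dom ordered01 (fun uv => gap uv ^+ 2) one_gap (fun uv : R * R =>
      A (first_half uv.2) * flow_err be B (second_half uv.1, second_half uv.2)).
    apply: dom_le (domM _ _ _ bA2 EB) => //.
    by exists 1 => // uv _; rewrite !mul1r.
  have bBb : bdd ordered01 one_gap (fun uv => B (second_half uv.1) * b uv) by apply: bddM.
  have D2 : dom ordered01 (fun uv => gap uv ^+ 2) one_gap (fun uv : R * R =>
      flow_err al A (first_half uv.1, first_half uv.2) *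
        (B (second_half uv.1) + B (second_half uv.1) * b uv)).
    apply: (@dom_le _ _ _ _ _ _ _ (fun uv => gap uv ^+ 2 * 1)) => //.
      by exists 1 => // uv _; rewrite mul1r mulr1.
    apply: domM => //.
    have [C C0 hC] := bdd_lin 1 bB1 bBb; exists C => // uv huv s hs.
    by have := hC uv huv s hs; rewrite scale1r.
  have D3 : dom ordered01 (fun uv => gap uv ^+ 2) one_gap (fun uv : R * R =>
      A (first_half uv.1) * (a uv * (B (second_half uv.1) * b uv))).
    apply: (@dom_le _ _ _ _ _ _ _ (fun uv => 1 * (gap uv * (1 * gap uv)))) => //.
      by exists 1 => // uv _; rewrite !mul1r expr2.
    apply: domM => //; first by move=> uv huv; rewrite mul1r mulr_ge0 ?gap_ge0.
    apply: domM => //; [exact: gap_ge0|by move=> uv huv; rewrite mul1r gap_ge0|].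
    by apply: domM => //; exact: gap_ge0.
  have [C C0 hC] := dom_lin 1 g2 D1 (dom_lin 1 g2 D2 D3).
  exists C => // uv huv s hs; rewrite key//.
  by have := hC uv huv s hs; rewrite !scale1r.
Qed.

End ReachGroup.

(** * Comparison of the Carnot-Caratheodory norm with the coordinates *)

Section BallBox.
Variables (R : realType) (d k : nat).
Implicit Types (L a c t : R) (g h : tensor R d k) (w s : seq 'I_d).
Local Notation G := (@free_group R d k).
Local Notation wbr := (@wbr R d k).
Local Notation tgen := (@tgen R d k).

(** The identity A B A^-1 B^-1 - 1 = [A - 1, B - 1] A^-1 B^-1 reduces the claim to the leading terms
    of A - 1 and B - 1. *)
Lemma vanish_commutator (A B x y : tensor R d k) i j :
  A [::] = 1 -> B [::] = 1 -> (0 < i)%N -> (0 < j)%N ->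
  vanish i x -> vanish j y ->
  vanish i.+1 (A - 1 - x) -> vanish j.+1 (B - 1 - y) ->
  vanish (i + j).+1 (A * B * (A^-1 * B^-1) - 1 - tbr x y).
Proof.
move=> A1 B1 i0 j0 hx hy hA hB.
have uA := unit_tcoef1 A1; have uB := unit_tcoef1 B1.
have vA : vanish i (A - 1).
  by rewrite -[A - 1](subrK x); apply: vanishD => //; apply: vanishW hA.
have vB : vanish j (B - 1).
  by rewrite -[B - 1](subrK y); apply: vanishD => //; apply: vanishW hB.
have e1 : A * B * (A^-1 * B^-1) - 1 = tbr A B * (A^-1 * B^-1).
  by rewrite /tbr mulrBl -[B * A * _]mulrA [A * (A^-1 * _)]mulrA mulrV// mul1r mulrV.
have e2 : tbr A B = tbr (A - 1) (B - 1).
  rewrite /tbr !(mulrBl, mulrBr, mulr1, mul1r).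
  by apply: tensorP => s _; rewrite !(tcoefD, tcoefN); ring.
have -> : A * B * (A^-1 * B^-1) - 1 - tbr x y =
    tbr (A - 1) (B - 1) * (A^-1 * B^-1 - 1) + (tbr (A - 1) (B - 1) - tbr x y).
  by rewrite e1 e2 mulrBr mulr1 addrA subrK.
apply: vanishD.
  rewrite -addn1; apply: vanishM; first exact: vanish_br.
  by apply/vanish1P; rewrite tcoefB tcoefM0 !tinv_nil// tcoef1 mulr1 subrr.
have -> : tbr (A - 1) (B - 1) - tbr x y =
    tbr (A - 1 - x) (B - 1) + tbr x (B - 1 - y).
  move: (A - 1) (B - 1) => A' B'.
  rewrite /tbr !(mulrBl, mulrBr).
  by apply: tensorP => s _; rewrite !(tcoefD, tcoefN); ring.
apply: vanishD; first by rewrite -addSn; apply: vanish_br.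
by rewrite -addnS; apply: vanish_br.
Qed.

(** The commutator of a segment of length t with the element of the shorter word; the coefficient c
    sits in the innermost segment. Inverses are carried along because the commutator contains them,
    and 4 comes from two layers of [reachM]. *)
Lemma reach_wbr w : w != [::] -> exists2 C, 0 <= C & forall t c, 0 <= t -> `|c| <= 1 ->
  exists g, [/\ reach (C * t) g, reach (C * t) g^-1 &
    vanish (size w).+1 (g - 1 - (c * t ^+ size w) *: wbr w)].
Proof.
elim: w => // i [|j w] IH _.
  exists 1 => // t c t0 c1; exists (texp ((c * t) *: tgen i)); rewrite mul1r.
  have le : `|c * t| <= t by rewrite normrM (ger0_norm t0) ler_piMl.
  have x0 : ((c * t) *: tgen i) [::] = 0 by rewrite tcoefZ tgenE mulr0.
  split; first exact: reach_le (reach_tgen k _ i).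
    rewrite (_ : _^-1 = texp ((- (c * t)) *: tgen i)).
      by apply: reach_le (reach_tgen k _ i); rewrite normrN.
    apply: (mulIr (unit_tcoef1 (texp0 x0))).
    by rewrite mulVr ?unit_tcoef1 ?texp0// scaleNr texpN.
  rewrite expr1; apply: (@texp_vanish _ _ _ 1) => //.
  by apply: vanishZ; exact/homog_vanish/homog_tgen.
have [C C0 H] := IH isT; exists (4 * (1 + C)); first by rewrite mulr_ge0 ?addr_ge0.
move=> t c t0 c1; have [g [rg rg' hg]] := H t c t0 c1.
pose A := texp (t *: tgen i).
have x0 : (t *: tgen i) [::] = 0 by rewrite tcoefZ tgenE mulr0.
have A1 : A [::] = 1 by rewrite texp0.
have g1 : g [::] = 1 by apply: free_group0; case: rg.
have uA := unit_tcoef1 A1; have ug := unit_tcoef1 g1.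
have rA : reach ((1 + C) * t) A.
  apply: reach_le (reach_tgen k t i); rewrite (ger0_norm t0) mulrDl mul1r lerDl.
  by rewrite mulr_ge0.
have rA' : reach ((1 + C) * t) A^-1.
  rewrite (_ : A^-1 = texp ((- t) *: tgen i)).
    apply: reach_le (reach_tgen k (- t) i); rewrite normrN (ger0_norm t0) mulrDl mul1r lerDl.
    by rewrite mulr_ge0.
  by apply: (mulIr uA); rewrite mulVr// scaleNr texpN.
have rB : reach ((1 + C) * t) g.
  by apply: reach_le rg; rewrite mulrDl mul1r lerDr.
have rB' : reach ((1 + C) * t) g^-1.
  by apply: reach_le rg'; rewrite mulrDl mul1r lerDr.
exists (A * g * (A^-1 * g^-1)); split.
- rewrite (_ : 4 * (1 + C) * t = 2 * (2 * ((1 + C) * t))); last by ring.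
  by apply: reachM; apply: reachM.
- have uA' : A^-1 \is a GRing.unit by rewrite unitrV.
  have ug' : g^-1 \is a GRing.unit by rewrite unitrV.
  have u1 : A * g \is a GRing.unit by rewrite unitrMl.
  have u2 : A^-1 * g^-1 \is a GRing.unit by rewrite unitrMl.
  rewrite (invrM u1 u2) (invrM uA ug) (invrM uA' ug') !invrK.
  rewrite (_ : 4 * (1 + C) * t = 2 * (2 * ((1 + C) * t))); last by ring.
  by apply: reachM; apply: reachM.
have -> : (c * t ^+ size (i :: j :: w)) *: wbr [:: i, j & w] =
    tbr (t *: tgen i) ((c * t ^+ size (j :: w)) *: wbr (j :: w)).
  rewrite /= tbrZr -[t *: tgen i]addr0 tbr_linearl /tbr mul0r mulr0 subr0 addr0 scalerA.
  by congr (_ *: _); rewrite [in LHS]exprS; ring.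
apply: (@vanish_commutator _ _ _ _ 1 (size (j :: w))) => //.
- by apply: vanishZ; exact/homog_vanish/homog_tgen.
- exact: vanishZ (homog_vanish (@homog_wbr R d k (j :: w))).
- by apply: (@texp_vanish _ _ _ 1) => //; apply: vanishZ; exact/homog_vanish/homog_tgen.
Qed.

Lemma vanish_mul_near (g h x y : tensor R d k) j : (0 < j)%N ->
  vanish j x -> vanish j y -> vanish j.+1 (g - 1 - x) -> vanish j.+1 (h - 1 - y) ->
  vanish j.+1 (g * h - 1 - (x + y)).
Proof.
move=> j0 hx hy hg hh.
have vg : vanish j (g - 1).
  by rewrite -[g - 1](subrK x); apply: vanishD => //; apply: vanishW hg.
have vh : vanish j (h - 1).
  by rewrite -[h - 1](subrK y); apply: vanishD => //; apply: vanishW hh.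
have -> : g * h - 1 - (x + y) = (g - 1) * (h - 1) + ((g - 1 - x) + (h - 1 - y)).
  rewrite !(mulrBl, mulrBr, mulr1, mul1r).
  by apply: tensorP => s _; rewrite !(tcoefD, tcoefN); ring.
apply: vanishD; last exact: vanishD.
apply: (@vanishW _ _ _ _ (j + j)); first by rewrite -addn1 leq_add2l.
exact: vanishM.
Qed.

Lemma reach_lin j (ws : seq (j.-tuple 'I_d)) : (0 < j)%N ->
  exists2 C, 0 <= C & forall t (c : seq 'I_d -> R), 0 <= t ->
    (forall w : j.-tuple 'I_d, `|c w| <= t ^+ j) ->
    exists2 g, reach (C * t) g &
      vanish j.+1 (g - 1 - \sum_(w <- ws) c w *: wbr w).
Proof.
move=> j0.
have hv (w : j.-tuple 'I_d) : vanish j (wbr w).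
  by have := homog_vanish (@homog_wbr R d k w); rewrite size_tuple.
elim: ws => [|w ws [C C0 IH]].
  exists 0 => // t c t0 _; exists 1; first by rewrite mul0r; exact: reach1.
  by rewrite big_nil subrr subr0; exact: vanish0.
have wn : tval w != [::] by rewrite -size_eq0 size_tuple -lt0n.
have [C' C'0 H] := reach_wbr wn.
exists (2 * (C' + C)); first by rewrite mulr_ge0 ?addr_ge0.
move=> t c t0 hc; have [h rh vh] := IH t c t0 hc.
have c1 : `|c w / t ^+ j| <= 1.
  have [->|tn] := eqVneq t 0.
    by rewrite expr0n gtn_eqF// invr0 mulr0 normr0.
  have tj : 0 < t ^+ j by rewrite exprn_gt0// lt_neqAle eq_sym tn.
  by rewrite normrM normfV (gtr0_norm tj) ler_pdivrMr// mul1r.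
have [g [rg _ vg]] := H t _ t0 c1.
(* For t = 0 the bound on the coefficients gives c w = 0, so the default value of the quotient does
   no harm. *)
have e : c w / t ^+ j * t ^+ size w = c w.
  rewrite size_tuple; have [t00|tn] := eqVneq t 0.
    have := hc w; rewrite t00 expr0n gtn_eqF//= normr_le0 => /eqP ->.
    by rewrite !mul0r.
  by rewrite mulfVK// expf_neq0.
exists (g * h).
  rewrite -mulrA; apply: reachM.
    by apply: reach_le rg; rewrite ler_wpM2r// lerDl.
  by apply: reach_le rh; rewrite ler_wpM2r// lerDr.
rewrite big_cons; move: vg; rewrite e size_tuple => vg.
apply: vanish_mul_near => //; first exact: vanishZ.
by apply: vanish_sum => w' _; exact: vanishZ.
Qed.

Lemma reach_level j : (j <= k)%N ->
  exists2 C, 0 <= C & forall t g, 0 <= t -> G g ->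
    (forall s, `|g s| <= t ^+ size s) ->
    exists2 h, reach (C * t) h & vanish j.+1 (h - g).
Proof.
elim: j => [_|j IH jk].
  exists 0 => // t g t0 Gg hg; exists 1; first by rewrite mul0r; exact: reach1.
  by apply/vanish1P; rewrite tcoefB tcoef1 (free_group0 Gg) subrr.
have [C C0 {}IH] := IH (ltnW jk).
(* All admissible triples (t, g, h) are made the index set of a family, so that [bddM] and [bdd_inv]
   bound h^-1 g with a constant independent of the triple. *)
pose P (x : R * tensor R d k * tensor R d k) :=
  [/\ 0 <= x.1.1, G x.1.2, forall s, `|x.1.2 s| <= x.1.1 ^+ size s,
      reach (C * x.1.1) x.2 & vanish j.+1 (x.2 - x.1.2)].
pose I := {x | P x}; pose l (i : I) := (sval i).1.1.
have l0 (i : I) : True -> 0 <= l i by case: i => -[[t g] h] [].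
have bg : bdd (fun=> True) l (fun i : I => (sval i).1.2).
  exists 1 => // i _ s _; have [_ _ hg _ _] := svalP i.
  by rewrite !mul1r; exact: hg.
have bh : bdd (fun=> True) l (fun i : I => (sval i).2).
  exists ((d%:R * C + 1) ^+ k); first by rewrite exprn_ge0// addr_ge0// mulr_ge0.
  move=> i _ s hs; have [t0 _ _ [_ [gamma [S fS]]] _] := svalP i.
  rewrite mulr1 (le_trans (flow_bound fS s))// (ger0_norm (mulr_ge0 C0 t0)).
  rewrite mulrA exprMn ler_wpM2r ?exprn_ge0//.
  have dC : 0 <= d%:R * C by rewrite mulr_ge0.
  apply: (@le_trans _ _ ((d%:R * C + 1) ^+ size s)).
    by rewrite lerXn2r ?nnegrE ?addr_ge0// lerDl.
  by rewrite ler_weXn2l// lerDr.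
have h1 (i : I) : (sval i).2 [::] = 1 by have [_ _ _ [/free_group0]] := svalP i.
have [K K0 hK] := bddM l0 (bdd_inv l0 h1 bh) bg.
have [C' C'0 H] := reach_lin (enum {: j.+1.-tuple 'I_d}) (ltn0Sn j).
exists (2 * (C + C' * (K + 1))); first by rewrite mulr_ge0 ?addr_ge0 ?mulr_ge0 ?addr_ge0.
move=> t g t0 Gg hg; have [h rh vh] := IH t g t0 Gg hg.
have Px : P (t, g, h) by [].
have hh : h [::] = 1 := h1 (exist _ _ Px).
have uh := unit_tcoef1 hh.
pose g' := h^-1 * g.
have Gg' : G g' by apply: free_groupM => //; apply: free_groupV; case: rh.
have vg' : vanish j.+1 (g' - 1).
  rewrite (_ : g' - 1 = h^-1 * (g - h)); last by rewrite mulrBr mulVr.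
  by apply: vanishMl; rewrite -opprB; exact: vanishN.
have hK' s : (size s <= k)%N -> `|g' s| <= K * t ^+ size s.
  by move=> hs; have := hK (exist _ _ Px) Logic.I s hs; rewrite !mulr1.
pose r := tlevel j.+1 g'.
have er : r = \sum_(w <- enum {: j.+1.-tuple 'I_d}) (g' w / j.+1%:R) *: wbr w.
  have jn : (j.+1%:R : R) != 0 by rewrite pnatr_eq0.
  rewrite /r -(tlevel_tlog _ (free_group0 Gg') vg')//.
  rewrite -[LHS]scale1r -[X in X *: _ = _](mulVf jn) -scalerA lie_tlevel_dynkin//;
    last exact: lie_tlog.
  rewrite /dynkin_level scaler_sumr -big_enum/=; apply: eq_bigr => w _.
  rewrite scalerA [X in X *: _ = _]mulrC; congr ((_ / _) *: _).
  have := congr1 (fun x : tensor R d k => x w) (tlevel_tlog (ltn0Sn j) (free_group0 Gg') vg').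
  by rewrite !tlevelE size_tuple eqxx.
(* As K + 1 >= 1, the bound K t^(j+1) on the coefficients is below ((K + 1) t)^(j+1): the constant
   is absorbed into the length. *)
have [|w|h2 rh2 vh2] := H ((K + 1) * t) (fun w => g' w / j.+1%:R).
- by rewrite mulr_ge0// addr_ge0.
- rewrite normrM normfV normr_nat ler_pdivrMr//.
  have := hK' w; rewrite size_tuple => /(_ jk) /le_trans; apply.
  rewrite exprMn mulrAC ler_wpM2r ?exprn_ge0//.
  have K1 : 1 <= K + 1 by rewrite lerDr.
  apply: (@le_trans _ _ ((K + 1) ^+ j.+1)); last first.
    by rewrite ler_peMr ?ler1n// exprn_ge0// addr_ge0.
  rewrite (le_trans (_ : K <= K + 1)) ?lerDl// exprS ler_peMr ?exprn_ege1//.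
  by rewrite addr_ge0.
exists (h * h2).
  rewrite -mulrA; apply: reachM.
    by apply: reach_le rh; rewrite ler_wpM2r// lerDl mulr_ge0// addr_ge0.
  by apply: reach_le rh2; rewrite mulrA ler_wpM2r// lerDr.
have -> : h * h2 - g = h * (h2 - g').
  by rewrite mulrBr /g' mulrA mulrV// mul1r.
apply: vanishMl.
rewrite (_ : h2 - g' = (h2 - 1 - r) - (g' - 1 - r)); last first.
  by apply: tensorP => s _; rewrite !(tcoefD, tcoefN); ring.
apply: vanishB; first by rewrite er.
move=> s; rewrite ltnS leq_eqVlt => /orP[/eqP e|hs].
  by rewrite tcoefB tlevelE e eqxx tcoefB tcoef1 -size_eq0 e/= subr0 subrr.
by rewrite tcoefB vg'// tlevelE ltn_eqF// subrr.
Qed.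

Lemma CC_norm_le : exists2 C, 0 <= C & forall t g, 0 <= t -> G g ->
  (forall s, `|g s| <= t ^+ size s) -> (CC_norm g <= (C * t)%:E)%E.
Proof.
have [C C0 H] := reach_level (leqnn k).
exists (d%:R * C); first by rewrite mulr_ge0.
move=> t g t0 Gg hg; have [h rh vh] := H t g t0 Gg hg.
have -> : g = h.
  by apply/eqP; rewrite eq_sym -subr_eq0; apply/eqP; apply: vanish_gt vh.
by have := reach_CC rh; rewrite (ger0_norm (mulr_ge0 C0 t0)) mulrA.
Qed.

End BallBox.

(** * Sewing *)

Section Halving.
Variable R : realType.
Implicit Types (t u v x y : R) (s P : seq R).

Lemma half_powR (th : R) : 1 < th -> 2 * (2^-1 `^ th) < 1.
Proof.
move=> th1; have e : 2^-1 `^ th = 2^-1 * 2^-1 `^ (th - 1) :> R.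
  rewrite -{2}[2^-1 : R]powRr1 ?invr_ge0// -powRD; first by rewrite addrC subrK.
  by rewrite invr_neq0 ?implybT// pnatr_eq0.
rewrite e mulrA mulfV ?pnatr_eq0// mul1r -[ltRHS](congr1 (fun f => f (th - 1)) (@powR1 R)).
by apply: gt0_ltr_powR; rewrite ?subr_gt0 ?nnegrE ?invr_ge0//; lra.
Qed.

Definition sewing_const (th : R) : R := 2 / (1 - 2 * (2^-1 `^ th)).

Lemma sewing_const_ge0 th : 1 < th -> 0 <= sewing_const th.
Proof. by move=> /half_powR h; rewrite divr_ge0//; lra. Qed.

(** The partition is cut at the point where the control [a] has grown by half,
    rather than by removing one point at a time. *)
Lemma young_maximal (a : R -> R) (Xi : R -> R -> R) (th B lo hi : R) x s :
  1 < th -> 0 <= B ->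
  (forall u v, lo <= u -> u <= v -> v <= hi -> a u <= a v) ->
  (forall u, lo <= u -> u <= hi -> Xi u u = 0) ->
  (forall u v w, lo <= u -> u <= v -> v <= w -> w <= hi ->
     `|Xi u w - Xi u v - Xi v w| <= B * (a w - a u) `^ th) ->
  lo <= x -> path <%R x s -> last x s <= hi ->
  `|psum Xi x s - Xi x (last x s)| <=
    sewing_const th * B * (a (last x s) - a x) `^ th.
Proof.
move=> th1 B0 amon Xi0 H; have C0 := sewing_const_ge0 th1.
have [n] := ubnP (size s); elim: n x s => // n IH x s.
case: s => [|c0 s0] hn lox hs lhi.
  by rewrite /= Xi0// subrr normr0 mulr_ge0 ?powR_ge0// mulr_ge0.
move: (c0 :: s0) (isT : c0 :: s0 != [::]) hn hs lhi => {c0 s0} s s0 hn hs lhi.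
set y := last x s in lhi *; set om := a y - a x.
have part_le u r : path <%R u r -> u <= last u r.
  by move=> h; apply: (@itv_partition_le _ _ _ _ r); split.
have xy : x <= y by exact: part_le.
have om0 : 0 <= om by rewrite subr_ge0 amon.
have [l [c [r [es hl hr]]]] : exists l c r, [/\ s = l ++ c :: r,
    a (last x l) - a x <= om / 2 & a y - a c <= om / 2].
  pose p := fun t => om / 2 < a t - a x.
  have [hp|/hasPn hp] := boolP (has p s).
    exists (take (find p s) s), (nth x s (find p s)), (drop (find p s).+1 s); split.
    - by rewrite -drop_nth ?cat_take_drop// -has_find.
    - have [e0|f0] := posnP (find p s); first by rewrite e0 take0/= subrr divr_ge0.
      have hl : (find p s <= size s)%N by rewrite find_size.
      rewrite (last_nth x) size_takel// -(prednK f0)/= nth_take ?prednK//.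
      have := @before_find _ x p s (find p s).-1; rewrite prednK// leqnn.
      by move=> /(_ isT) /negbT; rewrite -leNgt.
    - have := nth_find x hp; rewrite /p; set c := nth _ _ _.
      by rewrite /om; lra.
  (* No point exceeds half the growth, not even the last one; the control is then constant on the
     partition and any cut will do. *)
  have {}hp z : z \in s -> a z - a x <= om / 2 by move=> /hp; rewrite -leNgt.
  case: s s0 hs @y lhi @om xy om0 @p hp {hn} => // c r _ /= /andP[xc hcr] lhi xy om0 hp.
  exists [::], c, r; split=> //=; first by rewrite subrr divr_ge0.
  have h1 := hp _ (mem_last c r).
  have : a x <= a c by rewrite amon ?(ltW xc)// (le_trans (part_le _ _ hcr)).
  by lra.
move: hs; rewrite es cat_path/= => /and3P[hxl hlc hcr].
have yE : y = last c r by rewrite /y es last_cat.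
have xl := part_le _ _ hxl; have cy := part_le _ _ hcr.
have [sl sr] : (size l < n)%N /\ (size r < n)%N.
  move: hn; rewrite es size_cat/= ltnS addnS => h.
  by split; apply: leq_trans h; rewrite ltnS ?leq_addr ?leq_addl.
rewrite -yE in cy; have lx : lo <= last x l by apply: le_trans xl.
have lc : lo <= c by apply: le_trans lx (ltW hlc).
have chi : c <= hi by apply: le_trans cy lhi.
have IHl := IH x l sl lox hxl (le_trans (ltW hlc) chi).
have IHr := IH c r sr lc hcr; rewrite -yE in IHr; have {}IHr := IHr lhi.
have D1 := H x (last x l) c lox xl (ltW hlc) chi.
have D2 := H x c y lox (le_trans xl (ltW hlc)) cy lhi.
have -> : psum Xi x (l ++ c :: r) - Xi x y =
  (psum Xi x l - Xi x (last x l)) + (psum Xi c r - Xi c y)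
  - (Xi x c - Xi x (last x l) - Xi (last x l) c) - (Xi x y - Xi x c - Xi c y).
  by rewrite psum_cat/=; ring.
have pmon u v : 0 <= u -> u <= v -> u `^ th <= v `^ th.
  have th0 : 0 <= th by rewrite ltW// (lt_trans _ th1).
  by move=> u0 uv; apply: ge0_ler_powR; rewrite ?nnegrE// (le_trans u0).
have pl : (a (last x l) - a x) `^ th <= (2^-1 `^ th) * om `^ th.
  rewrite -powRM ?invr_ge0// mulrC pmon// subr_ge0 amon//.
  exact: le_trans (ltW hlc) chi.
have pr : (a y - a c) `^ th <= (2^-1 `^ th) * om `^ th.
  by rewrite -powRM ?invr_ge0// mulrC pmon// subr_ge0 amon.
have p1 : (a c - a x) `^ th <= om `^ th.
  rewrite pmon ?subr_ge0 ?lerD2r ?amon//; exact: le_trans xl (ltW hlc).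
have E : sewing_const th = 2 * 2^-1 `^ th * sewing_const th + 2.
  have := half_powR th1; rewrite /sewing_const; set q := 2^-1 `^ th => hq.
  field; lra.
have CB : 0 <= sewing_const th * B by rewrite mulr_ge0.
have {}IHl := le_trans IHl (ler_wpM2l CB pl).
have {}IHr := le_trans IHr (ler_wpM2l CB pr).
have {}D1 := le_trans D1 (ler_wpM2l B0 p1).
have -> : sewing_const th * B * om `^ th =
  sewing_const th * B * (2^-1 `^ th * om `^ th) +
  sewing_const th * B * (2^-1 `^ th * om `^ th) + B * om `^ th + B * om `^ th.
  by rewrite {1}E; ring.
rewrite (le_trans (ler_normB _ _))// lerD//.
by rewrite (le_trans (ler_normB _ _))// lerD// (le_trans (ler_normD _ _))// lerD.
Qed.

End Halving.

(** * Partitions ordered by refinement *)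

Section Refinement.
Variable R : realType.
Implicit Types (s t u : R) (P Q : seq R).

(** The list P is arbitrary, neither sorted nor confined to [s, t]: one P thus partitions all
    intervals at once, consistently by [cut_cat]. *)
Definition cut s t P : seq R :=
  if s < t then rcons (sort <=%R (undup [seq x <- P | s < x < t])) t else [::].

Lemma mem_cut s t P x : s < t -> (x \in cut s t P) = (x \in P) && (s < x < t) || (x == t).
Proof.
move=> st; rewrite /cut st mem_rcons inE mem_sort mem_undup mem_filter.
by rewrite orbC andbC.
Qed.

Lemma last_cut s t P : s <= t -> last s (cut s t P) = t.
Proof.
rewrite /cut; case: ltP => [_ _|ts st]; first by rewrite last_rcons.
by apply/eqP; rewrite /= eq_le st.
Qed.

Lemma path_cut s t P : path <%R s (cut s t P).
Proof.
rewrite /cut; case: ifP => // st; rewrite rcons_path; apply/andP; split.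
  rewrite path_sortedE; last exact: lt_trans.
  rewrite sort_lt_sorted undup_uniq andbT; apply/allP => x.
  by rewrite mem_sort mem_undup mem_filter => /andP[/andP[]].
have := mem_last s (sort <=%R (undup [seq x <- P | s < x < t])).
rewrite inE => /predU1P[->//|].
by rewrite mem_sort mem_undup mem_filter => /andP[/andP[]].
Qed.

Lemma cut_cat s u t P : s < u -> u < t -> u \in P ->
  cut s t P = cut s u P ++ cut u t P.
Proof.
move=> su ut uP; have st := lt_trans su ut.
apply: (@lt_sorted_eq _ R).
- exact: path_sorted (path_cut s t P).
- apply: (@path_sorted _ _ s); rewrite cat_path path_cut/= last_cut ?(ltW su)//.
  exact: path_cut.
move=> x; rewrite mem_cat !mem_cut//.
have [->|xu] := eqVneq x u; first by rewrite su ut uP orbT.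
case: (x \in P) => //=.
have [lt|gt|e] := ltgtP x u; last by rewrite e eqxx in xu.
  by rewrite (lt_trans lt ut) andbT orbF; case: (s < x); rewrite //= ?orbF;
    case: eqP => // e; have := lt_trans lt ut; rewrite e ltxx.
by rewrite (lt_trans su gt).
Qed.

Definition refinement : set_system (seq R) :=
  [set A | exists Q, forall P, {subset Q <= P} -> A P].

#[local] Instance refinement_filter : ProperFilter refinement.
Proof.
split.
  by move=> [Q /(_ Q)]; apply.
split.
- by exists [::].
- move=> A B [Q hQ] [Q' hQ']; exists (Q ++ Q') => P hP; split; [apply: hQ|apply: hQ'].
    by move=> x xQ; apply: hP; rewrite mem_cat xQ.
  by move=> x xQ; apply: hP; rewrite mem_cat xQ orbT.
- by move=> A B AB [Q hQ]; exists Q => P /hQ /AB.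
Qed.

(** Every given point u belongs to almost all P, which is the hypothesis of [cut_cat] for splitting
    an interval at u. *)
Lemma refinement_ultra : exists2 U : set_system (seq R), UltraFilter U &
  forall u, U [set P : seq R | u \in P].
Proof.
have [U [uU hU]] := ultraFilterLemma refinement_filter.
exists U => // u; apply: hU; exists [:: u] => P; apply; exact: mem_head.
Qed.

Lemma fmap_ultra (S T : Type) (U : set_system S) (f : S -> T) :
  UltraFilter U -> UltraFilter (f @ U).
Proof.
move=> uU; split; first exact: fmap_proper_filter.
move=> G pG sub; apply/seteqP; split=> // A GA.
have [//|UC] := in_ultra_setVsetC (f @^-1` A) uU.
have : G (A `&` ~` A) by apply: filterI => //; exact: sub.
by rewrite setICr => /filter_ex[].
Qed.

Lemma bounded_ultra_cvg (T : Type) (U : set_system T) (f : T -> R) M :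
  UltraFilter U -> (forall x, `|f x| <= M) -> exists l : R, f x @[x --> U] --> l.
Proof.
move=> uU hM; have := @segment_compact R (- M) M; rewrite compact_ultra.
move=> /(_ (f @ U)) []; first exact: fmap_ultra.
- by apply: (@filterE _ U _ (f @^-1` `[- M, M]%classic)) => x;
    rewrite /preimage/= in_itv/= -ler_norml.
- by move=> l [_ hl]; exists l.
Qed.
End Refinement.

(** * The sewing lemma *)

Section Sewing.
Variables (R : realType) (T : R) (a : R -> R) (Xi : R -> R -> R) (K kap th : R).
Hypothesis a_mono : forall u v, 0 <= u -> u <= v -> v <= T -> a u <= a v.
Hypothesis th1 : 1 < th.
Hypothesis kap0 : 0 <= kap.
Hypothesis K0 : 0 <= K.
Hypothesis Xi0 : forall u, 0 <= u -> u <= T -> Xi u u = 0.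
Hypothesis Xi_defect : forall x u y, 0 <= x -> x <= u -> u <= y -> y <= T ->
  `|Xi x y - Xi x u - Xi u y| <=
    K * Num.min (a u - a x) (a y - a u) `^ kap * (a y - a x) `^ th.

Let cut_bound s t eta P : 0 <= s -> s <= t -> t <= T -> 0 <= eta ->
  (forall u, s < u -> u < t -> Num.min (a u - a s) (a t - a u) <= eta) ->
  `|psum Xi s (cut s t P) - Xi s t| <=
    sewing_const th * (K * eta `^ kap) * (a t - a s) `^ th.
Proof.
move=> s0 st tT eta0 heta.
have := @young_maximal R a Xi th (K * eta `^ kap) s t s (cut s t P).
rewrite last_cut//; apply=> //; rewrite ?path_cut//.
- by rewrite mulr_ge0 ?powR_ge0.
- by move=> u v su uv vt; apply: a_mono => //; [exact: le_trans su|exact: le_trans vt tT].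
- by move=> u su ut; apply: Xi0; [exact: le_trans su|exact: le_trans tT].
move=> x u y sx xu uy yt.
have x0 := le_trans s0 sx; have yT := le_trans yt tT.
have axy : 0 <= (a y - a x) `^ th by exact: powR_ge0.
have u0 := le_trans x0 xu; have uT := le_trans uy yT.
(* The bound eta concerns interior points of [s, t]; the other positions of u have x = u or u = y,
   where the defect is 0. *)
have [e|xu'] := eqVneq x u.
  by rewrite e Xi0// subr0 subrr normr0 !mulr_ge0 ?powR_ge0.
have [e|uy'] := eqVneq u y.
  by rewrite -e Xi0// subr0 subrr normr0 !mulr_ge0 ?powR_ge0.
apply: le_trans (Xi_defect x0 xu uy yT) _.
rewrite ler_wpM2r// ler_wpM2l//; apply: ge0_ler_powR => //.
- by rewrite nnegrE le_min !subr_ge0 !a_mono ?(le_trans x0)// (le_trans uy).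
- have su : s < u by rewrite (le_lt_trans sx)// lt_neqAle xu'.
  have ut : u < t by rewrite (lt_le_trans _ yt)// lt_neqAle uy'.
  apply: le_trans (heta u su ut); rewrite le_min !ge_min; apply/andP; split.
    by rewrite lerD2l lerN2 a_mono// (le_trans xu)// (le_trans uy).
  by rewrite lerD2r a_mono ?orbT// (le_trans x0)// (le_trans xu).
Qed.

(** The limit along an ultrafilter exists by compactness, without a Cauchy
    argument; the ultrafilter being the same on all intervals, the limit is
    additive. *)
Lemma sewing : exists2 h : R -> R, h 0 = 0 &
  forall s t eta, 0 <= s -> s <= t -> t <= T -> 0 <= eta ->
    (forall u, s < u -> u < t -> Num.min (a u - a s) (a t - a u) <= eta) ->
    `|h t - h s - Xi s t| <=
      sewing_const th * (K * eta `^ kap) * (a t - a s) `^ th.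
Proof.
have [U uU hU] := refinement_ultra R.
pose f s t P := psum Xi s (cut s t P).
have fcvg s t : 0 <= s -> s <= t -> t <= T -> exists l : R, f s t P @[P --> U] --> l.
  move=> s0 st tT; pose eta := a t - a s.
  have eta0 : 0 <= eta by rewrite subr_ge0 a_mono.
  apply: (@bounded_ultra_cvg _ _ _ _ (sewing_const th * (K * eta `^ kap) * eta `^ th + `|Xi s t|)).
  move=> P; rewrite -[f s t P](subrK (Xi s t)) (le_trans (ler_normD _ _))// lerD2r.
  apply: cut_bound => // u su ut; rewrite ge_min lerD2r a_mono ?orTb ?(ltW ut)//.
  exact: le_trans s0 (ltW su).
pose L s t := lim (f s t P @[P --> U]).
have fL s t : 0 <= s -> s <= t -> t <= T -> f s t P @[P --> U] --> L s t.
  by move=> s0 st tT; apply/cvg_ex/fcvg.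
have L00 : L 0 0 = 0.
  rewrite /L (_ : f 0 0 = fun=> 0); first exact: lim_cst.
  by apply/funext => P; rewrite /f /cut ltxx.
exists (L 0) => // s t eta s0 st tT eta0 heta.
have LD : L 0 t - L 0 s = L s t.
  have [->|s_ne] := eqVneq s 0; first by rewrite L00 subr0.
  have [<-|t_ne] := eqVneq s t.
    rewrite subrr /L (_ : f s s = fun=> 0) ?lim_cst//.
    by apply/funext => P; rewrite /f /cut ltxx.
  have s0' : 0 < s by rewrite lt_neqAle eq_sym s_ne.
  have st' : s < t by rewrite lt_neqAle t_ne.
  apply/eqP; rewrite subr_eq addrC; apply/eqP.
  have h1 : f 0 t P @[P --> U] --> L 0 t by apply: fL => //; exact: le_trans st.
  have h2 : (f 0 s P + f s t P) @[P --> U] --> L 0 s + L s t.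
    by apply: cvgD; apply: fL => //; exact: le_trans tT.
  apply: (cvg_unique (@Rhausdorff R) h1).
  apply: cvg_trans h2; apply: near_eq_cvg.
  apply: filterS (hU s) => P /= sP.
  by rewrite /f (cut_cat s0' st' sP) psum_cat last_cut// ltW.
rewrite LD.
have h : `|f s t P - Xi s t| @[P --> U] --> `|L s t - Xi s t|.
  by apply: cvg_norm; apply: cvgB; [exact: fL|exact: cvg_cst].
rewrite -(cvg_lim (@Rhausdorff R) h); apply: limr_le.
  by apply/cvg_ex; eexists; exact: h.
by apply: filterE => P; exact: cut_bound.
Qed.

End Sewing.

(** * Controls *)

Section Control.
Variables (R : realType) (d : nat).
Implicit Types (a : R -> R) (u v t p T : R).

Definition nondecr a T := forall u v, 0 <= u -> u <= v -> v <= T -> a u <= a v.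

Lemma CC_norm_ge0 k (g : tensor R d k) : (0 <= CC_norm g)%E.
Proof.
apply: le_ereal_inf_tmp => _ [gamma _ <-].
apply: le_trans (partition_sum_mem _ (itv_partition1 ltr01)).
by rewrite /= addr0 lee_fin sqrtr_ge0.
Qed.

(** The infimum need not be attained, so curves of length below L + e are used and e tends to 0. *)
Lemma CC_le_bound k (g : tensor R d k) (L : R) s : 0 <= L ->
  (CC_norm g <= L%:E)%E -> `|g s| <= L ^+ size s.
Proof.
move=> L0 hL.
have h : (L + e) ^+ size s @[e --> (0 : R)^'+] --> L ^+ size s.
  apply: cvg_at_right_filter; rewrite -{2}[L]addr0.
  apply: (@cvg_comp _ _ _ (fun e => L + e) (fun x => x ^+ size s)); last exact: exprn_continuous.
  by apply: cvgD; [exact: cvg_cst|exact: cvg_id].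
rewrite -(cvg_lim (@Rhausdorff R) h); apply: limr_ge.
  by apply/cvg_ex; eexists; exact: h.
near=> e; apply: CC_norm_bound; first by rewrite addr_ge0// ltW.
by rewrite (le_lt_trans hL)// lte_fin ltrDl.
Unshelve. all: by end_near. Qed.

(** The control of [u, v] is the increment of a monotone function, hence additive; [pvar_control]
    takes for a the p-variation over [0, t]. Nothing is asked of its continuity, as it has to jump
    with X. *)
Definition controls k p T (X : R -> tensor R d k) a :=
  nondecr a T /\ forall u v, 0 <= u -> u < v -> v <= T ->
    (CC_dist (X u) (X v) `^ p <= (a v - a u)%:E)%E.

Lemma pvar_of_control k p T (X : R -> tensor R d k) a :
  controls p T X a -> finite_pvar p T X.
Proof.
move=> [_ h]; apply: le_lt_trans (ltry (a T - a 0)).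
exact: partition_sup_le.
Qed.

Lemma pvar_control k p T (X : R -> tensor R d k) : 0 <= T ->
  finite_pvar p T X -> exists a, controls p T X a.
Proof.
move=> T0 hX; pose F s t := (CC_dist (X s) (X t) `^ p)%E.
have F0 s t : (0 <= F s t)%E by exact: poweR_ge0.
pose V t := partition_sup F 0 t.
have S0 x s : (0 <= psum F x s)%E.
  by elim: s x => //= c s IH x; exact: adde_ge0.
have VD u v : 0 <= u -> u < v -> (V u + F u v <= V v)%E.
  move=> u0 uv.
  have H s : itv_partition 0 u s -> (psum F 0%R s + F u v <= V v)%E.
    move=> hs; have := partition_sum_mem F (itv_partition_rcons hs uv).
    rewrite -cats1 psum_cat/= addr0.
    by have -> : last 0 s = u by case: hs => _ /eqP.
  (* F u v can be moved across the inequality only if it is finite; otherwise V v is infinite as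
     well. *)
  have [e|ne] := eqVneq (F u v) +oo%E.
    have [s hs _] := fine_partition u0 ltr01.
    have := H s hs; rewrite e addey; last by rewrite gt_eqF// (lt_le_trans _ (S0 _ _)).
    by rewrite leye_eq => /eqP ->; rewrite leey.
  have fF : F u v \is a fin_num by rewrite ge0_fin_numE// ltey.
  rewrite -leeBrDr//; apply: ub_ereal_sup => _ [s hs <-].
  by rewrite psumE leeBrDr//; exact: H.
have V0 t : 0 <= t -> (0 <= V t)%E.
  move=> t0; have [s hs _] := fine_partition t0 ltr01.
  exact: le_trans (S0 _ _) (partition_sum_mem F hs).
have Vmono u v : 0 <= u -> u <= v -> (V u <= V v)%E.
  rewrite [u <= v]le_eqVlt => u0 /predU1P[->//|uv].
  by apply: le_trans (VD u v u0 uv); rewrite leeDl.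
have Vfin t : 0 <= t -> t <= T -> V t \is a fin_num.
  move=> t0 tT; rewrite ge0_fin_numE ?V0//.
  exact: le_lt_trans (Vmono t T t0 tT) hX.
exists (fun t => fine (V t)); split.
  move=> u v u0 uv vT; apply: fine_le; rewrite ?Vfin//; last exact: Vmono.
    exact: le_trans vT.
  exact: le_trans uv.
move=> u v u0 uv vT.
have fu : V u \is a fin_num by rewrite Vfin// (le_trans (ltW uv)).
have fv : V v \is a fin_num by rewrite Vfin// (le_trans u0 (ltW uv)).
rewrite EFinB !fineK// -/(F u v) leeBrDr// addeC; exact: VD.
Qed.

Section Increments.
Variables (k : nat) (p T : R) (X : R -> tensor R d k) (a : R -> R).
Hypothesis p1 : 1 <= p.

(** The length scale of [u, v]: the control bounds the p-th power of the distance. *)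
Definition incr a p u v : R := (a v - a u) `^ p^-1.

Lemma controls_bound u v s : controls p T X a -> 0 <= u -> u <= v -> v <= T ->
  X v \is a GRing.unit -> `|((X u)^-1 * X v) s| <= incr a p u v ^+ size s.
Proof.
move=> [amono h] u0; rewrite le_eqVlt => /predU1P[->|uv] vT uX.
  rewrite mulVr// tcoef1 /incr subrr powR0 ?invr_neq0 ?gt_eqF ?(lt_le_trans _ p1)//.
  by case: s => [|i s]; rewrite ?normr1 ?expr0// normr0 exprS mul0r.
apply: CC_le_bound; first exact: powR_ge0.
have := h u v u0 uv vT; rewrite /CC_dist.
have := CC_norm_ge0 ((X u)^-1 * X v); case: (CC_norm _) => [r|_|//]; last first.
  by rewrite poweRyr ?leye_eq// gt_eqF// (lt_le_trans _ p1).
rewrite poweR_EFin !lee_fin => r0 hr; rewrite /incr.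
have pn0 : p != 0 by rewrite gt_eqF// (lt_le_trans _ p1).
rewrite -[r]powRr1// -(mulfV pn0) powRrM; apply: ge0_ler_powR => //.
- by rewrite invr_ge0 (le_trans _ p1).
- by rewrite nnegrE powR_ge0.
- by rewrite nnegrE (le_trans _ hr)// powR_ge0.
Qed.

Lemma controls_of_bound K : 0 <= K -> nondecr a T ->
  (forall u v, 0 <= u -> u < v -> v <= T ->
     (CC_dist (X u) (X v) <= (K * incr a p u v)%:E)%E) ->
  exists a', controls p T X a'.
Proof.
move=> K0 amono h; have p0 : 0 <= p by rewrite (le_trans _ p1).
exists (fun t => K `^ p * a t); split.
  by move=> u v u0 uv vT; rewrite ler_wpM2l ?powR_ge0// amono.
move=> u v u0 uv vT; have := h u v u0 uv vT; rewrite /CC_dist.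
have := CC_norm_ge0 ((X u)^-1 * X v); case: (CC_norm _) => [r|_|//]; last first.
  by rewrite leye_eq.
have auv : 0 <= a v - a u by rewrite subr_ge0 amono// ltW.
rewrite poweR_EFin !lee_fin -mulrBr => r0 hr.
have -> : K `^ p * (a v - a u) = (K * incr a p u v) `^ p.
  rewrite powRM ?powR_ge0// /incr -powRrM mulVf ?powRr1//.
  by rewrite gt_eqF// (lt_le_trans _ p1).
by apply: ge0_ler_powR => //; rewrite nnegrE ?mulr_ge0 ?powR_ge0.
Qed.
End Increments.

(** A monotone function has a left limit at t. The value at t itself is excluded, since [a] may jump
    there. *)
Lemma osc_left a T t (eta : R) : nondecr a T -> 0 < t <= T -> 0 < eta ->
  \forall s \near t^'-, forall u, s < u -> u < t -> a u - a s <= eta.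
Proof.
move=> amono /andP[t0 tT] eta0.
pose A := [set a s | s in [set s | 0 <= s < t]].
have supA : has_sup A.
  split; first by exists (a 0); exists 0 => //=; rewrite lexx.
  exists (a T) => _ [s /= /andP[s0 st] <-]; apply: amono => //.
  exact: le_trans (ltW st) tT.
have [_ [s0 /= /andP[s00 s0t] <-] hs0] := sup_adherent eta0 supA.
near=> s => u su ut.
have ss0 : s0 <= s by near: s; exact: nbhs_left_ge.
have au : a u <= sup A.
  apply: ub_le_sup; first exact: supA.2.
  by exists u => //=; rewrite ut (le_trans s00)// (le_trans ss0)// ltW.
have as0 : a s0 <= a s.
  by apply: amono => //; rewrite (le_trans (ltW su))// (le_trans (ltW ut)).
by lra.
Unshelve. all: by end_near. Qed.

Lemma osc_right a T t (eta : R) : nondecr a T -> 0 <= t < T -> 0 < eta ->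
  \forall s \near t^'+, forall u, t < u -> u < s -> a s - a u <= eta.
Proof.
move=> amono /andP[t0 tT] eta0.
pose A := [set a s | s in [set s | t < s <= T]].
have infA : has_inf A.
  split; first by exists (a T); exists T => //=; rewrite tT lexx.
  exists (a t) => _ [s /= /andP[ts sT] <-]; apply: amono => //; exact: ltW.
have [_ [s0 /= /andP[ts0 s0T] <-] hs0] := inf_adherent eta0 infA.
near=> s => u tu us.
have ss0 : s <= s0 by near: s; exact: nbhs_right_le.
have au : inf A <= a u.
  apply: ge_inf; first exact: infA.2.
  exists u => //=; rewrite tu/= (le_trans (ltW us))//.
  exact: le_trans ss0 s0T.
have as0 : a s <= a s0.
  by apply: amono => //; rewrite (le_trans t0)// (le_trans (ltW tu))// ltW.
by lra.
Unshelve. all: by end_near. Qed.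

(** By the intermediate value theorem the increment over an interval is twice
    the one over either of two subintervals, and on one of these the control
    grows by at most half. *)
Lemma small_variation_cst a T (th C : R) (f : R -> R) : 1 < th -> 0 <= C ->
  nondecr a T -> {within `[0, T], continuous f} ->
  (forall u v, 0 <= u -> u <= v -> v <= T -> `|f v - f u| <= C * (a v - a u) `^ th) ->
  forall t, 0 <= t <= T -> f t = f 0.
Proof.
move=> th1 C0 amono fc hf t /andP[t0 tT].
pose q : R := 2 * (2^-1 `^ th).
have q0 : 0 <= q by rewrite mulr_ge0 ?powR_ge0.
have q1 : q < 1 by exact: half_powR.
have H n u v : 0 <= u -> u <= v -> v <= T -> `|f v - f u| <= C * (a v - a u) `^ th * q ^+ n.
  elim: n u v => [|n IH] u v u0 uv vT; first by rewrite expr0 mulr1 hf.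
  have fuv : {within `[u, v], continuous f}.
    apply: continuous_subspaceW fc => x /=; rewrite !in_itv/= => /andP[ux xv].
    by rewrite (le_trans u0 ux) (le_trans xv vT).
  have [w] : exists2 c, c \in `[u, v] & f c = (f u + f v) / 2.
    apply: IVT => //; rewrite ge_min le_max.
    by case: (leP (f u) (f v)) => h; apply/andP; split; apply/orP; [left|right|right|left]; lra.
  rewrite in_itv/= => /andP[uw wv] fw.
  have e1 : `|f v - f u| = 2 * `|f w - f u|.
    have -> : f v - f u = 2 * (f w - f u) by rewrite fw; field.
    by rewrite normrM normr_nat.
  have e2 : `|f v - f u| = 2 * `|f v - f w|.
    have -> : f v - f u = 2 * (f v - f w) by rewrite fw; field.
    by rewrite normrM normr_nat.
  have a1 : a u <= a w by rewrite amono// (le_trans wv).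
  have a2 : a w <= a v by rewrite amono// (le_trans u0).
  have auv : 0 <= a v - a u by rewrite subr_ge0 amono.
  have half (y : R) : 0 <= y -> y <= (a v - a u) / 2 ->
      y `^ th <= (a v - a u) `^ th * 2^-1 `^ th.
    move=> y0 hy; rewrite -powRM ?invr_ge0//; apply: ge0_ler_powR => //.
    - by rewrite ltW// (lt_trans _ th1).
    - by rewrite nnegrE mulr_ge0 ?invr_ge0.
  have fin (x y : R) : `|f v - f u| = 2 * x -> 0 <= y -> y <= (a v - a u) / 2 ->
      x <= C * y `^ th * q ^+ n ->
      `|f v - f u| <= C * (a v - a u) `^ th * q ^+ n.+1.
    move=> -> y0 hy hx; rewrite (_ : C * _ * _ =
      2 * (C * ((a v - a u) `^ th * 2^-1 `^ th) * q ^+ n)); last by rewrite exprS /q; ring.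
    rewrite ler_wpM2l//; apply: le_trans hx _.
    by rewrite ler_wpM2r ?exprn_ge0// ler_wpM2l// half.
  have [hle|hlt] := leP (a w - a u) ((a v - a u) / 2).
    apply: (fin _ _ e1 _ hle); first by rewrite subr_ge0.
    by apply: IH => //; exact: le_trans vT.
  apply: (fin _ (a v - a w) e2); first by rewrite subr_ge0.
    by lra.
  by apply: IH => //; exact: le_trans uw.
apply/eqP; rewrite -subr_eq0 -normr_le0.
have h : C * (a t - a 0) `^ th * q ^+ n @[n --> \oo] --> C * (a t - a 0) `^ th * 0.
  apply: cvgM; first exact: cvg_cst.
  by apply: cvg_expr; rewrite ger0_norm.
rewrite -[leRHS](mulr0 (C * (a t - a 0) `^ th)) -[leRHS](cvg_lim (@Rhausdorff R) h).
apply: limr_ge.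
  by apply/cvg_ex; eexists; exact: h.
by apply: nearW => n; exact: H.
Qed.

End Control.

(** * Extension by one level *)

Section CadlagPaths.
Variables (R : realType) (d k : nat).
Implicit Types (X : R -> tensor R d k) (T t : R).

Lemma left_limitE X t (l : tensor R d k) : tcvg t^'- X l -> left_limit X t = l.
Proof.
move=> h; apply: tensorP => s hs; rewrite mktE hs.
by apply: cvg_lim => //; exact: h.
Qed.

Lemma cadlag_right X T t : cadlag_in (@free_group R d k) T X -> 0 <= t < T ->
  tcvg t^'+ X (X t).
Proof. by move=> [_ h _] ht s; exact: h. Qed.

Lemma cadlag_left X T t : cadlag_in (@free_group R d k) T X -> 0 < t <= T ->
  exists2 l, free_group l & tcvg t^'- X l.
Proof. by move=> [_ _ h] ht; have [l Gl hl] := h t ht; exists l. Qed.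

End CadlagPaths.

Section Extension.
Variables (R : realType) (d m : nat) (p T : R) (X : R -> tensor R d m).
Variable a : R -> R.
Hypotheses (p1 : 1 <= p) (pm : p < m.+1%:R).
Hypothesis X_cadlag : cadlag_in (@free_group R d m) T X.
Hypothesis X0 : X 0 = 1.
Hypothesis X_ctl : controls p T X a.
Implicit Types (u v x y t : R) (s w : seq 'I_d).

Local Notation M := m.+1.
Local Notation rho := (incr a p).

Let inT t := 0 <= t /\ t <= T.

Let a_mono : nondecr a T := X_ctl.1.
Let p0 : 0 < p := lt_le_trans ltr01 p1.

Let GX t : inT t -> free_group (X t).
Proof. by move=> [t0 tT]; case: X_cadlag => h _ _; apply: h; rewrite t0. Qed.

Let Xnil t : inT t -> X t [::] = 1.
Proof. by move=> /GX/free_group0. Qed.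

Let Xunit t : inT t -> X t \is a GRing.unit.
Proof. by move=> /GX/free_group_unit. Qed.

Fact path_key : unit. Proof. exact: tt. Qed.
Definition path_incr := locked_with path_key (fun u v => (X u)^-1 * X v).
Definition lifted_incr : R -> R -> tensor R d M :=
  locked_with path_key (fun u v => tlift M (path_incr u v)).
Definition lifted_path : R -> tensor R d M := locked_with path_key (fun t => tlift M (X t)).
Definition lift_defect u v : tensor R d M := lifted_path u * lifted_incr u v - lifted_path v.

Let xxE u v : path_incr u v = (X u)^-1 * X v. Proof. by rewrite /path_incr unlock. Qed.
Let zzE u v : lifted_incr u v = tlift M (path_incr u v). Proof. by rewrite /lifted_incr unlock. Qed.
Let ztE t : lifted_path t = tlift M (X t). Proof. by rewrite /lifted_path unlock. Qed.

Let Gxx u v : inT u -> inT v -> free_group (path_incr u v).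
Proof. by move=> hu hv; rewrite xxE; apply: free_groupM; [exact/free_groupV/GX|exact: GX]. Qed.

Let xxnil u v : inT u -> inT v -> path_incr u v [::] = 1.
Proof. by move=> hu hv; apply: free_group0; exact: Gxx. Qed.

Let Gzz u v : inT u -> inT v -> free_group (lifted_incr u v).
Proof. by move=> hu hv; rewrite zzE; apply: free_group_tlift => //; exact: Gxx. Qed.

Let zznil u v : inT u -> inT v -> lifted_incr u v [::] = 1.
Proof. by move=> hu hv; apply: free_group0; exact: Gzz. Qed.

Let Gzt t : inT t -> free_group (lifted_path t).
Proof. by move=> ht; rewrite ztE; apply: free_group_tlift => //; exact: GX. Qed.

Let ztnil t : inT t -> lifted_path t [::] = 1.
Proof. by move=> ht; apply: free_group0; exact: Gzt. Qed.

Let resize_zz u v : inT u -> inT v -> tresize m (lifted_incr u v) = path_incr u v.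
Proof. by move=> hu hv; rewrite zzE tresize_tlift ?xxnil. Qed.

Let resize_zt t : inT t -> tresize m (lifted_path t) = X t.
Proof. by move=> ht; rewrite ztE tresize_tlift ?Xnil. Qed.

Let xxM x u y : inT u -> path_incr x u * path_incr u y = path_incr x y.
Proof. by move=> hu; rewrite !xxE mulrA -(mulrA _ (X u)) mulrV ?Xunit// mulr1. Qed.

Let Xxx u v : inT u -> X u * path_incr u v = X v.
Proof. by move=> hu; rewrite xxE mulrA mulrV ?Xunit// mul1r. Qed.

Let xx_bound u v s : 0 <= u -> u <= v -> v <= T -> `|path_incr u v s| <= rho u v ^+ size s.
Proof.
move=> u0 uv vT; rewrite xxE.
by apply: (controls_bound p1 s X_ctl u0 uv vT); apply: Xunit; split=> //; exact: le_trans uv.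
Qed.

Lemma resize_vanish (x : tensor R d M) : tresize m x = 0 -> vanish M x.
Proof.
move=> h s hs; have := congr1 (fun x : tensor R d m => x s) h.
by rewrite tresizeE tcoef0 -ltnS hs.
Qed.

Lemma lift_defect_vanish u v : inT u -> inT v -> vanish M (lift_defect u v).
Proof.
move=> hu hv; apply: resize_vanish; rewrite tresizeB tresizeM//.
by rewrite (resize_zt hu) (resize_zt hv) (resize_zz hu hv) Xxx// subrr.
Qed.

(** The defect being of top level, the group element Z_0v^-1 Z_0u Z_uv equals 1 + defect, that is
    the exponential of the defect. *)
Lemma lift_defect_lie u v : inT u -> inT v -> free_lie (lift_defect u v).
Proof.
move=> hu hv; have hx := lift_defect_vanish hu hv.
have uz := free_group_unit (Gzt hv).
have e : (lifted_path v)^-1 * (lifted_path u * lifted_incr u v) = texp (lift_defect u v).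
  have -> : lifted_path u * lifted_incr u v = lifted_path v + lift_defect u v.
    by rewrite addrC subrK.
  rewrite mulrDr mulVr// texp_top// mulx_top// tinv_nil ?ztnil//.
  by rewrite scale1r.
have G : free_group (texp (lift_defect u v)).
  rewrite -e; apply: free_groupM; first exact/free_groupV/Gzt.
  by apply: free_groupM; [exact: Gzt|exact: Gzz].
by have := lie_tlog G; rewrite texpK//; apply: hx.
Qed.

(** Recovers the defect from its scalar coordinates, so that these can be sewn separately and still
    yield a Lie element. *)
Lemma lift_defect_dynkin u v : inT u -> inT v ->
  M%:R *: lift_defect u v = \sum_(w : M.-tuple 'I_d) lift_defect u v w *: wbr R M w.
Proof.
move=> hu hv; rewrite -/(dynkin_level M (lift_defect u v)).
rewrite -lie_tlevel_dynkin//; last exact: lift_defect_lie.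
congr (_ *: _); apply: tensorP => s hs; rewrite tlevelE.
by case: eqP => // /eqP ne; rewrite (lift_defect_vanish hu hv)// ltn_neqAle ne.
Qed.

(** The additive defect needed for sewing is the multiplicative defect of Z, as the factors
    [lifted_path x] and [lifted_incr u y] act as 1 on the top level. *)
Lemma lift_defect_defect x u y : inT x -> inT u -> inT y ->
  lift_defect x y - lift_defect x u - lift_defect u y =
    lifted_incr x y - lifted_incr x u * lifted_incr u y.
Proof.
move=> hx hu hy; pose dl := lifted_incr x y - lifted_incr x u * lifted_incr u y.
have vd : vanish M dl.
  apply: resize_vanish; rewrite tresizeB tresizeM//.
  by rewrite (resize_zz hx hy) (resize_zz hx hu) (resize_zz hu hy) xxM// subrr.
have e1 : lifted_path x * dl = dl by rewrite mulx_top// ztnil// scale1r.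
have e2 : lift_defect x u * lifted_incr u y = lift_defect x u.
  by rewrite mul_topx ?zznil ?scale1r//; exact: lift_defect_vanish.
rewrite -/dl -e1 /dl mulrBr mulrA.
have -> : lifted_path x * lifted_incr x u = lifted_path u + lift_defect x u by rewrite addrC subrK.
rewrite mulrDl e2 /lift_defect; apply: tensorP => s _.
by rewrite !(tcoefD, tcoefN); ring.
Qed.

Let rho_ge0 u v : 0 <= rho u v. Proof. exact: powR_ge0. Qed.

Let rho_le x u v y : 0 <= x -> x <= u -> u <= v -> v <= y -> y <= T ->
  rho u v <= rho x y.
Proof.
move=> x0 xu uv vy yT; have u0 := le_trans x0 xu; have vT := le_trans vy yT.
apply: ge0_ler_powR; rewrite ?nnegrE ?invr_ge0 ?subr_ge0 ?(ltW p0)//.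
- exact: a_mono.
- by apply: a_mono => //; apply: le_trans xu (le_trans uv vy).
- apply: lerB; first by apply: a_mono => //; exact: le_trans uv.
  by apply: a_mono => //; exact: le_trans uv vT.
Qed.

Let tri (i : R * R * R) := [/\ 0 <= i.1.1, i.1.1 <= i.1.2, i.1.2 <= i.2 & i.2 <= T].

Let tri_inT i : tri i -> [/\ inT i.1.1, inT i.1.2 & inT i.2].
Proof.
move=> [h1 h2 h3 h4]; split; split=> //.
- exact: le_trans h2 (le_trans h3 h4).
- exact: le_trans h1 h2.
- exact: le_trans h3 h4.
- exact: le_trans h1 (le_trans h2 h3).
Qed.

(** Since e <= 1, (e l)^j <= e l^j for j >= 1, while in the scalar component the difference is 0. *)
Let near_one (e l : R * R * R -> R) (f : R * R * R -> tensor R d m) :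
  (forall i, tri i -> [/\ 0 <= e i, e i <= 1 & 0 <= l i]) ->
  (forall i, tri i -> f i [::] = 1 /\ forall s, `|f i s| <= (e i * l i) ^+ size s) ->
  near_bdd tri l e f (fun=> 1).
Proof.
move=> hel hf; split.
- exists 1 => // i /[dup] /hel[e0 e1 l0] /hf[_ h] s _; rewrite !mul1r.
  apply: le_trans (h s) _; rewrite lerXn2r ?nnegrE ?mulr_ge0//.
  by rewrite ler_piMl.
- by apply: bdd1 => i /hel[].
- exists 1 => // i /[dup] /hel[e0 e1 l0] /hf[h0 h] [|j s] _.
    by rewrite mul1r tcoefB h0 tcoef1 subrr normr0 expr0 mulr1.
  rewrite tcoefB tcoef1 subr0 mul1r; apply: le_trans (h _) _.
  rewrite exprMn ler_wpM2r ?exprn_ge0// [X in _ ^+ X]/= exprS ler_piMr//.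
  by rewrite exprn_ile1.
Qed.

(* Lifting commutes with a product of which one factor is 1: the defect is
   proportional to the distance of either factor to 1. *)
Let half_defect (b : bool) : exists2 C, 0 <= C & forall x u y, tri (x, u, y) ->
  forall s, size s = M -> `|(lifted_incr x y - lifted_incr x u * lifted_incr u y) s| <=
    C * ((if b then rho x u else rho u y) * rho x y ^+ m).
Proof.
pose l (i : R * R * R) := rho i.1.1 i.2.
pose small (i : R * R * R) := if b then rho i.1.1 i.1.2 else rho i.1.2 i.2.
(* If l i = 0 the quotient is 0, which is coherent because small i is then 0 too. *)
pose e i := small i / l i.
have small_le i : tri i -> small i <= l i.
  by case: i => -[x u] y [/= x0 xu uy yT]; rewrite /small /l; case: (b); apply: rho_le.
have small0 i : 0 <= small i by rewrite /small; case: (b).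
have el i : tri i -> e i * l i = small i.
  move=> /small_le; rewrite /e; have [->|ne] := eqVneq (l i) 0; last by rewrite mulfVK.
  by move=> h; rewrite mulr0; apply/eqP; rewrite eq_le h small0.
have e0 i : tri i -> 0 <= e i by move=> _; rewrite divr_ge0// /l.
have l0 i : tri i -> 0 <= l i by rewrite /l.
have e1 i : tri i -> e i <= 1.
  move=> /small_le h; rewrite /e; have [->|ne] := eqVneq (l i) 0; first by rewrite invr0 mulr0.
  by rewrite ler_pdivrMr ?mul1r// lt_neqAle eq_sym ne; exact: rho_ge0.
have bX (v w : R * R * R -> R) :
    (forall i, tri i -> [/\ 0 <= v i, v i <= w i, w i <= T & rho (v i) (w i) <= l i]) ->
    bdd tri l (fun i => path_incr (v i) (w i)).
  move=> h; exists 1 => // i hi s _; have [v0 vw wT hl] := h i hi.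
  rewrite !mul1r; apply: le_trans (xx_bound s v0 vw wT) _.
  by rewrite lerXn2r ?nnegrE ?rho_ge0 ?l0.
have b1 : bdd tri l (fun i => path_incr i.1.1 i.1.2).
  by apply: bX => -[[x u] y] [/= x0 xu uy yT]; split=> //; [exact: le_trans yT|exact: rho_le].
have b2 : bdd tri l (fun i => path_incr i.1.2 i.2).
  by apply: bX => -[[x u] y] [/= x0 xu uy yT]; split=> //; [exact: le_trans xu|exact: rho_le].
have n1 (v w : R * R * R -> R) :
    (forall i, tri i -> [/\ 0 <= v i, v i <= w i, w i <= T & rho (v i) (w i) = small i]) ->
    near_bdd tri l e (fun i => path_incr (v i) (w i)) (fun=> 1).
  move=> h; apply: near_one => i hi; first by split; auto.
  have [v0 vw wT hl] := h i hi; split.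
    by apply: xxnil; split=> //; [exact: le_trans vw wT|exact: le_trans v0 vw].
  by move=> s; rewrite el// -hl; exact: xx_bound.
have key : near_bdd tri l e (fun i => tlift M (path_incr i.1.1 i.1.2 * path_incr i.1.2 i.2))
    (fun i => tlift M (path_incr i.1.1 i.1.2) * tlift M (path_incr i.1.2 i.2)).
  case: b @small @e small_le small0 el e0 e1 n1 => small e small_le small0 el e0 e1 n1.
    apply: near_bdd_tliftMl => //.
    by apply: n1 => -[[x u] y] [/= x0 xu uy yT]; split=> //; exact: le_trans yT.
  apply: near_bdd_tliftMr => //.
  by apply: n1 => -[[x u] y] [/= x0 xu uy yT]; split=> //; exact: le_trans xu.
have [_ _ [C C0 hC]] := key; exists C => // x u y hxy s hs.
have [_ hu _] := tri_inT hxy.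
have := hC (x, u, y) hxy s; rewrite hs leqnn => /(_ isT).
rewrite /= xxM// -!zzE => /le_trans; apply.
by rewrite -mulrA ler_wpM2l// exprS mulrA el.
Qed.

Lemma lifted_incr_defect_bound : exists2 C, 0 <= C & forall x u y,
  0 <= x -> x <= u -> u <= y -> y <= T -> forall s, size s = M ->
    `|(lifted_incr x y - lifted_incr x u * lifted_incr u y) s| <=
      C * (Num.min (a u - a x) (a y - a u) `^ p^-1 * rho x y ^+ m).
Proof.
have [C C0 h] := half_defect true; have [C' C'0 h'] := half_defect false.
exists (C + C'); first exact: addr_ge0.
move=> x u y x0 xu uy yT s hs; have hxy : tri (x, u, y) by [].
rewrite minEle; case: ifP => _.
  apply: le_trans (h x u y hxy s hs) _.
  by rewrite ler_wpM2r ?mulr_ge0 ?exprn_ge0// lerDl.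
apply: le_trans (h' x u y hxy s hs) _.
by rewrite ler_wpM2r ?mulr_ge0 ?exprn_ge0// lerDr.
Qed.

(* The part [kappa] of the exponent [M / p] is spared for the factor of the
   defect that vanishes on an interval with a jump at one end. *)
Definition kappa : R := Num.min p^-1 ((M%:R / p - 1) / 2).
Definition theta : R := M%:R / p - kappa.

Lemma kappa_gt0 : 0 < kappa.
Proof. by rewrite lt_min invr_gt0 p0 divr_gt0// subr_gt0 ltr_pdivlMr// mul1r. Qed.

Lemma theta_gt1 : 1 < theta.
Proof.
have h : 1 < M%:R / p by rewrite ltr_pdivlMr// mul1r.
have : kappa <= (M%:R / p - 1) / 2 by rewrite ge_min lexx orbT.
by rewrite /theta; lra.
Qed.

(** Of the exponent 1/p of mu only kappa is kept; as mu <= l, the rest is given to l and completes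
    theta. *)
Lemma split_power (mu l : R) : 0 <= mu -> mu <= l ->
  mu `^ p^-1 * (l `^ p^-1) ^+ m <= mu `^ kappa * l `^ theta.
Proof.
move=> mu0 mul; have l0 := le_trans mu0 mul.
have k0 := kappa_gt0; have t1 := theta_gt1.
have kp : kappa <= p^-1 by rewrite ge_min lexx.
have -> : mu `^ p^-1 = mu `^ kappa * mu `^ (p^-1 - kappa).
  rewrite -powRD; first by rewrite addrC subrK.
  by rewrite addrC subrK invr_eq0 gt_eqF.
rewrite -mulrA ler_wpM2l ?powR_ge0//.
rewrite -powR_mulrn ?powR_ge0// -powRrM.
apply: (@le_trans _ _ (l `^ (p^-1 - kappa) * l `^ (p^-1 * m%:R))).
  rewrite ler_wpM2r ?powR_ge0//; apply: ge0_ler_powR => //.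
  by rewrite subr_ge0.
have e : theta = p^-1 - kappa + p^-1 * m%:R.
  by rewrite /theta -natr1 mulrDl mul1r mulrC; ring.
rewrite -powRD -?e//.
by rewrite gt_eqF// (lt_trans _ t1).
Qed.

(** When eta is the whole increment, the sewing error has the homogeneity of level M, which is what
    finite p-variation of the extension requires. *)
Lemma kappa_theta (l : R) : l `^ kappa * l `^ theta = (l `^ p^-1) ^+ M.
Proof.
have e : kappa + theta = p^-1 * M%:R by rewrite /theta addrC subrK mulrC.
rewrite -powRD; last by rewrite e mulf_eq0 invr_eq0 pnatr_eq0 gt_eqF.
by rewrite e powRrM powR_mulrn// powR_ge0.
Qed.

Lemma corrector : exists h : M.-tuple 'I_d -> R -> R, (forall w : M.-tuple 'I_d, h w 0 = 0) /\
  exists2 C, 0 <= C & forall (w : M.-tuple 'I_d) x y eta, 0 <= x -> x <= y -> y <= T -> 0 <= eta ->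
    (forall u, x < u -> u < y -> Num.min (a u - a x) (a y - a u) <= eta) ->
    `|h w y - h w x - lift_defect x y w| <= C * (eta `^ kappa * (a y - a x) `^ theta).
Proof.
have [C C0 hC] := lifted_incr_defect_bound.
have /choice[h hP] : forall w : M.-tuple 'I_d, exists h : R -> R, h 0 = 0 /\
    forall x y (eta : R), 0 <= x -> x <= y -> y <= T -> 0 <= eta ->
    (forall u, x < u -> u < y -> Num.min (a u - a x) (a y - a u) <= eta) ->
    `|h y - h x - lift_defect x y w| <=
      sewing_const theta * (C * eta `^ kappa) * (a y - a x) `^ theta.
  move=> w.
  have [||h h0 hP] := @sewing R T a (fun x y => lift_defect x y w) C kappa theta a_mono theta_gt1
    (ltW kappa_gt0) C0; last by exists h.
  - move=> u u0 uT; have hu : inT u by [].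
    rewrite /lift_defect zzE xxE mulVr ?Xunit// tlift1 mulr1 subrr tcoef0//.
  - move=> x u y x0 xu uy yT.
    have [hx hu hy] := @tri_inT (x, u, y) (And4 x0 xu uy yT).
    have := lift_defect_defect hx hu hy => /(congr1 (fun z : tensor R d M => z w)).
    rewrite [in X in X -> _]/= [X in X = _ -> _]tcoefB tcoefB => ->.
    apply: le_trans (hC x u y x0 xu uy yT w (size_tuple w)) _.
    rewrite -mulrA ler_wpM2l//; apply: split_power.
      by rewrite le_min !subr_ge0 !a_mono//; [exact: le_trans xu|exact: le_trans yT].
    by rewrite ge_min lerD2r a_mono// (le_trans x0).
exists h; split=> [w|]; first by case: (hP w).
exists (sewing_const theta * C); first by rewrite mulr_ge0 ?sewing_const_ge0 ?theta_gt1.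
move=> w x y eta x0 xy yT e0 he; have [_ /(_ x y eta x0 xy yT e0 he)] := hP w.
by rewrite !mulrA.
Qed.

(** * The corrected path: variation, one-sided limits and jumps *)

Section Corrected.
Variables (h : M.-tuple 'I_d -> R -> R) (C : R).
Hypotheses (h0 : forall w : M.-tuple 'I_d, h w 0 = 0) (C0 : 0 <= C).
Hypothesis h_sewn : forall (w : M.-tuple 'I_d) x y eta, 0 <= x -> x <= y -> y <= T -> 0 <= eta ->
  (forall u, x < u -> u < y -> Num.min (a u - a x) (a y - a u) <= eta) ->
  `|h w y - h w x - lift_defect x y w| <= C * (eta `^ kappa * (a y - a x) `^ theta).

(** The scalar paths enter as coefficients of brackets, so the value is Lie whatever they are; on
    the coordinates of the defect the same formula gives back the defect, by
    [lift_defect_dynkin]. *)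
Definition correction : R -> tensor R d M := locked_with path_key
  (fun t => M%:R^-1 *: \sum_(w : M.-tuple 'I_d) h w t *: wbr R M w).
(** The sewing error; by [xn_incr] it is exactly what the increments of the corrected path add to
    [lifted_incr]. *)
Definition correction_incr : R -> R -> tensor R d M := locked_with path_key
  (fun u v => correction v - correction u - lift_defect u v).
Definition corrected_path : R -> tensor R d M :=
  locked_with path_key (fun t => lifted_path t + correction t).

Let hhE t : correction t = M%:R^-1 *: \sum_(w : M.-tuple 'I_d) h w t *: wbr R M w.
Proof. by rewrite /correction unlock. Qed.
Let rrE u v : correction_incr u v = correction v - correction u - lift_defect u v.
Proof. by rewrite /correction_incr unlock. Qed.
Let xnE t : corrected_path t = lifted_path t + correction t.
Proof. by rewrite /corrected_path unlock. Qed.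

Let hh_vanish t : vanish M (correction t).
Proof.
rewrite hhE; apply/vanishZ/vanish_sum => w _; apply: vanishZ.
by apply: homog_vanish; rewrite -[in X in homog X _](size_tuple w); exact: homog_wbr.
Qed.

Let hh_lie t : free_lie (correction t).
Proof. by rewrite hhE; apply/lieZ/lie_sum => w _; apply/lieZ/lie_wbr. Qed.

Let hh0 : correction 0 = 0.
Proof.
rewrite hhE big1 ?scaler0// => w _.
by rewrite h0 scale0r.
Qed.

Let rr_vanish u v : inT u -> inT v -> vanish M (correction_incr u v).
Proof.
move=> hu hv; rewrite rrE; apply: vanishB; last exact: lift_defect_vanish.
exact: vanishB.
Qed.

Let rr_sum u v : inT u -> inT v -> correction_incr u v =
  M%:R^-1 *: \sum_(w : M.-tuple 'I_d) (h w v - h w u - lift_defect u v w) *: wbr R M w.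
Proof.
move=> hu hv.
have e : lift_defect u v = M%:R^-1 *: \sum_(w : M.-tuple 'I_d) lift_defect u v w *: wbr R M w.
  by rewrite -lift_defect_dynkin// scalerK// pnatr_eq0.
rewrite rrE !hhE {1}e -!scalerBr -!sumrB; congr (_ *: _).
by apply: eq_bigr => w _; rewrite !scalerBl.
Qed.

Let rr_bound : exists2 C', 0 <= C' & forall u v eta s, 0 <= u -> u <= v -> v <= T ->
  0 <= eta -> (forall x, u < x -> x < v -> Num.min (a x - a u) (a v - a x) <= eta) ->
  `|correction_incr u v s| <= C' * (eta `^ kappa * (a v - a u) `^ theta).
Proof.
exists (M%:R^-1 * \sum_(w : M.-tuple 'I_d) C * \sum_(s : M.-tuple 'I_d) `|wbr R M w s|).
  by rewrite mulr_ge0 ?invr_ge0// sumr_ge0// => w _; rewrite mulr_ge0// sumr_ge0.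
move=> u v eta s u0 uv vT e0 he.
have hu : inT u by split=> //; exact: le_trans vT.
have hv : inT v by split=> //; exact: le_trans uv.
have E0 : 0 <= eta `^ kappa * (a v - a u) `^ theta by rewrite mulr_ge0 ?powR_ge0.
have [hs|ne] := eqVneq (size s) M; last first.
  have -> : correction_incr u v s = 0.
    have [hs|hs] := ltnP (size s) M; first exact: rr_vanish.
    by rewrite tcoef_gt// ltn_neqAle eq_sym ne.
  rewrite normr0 mulr_ge0// mulr_ge0 ?invr_ge0// sumr_ge0// => w _.
  by rewrite mulr_ge0// sumr_ge0.
rewrite rr_sum// tcoefZ normrM ger0_norm ?invr_ge0// -mulrA ler_wpM2l ?invr_ge0//.
rewrite tcoef_sum (le_trans (ler_norm_sum _ _ _))// mulr_suml ler_sum// => w _.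
rewrite tcoefZ normrM mulrAC ler_pM//; first exact: h_sewn.
rewrite (bigD1 (Tuple (introT eqP hs)))//= lerDl sumr_ge0//.
Qed.

Let Gxn t : inT t -> free_group (corrected_path t).
Proof.
move=> ht; have -> : corrected_path t = lifted_path t * texp (correction t).
  by rewrite texp_top// mulrDr mulr1 mulx_top// ztnil// scale1r xnE.
apply: free_groupM; first exact: Gzt.
by exists (correction t) => //; exact: hh_lie.
Qed.

Let xn_step u v : inT u -> inT v ->
  corrected_path u * (lifted_incr u v + correction_incr u v) = corrected_path v.
Proof.
move=> hu hv; have vr := rr_vanish hu hv.
rewrite xnE mulrDl mulrDr (mulx_top (lifted_path u) vr) (ztnil hu) scale1r.
rewrite (mul_topx _ (hh_vanish u)) tcoefD (zznil hu hv) vr// addr0 scale1r xnE rrE /lift_defect.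
by apply: tensorP => s _; rewrite !(tcoefD, tcoefN); ring.
Qed.

Let xn_incr u v : inT u -> inT v ->
  (corrected_path u)^-1 * corrected_path v = lifted_incr u v + correction_incr u v.
Proof.
by move=> hu hv; rewrite -(xn_step hu hv) mulrA mulVr ?mul1r//; exact/free_group_unit/Gxn.
Qed.

Let zz_bound : exists2 C', 0 <= C' & forall u v s, 0 <= u -> u <= v -> v <= T ->
  (size s <= M)%N -> `|lifted_incr u v s| <= C' * rho u v ^+ size s.
Proof.
pose D (i : R * R) := [/\ 0 <= i.1, i.1 <= i.2 & i.2 <= T].
pose l (i : R * R) := rho i.1 i.2.
have l0 i : D i -> 0 <= l i by rewrite /l.
have b : bdd D l (fun i => path_incr i.1 i.2).
  exists 1 => // -[u v] [/= u0 uv vT] s _; rewrite !mul1r; exact: xx_bound.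
have [C' C'0 hC'] := bdd_tlift l0 M b; exists C' => // u v s u0 uv vT hs.
by have := hC' (u, v) (And3 u0 uv vT) s hs; rewrite /= mulr1 -zzE.
Qed.

Lemma corrected_path_controls : exists a', controls p T corrected_path a'.
Proof.
have [Cz Cz0 hz] := zz_bound; have [Cr Cr0 hr] := rr_bound.
have [K K0 hK] := @CC_norm_le R d M.
(* As c >= 1, the constant Cz + Cr is below c^j at each level j >= 1, and can be absorbed into the
   length as [CC_norm_le] asks. *)
pose c := 1 + (Cz + Cr).
have c1 : 1 <= c by rewrite lerDl addr_ge0.
have c0 : 0 <= c by exact: le_trans c1.
apply: (@controls_of_bound _ _ _ p T corrected_path a p1 (K * c)) => //; first exact: mulr_ge0.
move=> u v u0 /ltW uv vT.
have hu : inT u by split=> //; exact: le_trans vT.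
have hv : inT v by split=> //; exact: le_trans uv.
rewrite /CC_dist -mulrA; apply: hK; first by rewrite mulr_ge0.
  by apply: free_groupM; [exact/free_groupV/Gxn|exact: Gxn].
move=> s; rewrite xn_incr//.
have [hs|hs] := leqP (size s) M; last first.
  by rewrite tcoef_gt// normr0 exprn_ge0// mulr_ge0.
have [s0|s1] := posnP (size s).
  rewrite (size0nil s0) tcoefD (zznil hu hv) (rr_vanish hu hv)// addr0 normr1.
  by rewrite expr0.
have auv : 0 <= a v - a u by rewrite subr_ge0 a_mono.
have rb : `|correction_incr u v s| <= Cr * rho u v ^+ size s.
  have [e|ne] := eqVneq (size s) M.
    (* Here eta is the whole increment a v - a u. *)
    rewrite e /incr -kappa_theta; apply: hr => // x ux xv.
    rewrite ge_min lerD2r a_mono ?(ltW xv)//; exact: le_trans (ltW ux).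
  rewrite (rr_vanish hu hv) ?normr0 ?mulr_ge0 ?exprn_ge0//.
  by rewrite ltn_neqAle ne.
rewrite tcoefD (le_trans (ler_normD _ _))// (le_trans (lerD (hz _ _ _ u0 uv vT hs) rb))//.
rewrite -mulrDl exprMn ler_wpM2r ?exprn_ge0//.
apply: (@le_trans _ _ c); first by rewrite lerDr.
by rewrite -[leLHS]expr1 ler_weXn2l.
Qed.

Lemma corrected_path0 : corrected_path 0 = 1.
Proof. by rewrite xnE hh0 addr0 ztE X0 tlift1. Qed.

Lemma tresize_corrected_path t : inT t -> tresize m (corrected_path t) = X t.
Proof.
move=> ht; rewrite xnE tresizeD (resize_zt ht) -[RHS]addr0; congr (_ + _).
apply: tensorP => s hs; rewrite tresizeE hs tcoef0.
by apply: hh_vanish.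
Qed.

Let rr_small (e : R) : 0 < e -> exists2 eta : R, 0 < eta & forall u v s,
  0 <= u -> u <= v -> v <= T ->
  (forall x, u < x -> x < v -> Num.min (a x - a u) (a v - a x) <= eta) ->
  `|correction_incr u v s| <= e.
Proof.
move=> e0; have [C' C'0 hC'] := rr_bound.
(* An upper bound of the factor of eta^kappa on all intervals; the 1 makes it positive, and eta
   solves eta^kappa = e / B. *)
pose B := C' * (a T - a 0) `^ theta + 1.
have B0 : 0 < B by rewrite ltr_wpDl// mulr_ge0 ?powR_ge0.
have k0 := kappa_gt0.
exists ((e / B) `^ kappa^-1); first by rewrite powR_gt0 ?divr_gt0.
move=> u v s u0 uv vT hx; apply: le_trans (hC' u v _ s u0 uv vT (powR_ge0 _ _) hx) _.
have eB : 0 <= e / B by rewrite divr_ge0 ?ltW.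
rewrite -powRrM mulVf ?gt_eqF// powRr1//.
apply: (@le_trans _ _ (e / B * B)); last by rewrite mulfVK ?gt_eqF.
rewrite mulrCA ler_wpM2l// (le_trans _ (ler_wpDr ler01 (lexx _)))//.
rewrite ler_wpM2l//; apply: ge0_ler_powR.
- by rewrite ltW// (lt_trans ltr01 theta_gt1).
- by rewrite nnegrE subr_ge0 a_mono.
- by rewrite nnegrE subr_ge0 a_mono// (le_trans (le_trans u0 uv) vT).
- apply: lerB; first by apply: a_mono => //; exact: le_trans uv.
  by apply: a_mono => //; exact: le_trans uv vT.
Qed.

Let near_left t : 0 < t <= T -> \forall s \near t^'-, 0 <= s /\ s < t.
Proof.
move=> /andP[t0 tT]; near=> s; split; near: s; last exact: nbhs_left_lt.
by apply: filterS (nbhs_left_gt t0) => s /ltW.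
Unshelve. all: by end_near. Qed.

Let near_right t : 0 <= t < T -> \forall s \near t^'+, t < s /\ s <= T.
Proof.
move=> /andP[t0 tT]; near=> s; split; near: s; first exact: nbhs_right_gt.
by apply: filterS (nbhs_right_lt tT) => s /ltW.
Unshelve. all: by end_near. Qed.

Let rr_left t : 0 < t <= T -> tcvg t^'- (fun s : R => correction_incr s t) 0.
Proof.
move=> ht w; rewrite tcoef0; apply/cvgr0Pnorm_le => e /rr_small[eta eta0 he].
have /andP[t0 tT] := ht.
apply: filterS2 (near_left ht) (osc_left a_mono ht eta0) => s [s0 st] hs.
by apply: he => //; [exact: ltW|move=> x sx xt; rewrite ge_min hs].
Qed.

Let rr_right t : 0 <= t < T -> tcvg t^'+ (fun s : R => correction_incr t s) 0.
Proof.
move=> ht w; rewrite tcoef0; apply/cvgr0Pnorm_le => e /rr_small[eta eta0 he].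
have /andP[t0 tT] := ht.
apply: filterS2 (near_right ht) (osc_right a_mono ht eta0) => s [ts sT] hs.
by apply: he => //; [exact: ltW|move=> x sx xt; rewrite ge_min hs ?orbT].
Qed.

Lemma corrected_path_right t : 0 <= t < T -> tcvg t^'+ corrected_path (corrected_path t).
Proof.
move=> ht; have /andP[t0 tT] := ht; have it : inT t by split=> //; exact: ltW.
have hX := cadlag_right X_cadlag ht.
have cz : tcvg t^'+ (fun s : R => tlift M ((X t)^-1 * X s)) (tlift M ((X t)^-1 * X t)).
  by apply: tcvg_tlift; apply: tcvgM => //; exact: tcvg_cst.
have cr := rr_right ht.
have c : tcvg t^'+ (fun s : R =>
      corrected_path t * (1 *: tlift M ((X t)^-1 * X s) + correction_incr t s))
    (corrected_path t * (1 *: tlift M ((X t)^-1 * X t) + 0)).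
  by apply: tcvgM; [exact: tcvg_cst|exact: tcvg_lin].
have e : corrected_path t * (1 *: tlift M ((X t)^-1 * X t) + 0) = corrected_path t.
  by rewrite mulVr ?Xunit// tlift1 scale1r addr0 mulr1.
rewrite -[in X in tcvg _ _ X]e; apply: near_tcvg c.
apply: filterS (near_right ht) => s [ts sT].
have is_ : inT s by split=> //; exact: le_trans (ltW ts).
by rewrite scale1r -xxE -zzE xn_step.
Qed.

(** The limit is computed backwards from t: the path at s is its value at t times the inverse of the
    increment over [s, t]. That increment tends to the lift of the jump of X because the sewing
    error tends to 0. *)
Let xn_left_cvg t l : 0 < t <= T -> free_group l -> tcvg t^'- X l ->
  tcvg t^'- corrected_path (corrected_path t * (tlift M (l^-1 * X t))^-1).
Proof.
move=> ht Gl hX; have /andP[t0 tT] := ht; have it : inT t by split=> //; exact: ltW.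
have l1 := free_group0 Gl.
have G1 : free_group (l^-1 * X t) by apply: free_groupM; [exact: free_groupV|exact: GX].
have cz : tcvg t^'- (fun s : R => tlift M ((X s)^-1 * X t)) (tlift M (l^-1 * X t)).
  apply: tcvg_tlift; apply: tcvgM; last exact: tcvg_cst.
  apply: tcvg_inv => //; apply: filterS (near_left ht) => s [s0 st].
  by apply: Xnil; split=> //; apply: le_trans tT; exact: ltW.
have cw : tcvg t^'- (fun s : R => 1 *: tlift M ((X s)^-1 * X t) + correction_incr s t)
    (tlift M (l^-1 * X t)).
  have := rr_left ht; rewrite -[tlift M (l^-1 * X t)]addr0 -[tlift M (l^-1 * X t)]scale1r.
  exact: tcvg_lin.
have nice : \forall s \near t^'-,
    [/\ inT s & 1 *: tlift M ((X s)^-1 * X t) + correction_incr s t =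
          lifted_incr s t + correction_incr s t].
  apply: filterS (near_left ht) => s [s0 st].
  split; first by split=> //; apply: le_trans tT; exact: ltW.
  by rewrite scale1r -xxE -zzE.
have c : tcvg t^'- (fun s : R =>
      corrected_path t * (1 *: tlift M ((X s)^-1 * X t) + correction_incr s t)^-1)
    (corrected_path t * (tlift M (l^-1 * X t))^-1).
  apply: tcvgM; first exact: tcvg_cst.
  apply: tcvg_inv => //; last by rewrite tlift_nil//; exact: free_group0.
  apply: filterS nice => s [is_ ->].
  by rewrite tcoefD (zznil is_ it) (rr_vanish is_ it)// addr0.
apply: near_tcvg c; apply: filterS nice => s [is_ ->].
have u1 : lifted_incr s t + correction_incr s t \is a GRing.unit.
  by rewrite -xn_incr//; apply/free_group_unit/free_groupM; [exact/free_groupV/Gxn|exact: Gxn].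
by rewrite -(xn_step is_ it) mulrK.
Qed.

Lemma corrected_path_left t : 0 < t <= T -> exists2 l, free_group l & tcvg t^'- corrected_path l.
Proof.
move=> ht; have [l Gl hl] := cadlag_left X_cadlag ht.
exists (corrected_path t * (tlift M (l^-1 * X t))^-1); last exact: xn_left_cvg.
have /andP[t0 tT] := ht; have it : inT t by split=> //; exact: ltW.
apply: free_groupM; first exact: Gxn.
apply/free_groupV/free_group_tlift => //.
by apply: free_groupM; [exact: free_groupV|exact: GX].
Qed.

Lemma corrected_path_cadlag : cadlag_in (@free_group R d M) T corrected_path.
Proof.
split; last exact: corrected_path_left.
- by move=> t /andP[t0 tT]; exact: Gxn.
- by move=> t ht w; exact: corrected_path_right.
Qed.

(** By [xn_left_cvg] the jump is the lift of the jump of X, and lifting preserves the logarithm. *)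
Lemma corrected_path_jump t : 0 < t <= T ->
  tlog (jump corrected_path t) = tresize M (tlog (jump X t)).
Proof.
move=> ht; have [l Gl hl] := cadlag_left X_cadlag ht.
have /andP[t0 tT] := ht; have it : inT t by split=> //; exact: ltW.
have G1 : free_group (l^-1 * X t) by apply: free_groupM; [exact: free_groupV|exact: GX].
have GJ : free_group (tlift M (l^-1 * X t)) by exact: free_group_tlift.
rewrite /jump (left_limitE hl) (left_limitE (xn_left_cvg ht Gl hl)).
rewrite invrM ?unitrV ?free_group_unit//; last exact: Gxn.
rewrite invrK mulrVK ?free_group_unit ?tlog_tlift//; first exact: free_group0.
exact: Gxn.
Qed.

End Corrected.

End Extension.

Definition jump_extension (R : realType) d m n (p T : R) (X : R -> tensor R d m)
    (Y : R -> tensor R d n) :=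
  [/\ cadlag_in (@free_group R d n) T Y,
      forall t, 0 <= t <= T -> tresize m (Y t) = X t,
      Y 0 = 1,
      finite_pvar p T Y
    & forall t, 0 < t <= T -> tlog (jump Y t) = tresize n (tlog (jump X t))].

Lemma level_extension (R : realType) d m (p T : R) (X : R -> tensor R d m) :
  1 <= p -> p < m.+1%:R -> 0 < T -> cadlag_in (@free_group R d m) T X -> X 0 = 1 ->
  finite_pvar p T X -> exists Y : R -> tensor R d m.+1, jump_extension p T X Y.
Proof.
move=> p1 pm T0 cX X0 vX; have [a ca] := pvar_control (ltW T0) vX.
have [h [h0 [C C0 hC]]] := corrector p1 pm cX ca.
exists (corrected_path X h); split.
- exact: (corrected_path_cadlag p1 pm cX ca C0 hC).
- by move=> t /andP[t0 tT]; apply: tresize_corrected_path cX _ _ _.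
- exact: corrected_path0.
- have [a' ca'] := corrected_path_controls p1 cX ca C0 hC.
  exact: pvar_of_control ca'.
- by move=> t ht; apply: (corrected_path_jump p1 pm cX ca C0 hC ht).
Qed.

(** * Uniqueness and induction on the level *)

Section Uniqueness.
Variables (R : realType) (d m : nat) (p T : R) (Y1 Y2 : R -> tensor R d m.+1).
Hypotheses (p1 : 1 <= p) (pm : p < m.+1%:R) (T0 : 0 < T).
Hypotheses (cY1 : cadlag_in (@free_group R d m.+1) T Y1)
  (cY2 : cadlag_in (@free_group R d m.+1) T Y2).
Hypotheses (vY1 : finite_pvar p T Y1) (vY2 : finite_pvar p T Y2).
Hypothesis Y0 : Y1 0 = Y2 0.
Hypothesis Ym : forall t, 0 <= t <= T -> tresize m (Y1 t) = tresize m (Y2 t).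
Hypothesis YJ : forall t, 0 < t <= T -> tlog (jump Y1 t) = tlog (jump Y2 t).

Local Notation M := m.+1.

Let G1 t : 0 <= t <= T -> free_group (Y1 t).
Proof. by case: cY1 => h _ _; exact: h. Qed.

Let G2 t : 0 <= t <= T -> free_group (Y2 t).
Proof. by case: cY2 => h _ _; exact: h. Qed.

Let diff_vanish t : 0 <= t <= T -> vanish M (Y1 t - Y2 t).
Proof. by move=> ht; apply: resize_vanish; rewrite tresizeB Ym// subrr. Qed.

(** The two paths differ at the top level only, where group factors act as 1; so the increments of
    the difference inherit the bounds on the group increments. *)
Let diff_incr u v : 0 <= u <= T -> 0 <= v <= T ->
  (Y1 v - Y2 v) - (Y1 u - Y2 u) = (Y1 u)^-1 * Y1 v - (Y2 u)^-1 * Y2 v.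
Proof.
move=> hu hv; set I1 := _ * Y1 v; set I2 := _ * Y2 v.
have e1 : Y1 u * I1 = Y1 v by rewrite /I1 mulrA mulrV ?mul1r//; exact/free_group_unit/G1.
have e2 : Y2 u * I2 = Y2 v by rewrite /I2 mulrA mulrV ?mul1r//; exact/free_group_unit/G2.
have GI2 : free_group I2 by apply: free_groupM; [exact/free_groupV/G2|exact: G2].
have vI : vanish M (I1 - I2).
  apply: resize_vanish; rewrite tresizeB /I1 /I2 !tresizeM// !tresizeV ?(Ym hu) ?(Ym hv) ?subrr//.
    exact/free_group0/G2.
  exact/free_group0/G1.
have f1 : Y1 u * (I1 - I2) = I1 - I2.
  by rewrite mulx_top// (free_group0 (G1 hu)) scale1r.
have f2 : (Y1 u - Y2 u) * I2 = Y1 u - Y2 u.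
  by rewrite mul_topx ?(free_group0 GI2) ?scale1r//; exact: diff_vanish.
rewrite -[RHS]f1 -[in LHS]f2 -[in LHS]e1 -[in LHS]e2 mulrBr mulrBl.
by apply: tensorP => s _; rewrite !(tcoefD, tcoefN); ring.
Qed.

(** Both paths are their left limit times the same jump, which acts as 1 on l1 - l2, an element of
    the top level. Equal jumps thus make the difference left continuous. *)
Let diff_left t : 0 < t <= T -> forall s, (Y1 x - Y2 x) s @[x --> t^'-] --> (Y1 t - Y2 t) s.
Proof.
move=> ht; have /andP[t0 tT] := ht; have it : 0 <= t <= T by rewrite ltW.
have [l1 Gl1 h1] := cadlag_left cY1 ht; have [l2 Gl2 h2] := cadlag_left cY2 ht.
have GJ1 : free_group (l1^-1 * Y1 t) by apply: free_groupM; [exact: free_groupV|exact: G1].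
have GJ2 : free_group (l2^-1 * Y2 t) by apply: free_groupM; [exact: free_groupV|exact: G2].
have eJ : l1^-1 * Y1 t = l2^-1 * Y2 t.
  have := YJ ht; rewrite /jump (left_limitE h1) (left_limitE h2) => e.
  by rewrite -(tlogK (free_group0 GJ1)) e tlogK//; exact: free_group0.
have h : tcvg t^'- (fun x : R => -1 *: Y2 x + Y1 x) (-1 *: l2 + l1) by exact: tcvg_lin.
have vl : vanish M (l1 - l2).
  move=> s hs; rewrite tcoefB; apply/eqP; rewrite subr_eq0; apply/eqP.
  apply: (cvg_unique _ (h1 s)) => //; apply: cvg_trans (h2 s); apply: near_eq_cvg.
  near=> x; have hx : 0 <= x <= T.
    apply/andP; split; apply/ltW; first by near: x; exact: nbhs_left_gt.
    apply: lt_le_trans tT; near: x; exact: nbhs_left_lt.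
  have := diff_vanish hx hs; rewrite tcoefB => /eqP.
  by rewrite subr_eq0 => /eqP.
have e : Y1 t - Y2 t = l1 - l2.
  have u1 := free_group_unit Gl1; have u2 := free_group_unit Gl2.
  rewrite -[Y1 t](mulVKr u1) -[Y2 t](mulVKr u2) eJ -mulrBl mul_topx//.
  by rewrite (free_group0 GJ2) scale1r.
move=> s; rewrite e.
have -> : (fun x => (Y1 x - Y2 x) s) = (fun x => (-1 *: Y2 x + Y1 x) s).
  by apply/funext => x; rewrite scaleN1r addrC.
by have := h s; rewrite scaleN1r addrC.
Unshelve. all: by end_near. Qed.

Let diff_right t : 0 <= t < T -> forall s, (Y1 x - Y2 x) s @[x --> t^'+] --> (Y1 t - Y2 t) s.
Proof.
move=> ht s.
have -> : (fun x => (Y1 x - Y2 x) s) = (fun x => Y1 x s - Y2 x s).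
  by apply/funext => x; rewrite tcoefB.
by rewrite tcoefB; apply: cvgB; [exact: (cadlag_right cY1 ht)|exact: (cadlag_right cY2 ht)].
Qed.

Lemma level_unique t : 0 <= t <= T -> Y1 t = Y2 t.
Proof.
move=> ht; have [a1 c1] := pvar_control (ltW T0) vY1.
have [a2 c2] := pvar_control (ltW T0) vY2.
pose a x := a1 x + a2 x.
have p0 : 0 < p by exact: lt_le_trans p1.
have am : nondecr a T.
  by move=> u v u0 uv vT; apply: lerD; [exact: c1.1|exact: c2.1].
have powle (x y : R) : 0 <= x -> x <= y -> (x `^ p^-1) ^+ M <= y `^ (M%:R / p).
  move=> x0 xy; rewrite -powR_mulrn ?powR_ge0// -powRrM mulrC.
  apply: ge0_ler_powR; rewrite ?nnegrE//; first by rewrite divr_ge0// ltW.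
  exact: le_trans xy.
apply/eqP; rewrite -subr_eq0; apply/eqP/tensorP => s hs; rewrite tcoef0.
have [eM|ne] := eqVneq (size s) M; last by rewrite diff_vanish// ltn_neqAle ne.
transitivity ((Y1 0 - Y2 0) s); last by rewrite Y0 subrr tcoef0.
(* Each path contributes, at level M, the power M / p > 1 of the common control: hence the constant
   2. *)
apply: (@small_variation_cst R a T (M%:R / p) 2 (fun x => (Y1 x - Y2 x) s)) => //.
- by rewrite ltr_pdivlMr// mul1r.
- apply/continuous_within_itvP => //; split.
  + move=> x; rewrite in_itv/= => /andP[x0 xT]; apply/left_right_continuousP; split.
      by apply: diff_left; rewrite x0 ltW.
    by apply: diff_right; rewrite ltW.
  + by apply: diff_right; rewrite lexx.
  + by apply: diff_left; rewrite T0 lexx.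
move=> u v u0 uv vT.
have hu : 0 <= u <= T by rewrite u0 (le_trans uv).
have hv : 0 <= v <= T by rewrite (le_trans u0 uv).
have h1 := controls_bound p1 s c1 u0 uv vT (free_group_unit (G1 hv)).
have h2 := controls_bound p1 s c2 u0 uv vT (free_group_unit (G2 hv)).
rewrite -tcoefB diff_incr// tcoefB (le_trans (ler_normB _ _))//.
apply: (le_trans (lerD h1 h2)); rewrite eM mulr_natl mulr2n.
have d1 : 0 <= a1 v - a1 u by rewrite subr_ge0 c1.1.
have d2 : 0 <= a2 v - a2 u by rewrite subr_ge0 c2.1.
by rewrite lerD// powle// /a; lra.
Qed.

End Uniqueness.

(** * Projection to a lower level *)

Section Projection.
Variables (R : realType) (d k l : nat) (p T : R).
Hypotheses (lk : (l <= k)%N) (p0 : 0 <= p).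
Implicit Types (Y : R -> tensor R d k).

Lemma CC_norm_tresize (g : tensor R d k) : (CC_norm (tresize l g) <= CC_norm g)%E.
Proof.
apply: le_ereal_inf => _ [gamma [cg lg sg] <-]; exists gamma => //; split=> //.
rewrite -sg; apply: tensorP => s hs.
by rewrite tresizeE hs !mktE hs (leq_trans hs lk).
Qed.

Lemma tresize_cadlag Y : cadlag_in (@free_group R d k) T Y ->
  cadlag_in (@free_group R d l) T (fun t => tresize l (Y t)).
Proof.
move=> cY; split=> [t ht|t ht w|t ht].
- by case: cY => h _ _; apply: tresize_free_group => //; exact: h.
- exact: (tcvg_tresize (cadlag_right cY ht)).
- have [g Gg hg] := cadlag_left cY ht.
  exists (tresize l g); first exact: tresize_free_group.
  exact: (tcvg_tresize hg).
Qed.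

Lemma tresize_jump Y t : cadlag_in (@free_group R d k) T Y -> 0 < t <= T ->
  jump (fun t => tresize l (Y t)) t = tresize l (jump Y t).
Proof.
move=> cY ht; have [g Gg hg] := cadlag_left cY ht.
rewrite /jump (left_limitE hg) (left_limitE (tcvg_tresize hg)) tresizeM// tresizeV//.
exact: free_group0.
Qed.

Lemma jump_nil Y t : cadlag_in (@free_group R d k) T Y -> 0 < t <= T ->
  jump Y t [::] = 1.
Proof.
move=> cY ht; have [g Gg hg] := cadlag_left cY ht.
rewrite /jump (left_limitE hg); apply: free_group0.
apply: free_groupM; first exact: free_groupV.
by case: cY => h _ _; apply: h; case/andP: ht => /ltW -> ->.
Qed.

Lemma tresize_pvar Y : 0 <= T -> cadlag_in (@free_group R d k) T Y ->
  finite_pvar p T Y -> finite_pvar p T (fun t => tresize l (Y t)).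
Proof.
move=> T0 cY /(pvar_control T0)[a [am ha]]; apply: (@pvar_of_control _ _ _ _ _ _ a).
split=> // u v u0 uv vT; apply: le_trans (ha u v u0 uv vT).
have Yu : Y u [::] = 1.
  by apply: free_group0; case: cY => h _ _; apply: h; rewrite u0 (le_trans (ltW uv)).
apply: gt0_ler_poweR => //; rewrite ?in_itv/= ?leey ?andbT ?CC_norm_ge0//.
by rewrite /CC_dist -tresizeV// -tresizeM//; exact: CC_norm_tresize.
Qed.

End Projection.

(** * Induction on the level *)

Section Induction.
Variables (R : realType) (d m : nat) (p T : R) (X : R -> tensor R d m).
Hypotheses (p1 : 1 <= p) (pm : p < m.+1%:R) (T0 : 0 < T).
Hypotheses (cX : cadlag_in (@free_group R d m) T X) (X0 : X 0 = 1).
Hypothesis vX : finite_pvar p T X.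

Let p_lt n : (m <= n)%N -> p < n.+1%:R.
Proof. by move=> mn; rewrite (lt_le_trans pm)// ler_nat ltnS. Qed.

Lemma jump_extension_exists n : (m <= n)%N ->
  exists Y : R -> tensor R d n, jump_extension p T X Y.
Proof.
elim: n => [|n IH]; last rewrite leq_eqVlt => /predU1P[e|].
- rewrite leqn0 => /eqP e; move: (X) cX X0 vX; rewrite e => X' cX' X'0 vX'.
  by exists X'; split=> // t _; rewrite tresize_id.
- move: (X) cX X0 vX; rewrite e => X' cX' X'0 vX'.
  by exists X'; split=> // t _; rewrite tresize_id.
rewrite ltnS => mn; have [Y [cY Ym Y0 vY JY]] := IH mn.
have [Z [cZ Zn Z0 vZ JZ]] := level_extension p1 (p_lt mn) T0 cY Y0 vY.
exists Z; split=> // t ht; last by rewrite JZ// JY// tresize_up_up.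
by rewrite -(tresize_tresize (l := n))// Zn// Ym.
Qed.

Lemma jump_extension_unique n (Y1 Y2 : R -> tensor R d n) : (m <= n)%N ->
  jump_extension p T X Y1 -> jump_extension p T X Y2 ->
  forall t, 0 <= t <= T -> Y1 t = Y2 t.
Proof.
have base (Z1 Z2 : R -> tensor R d m) : jump_extension p T X Z1 ->
    jump_extension p T X Z2 -> forall t, 0 <= t <= T -> Z1 t = Z2 t.
  move=> [_ h1 _ _ _] [_ h2 _ _ _] t ht.
  by rewrite -(tresize_id (Z1 t)) -(tresize_id (Z2 t)) h1// h2.
elim: n Y1 Y2 => [|n IH] Y1 Y2; last rewrite leq_eqVlt => /predU1P[e|].
- rewrite leqn0 => /eqP e; move: Y1 Y2; rewrite -e; exact: base.
- move: Y1 Y2; rewrite -e; exact: base.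
rewrite ltnS => mn E1 E2.
(* The condition on jumps survives because including into level n + 1 and projecting to level n is
   the inclusion into level n. *)
have proj (Z : R -> tensor R d n.+1) : jump_extension p T X Z ->
    jump_extension p T X (fun t => tresize n (Z t)).
  move=> [cZ Zm Z0 vZ JZ]; split.
  - exact: tresize_cadlag.
  - by move=> t ht; rewrite tresize_tresize// Zm.
  - by rewrite Z0 tresize1.
  - by apply: tresize_pvar => //; [exact: le_trans p1|exact: ltW].
  - move=> t ht; rewrite (tresize_jump _ cZ ht)// -tresize_tlog// ?(jump_nil cZ ht)//.
    by rewrite JZ// tresize_tresize.
have En := IH _ _ mn (proj _ E1) (proj _ E2).
case: E1 E2 => [c1 _ z1 v1 J1] [c2 _ z2 v2 J2] t ht.
apply: (level_unique p1 (p_lt mn) T0 c1 c2 v1 v2 _ _ _ ht) => //.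
  by rewrite z1 z2.
by move=> x hx; rewrite J1// J2.
Qed.

End Induction.

Theorem theorem23 (R : realType) (d m n : nat) (p T : R) (Xm : R -> tensor R d m)
  (hp : 1 <= p) (hm : m = Num.truncn p) (hmn : (m < n)%N) (hT : 0 < T)
  (Xm_cadlag : cadlag_in (@free_group R d m) T Xm) (Xm_0 : Xm 0 = 1)
  (Xm_pvar : finite_pvar p T Xm) :
  let is_min_jump_ext (X : R -> tensor R d n) : Prop :=
    [/\ cadlag_in (@free_group R d n) T X,
        forall t, 0 <= t <= T -> tresize m (X t) = Xm t,
        X 0 = 1,
        finite_pvar p T X
      & forall t, 0 < t <= T ->
          tlog (jump X t) = tresize n (tlog (jump Xm t))] in
  exists2 Xn : R -> tensor R d n, is_min_jump_ext Xn &
    forall Y : R -> tensor R d n, is_min_jump_ext Y ->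
      forall t, 0 <= t <= T -> Y t = Xn t.
Proof.
have pm : p < m.+1%:R by rewrite hm; have /andP[] := Num.Theory.truncn_itv (le_trans ler01 hp).
have mn := ltnW hmn.
have [Xn hXn] := jump_extension_exists hp pm hT Xm_cadlag Xm_0 Xm_pvar mn.
exists Xn => // Y hY t ht; by apply: (jump_extension_unique hp pm hT mn hY hXn).
Qed.
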